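(* Let $P_n$ be the Kalman prediction covariances and $p_n$ the (normalised) sample covariances of the Ensemble Kalman filter with $N+1$ particles, $N\ge 1$. (1) For any $n\geq 1$, $$0<R\leq \mathbb{E}(p_{n})\leq P_n\leq AS^{-1}A'+R .$$ (2) There exists some $\iota>0$ (independent of $n$ and $N$) such that for any $n\geq 0$ and $N>1+d$, $$0\leq P_n-\mathbb{E}(p_n)\leq \frac{\iota}{N}\, I .$$ (3) For any $r\geq 1$ there is a finite constant $c(r)$ (independent of $n$ and $N$) such that for any $N>1+d$, $$\sup_{n\geq 0}\mathbb{E}\left(\Vert p_n-P_n\Vert^r\right)^{1/r}\leq \frac{c(r)}{\sqrt{N}} .$$
   Context: $M'$ denotes the transpose of a matrix, $I$ the identity matrix; $\le,<$ between symmetric matrices is the Loewner order ($M_1\ge M_2$ iff $M_1-M_2$ is positive semi-definite, $M_1>M_2$ iff $M_1-M_2$ is positive definite). $\|\cdot\|$ is any fixed matrix norm (e.g. spectral or Frobenius). Model. Fix $d,d_0\ge1$, $A\in\mathbb{R}^{d\times d}$, $B\in\mathbb{R}^{d_0\times d}$, and symmetric positive definite $R\in\mathbb{R}^{d\times d}$, $R_0\in\mathbb{R}^{d_0\times d_0}$, $P_0\in\mathbb{R}^{d\times d}$. The signal-observation process is $X_{n+1}=AX_n+W_n$, $Y_n=BX_n+V_n$, $n\ge0$, where $W_n\sim\mathcal N(0,R)$, $V_n\sim\mathcal N(0,R_0)$ are independent sequences of independent variables, independent of the Gaussian variable $X_0$ which has covariance $P_0$. Put $S:=B'R_0^{-1}B$,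 assumed positive definite. For positive semi-definite $P$ set $K(P):=PB'(BPB'+R_0)^{-1}$ and $\Phi(P):=A(I+PS)^{-1}PA'+R$. The one-step prediction covariances satisfy $P_{n+1}=\Phi(P_n)$, started at $P_0$. Ensemble Kalman filter. For $N\ge1$ let $\xi_0^i$, $1\le i\le N+1$, be independent copies of $X_0$ and let $\mathcal W_n^i\sim\mathcal N(0,R)$, $\mathcal V^i_n\sim\mathcal N(0,R_0)$ be independent, all independent of each other and of $(X_n,Y_n)_{n\ge0}$. Define for $n\ge 0$, $1\le i\le N+1$ $$\widehat\xi_n^i=\xi_n^i+K(p_n)\big(Y_n-(B\xi_n^i+\mathcal V_n^i)\big),\qquad \xi_{n+1}^i=A\widehat\xi_n^i+\mathcal W_{n+1}^i,$$ where $m_n=\frac1{N+1}\sum_{i=1}^{N+1}\xi_n^i$ and $p_n=\frac1N\sum_{i=1}^{N+1}(\xi_n^i-m_n)(\xi_n^i-m_n)'$. *)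

(* Defs.v *)
From HB Require Import structures.
From mathcomp Require Import all_boot all_order all_algebra.
From mathcomp Require Import all_classical all_reals all_analysis.

Set Implicit Arguments.
Unset Strict Implicit.
Unset Printing Implicit Defensive.

Import Order.TTheory GRing.Theory Num.Theory.
Import numFieldNormedType.Exports.

Local Open Scope classical_set_scope.
Local Open Scope ring_scope.

Definition psdmx (F : realType) (k : nat) (M : 'M[F]_k) : Prop :=
  M^T = M /\ forall u : 'cV[F]_k, 0 <= (u^T *m M *m u) 0 0.

Definition pdmx (F : realType) (k : nat) (M : 'M[F]_k) : Prop :=
  M^T = M /\ forall u : 'cV[F]_k, u != 0 -> 0 < (u^T *m M *m u) 0 0.

Definition loewner_le (F : realType) (k : nat) (M1 M2 : 'M[F]_k) : Prop :=
  psdmx (M2 - M1).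

Definition loewner_lt (F : realType) (k : nat) (M1 M2 : 'M[F]_k) : Prop :=
  pdmx (M2 - M1).

Notation "M1 <=L M2" := (loewner_le M1 M2) (at level 70, no associativity).
Notation "M1 <L M2" := (loewner_lt M1 M2) (at level 70, no associativity).

(* An arbitrary norm on the vector space of matrices: spectral, Frobenius, etc.
   Submultiplicativity is not required. *)
Record matrix_norm (F : realType) (k l : nat) (nu : 'M[F]_(k, l) -> F) :
    Prop := MatrixNorm {
  matrix_norm_eq0 : forall M, nu M = 0 -> M = 0 ;
  matrix_normZ : forall a M, nu (a *: M) = `|a| * nu M ;
  matrix_normD : forall M1 M2, nu (M1 + M2) <= nu M1 + nu M2 }.

Section RandomVectors.
Context (F : realType) (disp : measure_display) (T : measurableType disp)
  (Pr : probability T F).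

Definition random_vector (k : nat) (X : T -> 'cV[F]_k) : Prop :=
  forall i, measurable_fun setT (fun w => X w i 0).

Definition sigma_vector (k : nat) (X : T -> 'cV[F]_k) : set (set T) :=
  g_sigma_preimage (fun (i : 'I_k) (w : T) => X w i 0 : measurableTypeR F).

(* [v] is the variance, whereas [normal_prob] takes a standard deviation and
   is not a Dirac mass when the latter is 0. *)
Definition normal_law (m v : F) (E : set (measurableTypeR F)) : \bar F :=
  if v == 0 then \d_m E else normal_prob m (Num.sqrt v) E.

(* X ~ N(m, C), in the sense that u'X ~ N(u'm, u'Cu) for every u *)
Definition gaussian_vector (k : nat) (X : T -> 'cV[F]_k)
    (m : 'cV[F]_k) (C : 'M[F]_k) : Prop :=
  random_vector X /\
  forall (u : 'cV[F]_k) (E : set (measurableTypeR F)), measurable E ->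
    Pr [set w | E ((u^T *m X w) 0 0)] =
    normal_law ((u^T *m m) 0 0) ((u^T *m C *m u) 0 0) E.

(* Product rule for every finite subfamily; finite subsets of the index type
   are given by injections from some 'I_k. *)
Definition mutually_independent (I : Type) (G : I -> set (set T)) : Prop :=
  forall (k : nat) (j : 'I_k -> I), injective j ->
  forall E : 'I_k -> set T, (forall l, G (j l) (E l)) ->
    Pr (\bigcap_(l in [set: 'I_k]) E l) = (\prod_(l < k) Pr (E l))%E.

Definition mx_integrable (k l : nat) (M : T -> 'M[F]_(k, l)) : Prop :=
  forall i j, Pr.-integrable setT (fun w => (M w i j)%:E).

(* Only meaningful under [mx_integrable M] because of [fine]. *)
Definition mx_expectation (k l : nat) (M : T -> 'M[F]_(k, l)) : 'M[F]_(k, l) :=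
  \matrix_(i, j) fine ('E_Pr[fun w => M w i j])%E.

End RandomVectors.

Section KalmanFilter.
Context (F : realType) (d d0 : nat) (A : 'M[F]_d) (B : 'M[F]_(d0, d))
  (R : 'M[F]_d) (R0 : 'M[F]_d0).

Definition obs_S : 'M[F]_d := B^T *m invmx R0 *m B.

Definition gain (P : 'M[F]_d) : 'M[F]_(d, d0) :=
  P *m B^T *m invmx (B *m P *m B^T + R0).

Definition riccati (P : 'M[F]_d) : 'M[F]_d :=
  A *m invmx (1%:M + P *m obs_S) *m P *m A^T + R.

Definition kalman_cov (P0 : 'M[F]_d) (n : nat) : 'M[F]_d := iter n riccati P0.

End KalmanFilter.

Section Samples.
Context (F : realType) (d N : nat).

Definition sample_mean (xi : 'I_N.+1 -> 'cV[F]_d) : 'cV[F]_d :=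
  N.+1%:R^-1 *: \sum_i xi i.

Definition sample_cov (xi : 'I_N.+1 -> 'cV[F]_d) : 'M[F]_d :=
  N%:R^-1 *: \sum_i ((xi i - sample_mean xi) *m (xi i - sample_mean xi)^T).

End Samples.

(* Labels of the independent random inputs: X_0, W_n, V_n for the signal and
   the observation, xi_0^i, calW_n^i, calV_n^i for the ensemble. *)
Inductive noise_label (N : nat) : Type :=
  | LabX0 | LabW of nat | LabV of nat
  | LabXi0 of 'I_N.+1 | LabCW of nat & 'I_N.+1 | LabCV of nat & 'I_N.+1.

(* The random inputs of the model and of its ensemble of N + 1 particles, on
   some probability space. Since sigma(X_n, Y_n, n >= 0) is generated by
   X_0, (W_n), (V_n), all the independence assumptions together amount to the
   mutual independence of the inputs. *)
Record enkf_input (F : realType) (d d0 : nat) (R : 'M[F]_d) (R0 : 'M[F]_d0)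
    (m0 : 'cV[F]_d) (P0 : 'M[F]_d) (N : nat) := EnkfInput {
  in_disp : measure_display ;
  Omega : measurableType in_disp ;
  Prob : probability Omega F ;
  X0 : Omega -> 'cV[F]_d ;
  W : nat -> Omega -> 'cV[F]_d ;
  V : nat -> Omega -> 'cV[F]_d0 ;
  xi0 : 'I_N.+1 -> Omega -> 'cV[F]_d ;
  calW : nat -> 'I_N.+1 -> Omega -> 'cV[F]_d ;
  calV : nat -> 'I_N.+1 -> Omega -> 'cV[F]_d0 ;
  X0_gaussian : gaussian_vector Prob X0 m0 P0 ;
  W_gaussian : forall n, gaussian_vector Prob (W n) 0 R ;
  V_gaussian : forall n, gaussian_vector Prob (V n) 0 R0 ;
  xi0_gaussian : forall i, gaussian_vector Prob (xi0 i) m0 P0 ;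
  calW_gaussian : forall n i, gaussian_vector Prob (calW n i) 0 R ;
  calV_gaussian : forall n i, gaussian_vector Prob (calV n i) 0 R0 ;
  inputs_independent : mutually_independent Prob
    (fun a : noise_label N => match a with
      | LabX0 => sigma_vector X0
      | LabW n => sigma_vector (W n)
      | LabV n => sigma_vector (V n)
      | LabXi0 i => sigma_vector (xi0 i)
      | LabCW n i => sigma_vector (calW n i)
      | LabCV n i => sigma_vector (calV n i)
      end) }.

Section EnsembleKalmanFilter.
Context (F : realType) (d d0 : nat) (A : 'M[F]_d) (B : 'M[F]_(d0, d))
  (R : 'M[F]_d) (R0 : 'M[F]_d0) (m0 : 'cV[F]_d) (P0 : 'M[F]_d) (N : nat)
  (S : enkf_input R R0 m0 P0 N).

Fixpoint signal (n : nat) (w : Omega S) : 'cV[F]_d :=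
  if n is k.+1 then A *m signal k w + W k w else X0 w.

Definition observation (n : nat) (w : Omega S) : 'cV[F]_d0 :=
  B *m signal n w + V n w.

(* The transition from xi_n to xi_{n+1}, with the analysis step in between. *)
Definition enkf_step (n : nat) (w : Omega S) (xi : 'I_N.+1 -> 'cV[F]_d) :
    'I_N.+1 -> 'cV[F]_d := fun i =>
  let xihat := xi i + gain B R0 (sample_cov xi)
                 *m (observation n w - (B *m xi i + calV n i w)) in
  A *m xihat + calW n.+1 i w.

Fixpoint particles (n : nat) (w : Omega S) : 'I_N.+1 -> 'cV[F]_d :=
  if n is k.+1 then enkf_step k w (particles k w) else fun i => xi0 i w.

Definition enkf_cov (n : nat) (w : Omega S) : 'M[F]_d :=
  sample_cov (particles n w).

End EnsembleKalmanFilter.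

(* Main.v *)
From HB Require Import structures.
Require Import Defs.
From mathcomp Require Import all_boot all_order all_algebra.
From mathcomp Require Import all_classical all_reals all_analysis.
From mathcomp Require Import measurable_realfun.
From mathcomp Require Import ring lra.

Set Implicit Arguments.
Unset Strict Implicit.
Unset Printing Implicit Defensive.

Import Order.TTheory GRing.Theory Num.Theory.
Import numFieldNormedType.Exports.
Local Open Scope classical_set_scope.
Local Open Scope ring_scope.

(** The sample covariance does not see a translation common to all particles,
    so the observations cancel and p_n can be computed from particles driven by
    their own noise only ([particles_shift]).  Given these particles at time n,
    the quadratic form u' p_(n+1) u is the sample variance of y_i + g_i, where
    the y_i are known and the g_i are independent centred Gaussian variables.
    Its conditional expectation is u' Phi(p_n) u, with Phi the Riccati map, and
    its conditional moments of order 2q around that value are O(N^-q), with a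
    constant independent of p_n: all the variances involved are bounded by
    u' Phi(p_n) u <= u' (A S^-1 A' + R) u.  Conditioning is done by freezing
    ([freezing]): in the expectation of a nonnegative function of two
    independent sources of randomness, one of them may be fixed first.  The
    moments of sums of independent variables then follow by adding the
    variables one at a time ([even_moment_sum]).

    The rest is deterministic.  Since
    Phi(P) = A (S^-1 - S^-1 (S^-1 + P)^-1 S^-1) A' + R,
    the map Phi is concave for the Loewner order, with tangent
    Phi(P) + E(P) (p - P) E(P)' at P, where E(P) = A (I + P S)^-1, and it lies
    below this tangent by at most E(P) D S D E(P)', D = p - P
    ([riccati_tangent], [riccati_remainder]).  Moreover
    E(P) P E(P)' + R <= Phi(P) ([riccati_lower]).  As R >= del Phi(P_n) for
    some del > 0, this makes Phi contract: if - t P <= p - P <= t P then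
    - (1 - del) t Phi(P) <= Phi(p) - Phi(P) <= (1 - del) t Phi(P)
    ([riccati_contraction]).

    (1) The lower bound is Phi(p) >= R; the upper bound follows by induction
    from the tangent inequality at P_n, which is linear in p.

    (3) Let t_n be the solution of t_(n+1) = (1 - del) t_n + f_(n+1) / rho,
    where f_n is the size of the fluctuation p_n - Phi(p_(n-1)) and P_n >= rho I.
    Then - t_n P_n <= p_n - P_n <= t_n P_n, and by convexity the moments of t_n
    inherit, uniformly in n, the bounds on the moments of f_n
    ([envelope_bound], [envelope_moment]).

    (2) In expectation, the linear term of the expansion of Phi at P_n carries
    the bias and the quadratic one is O(1/N) by (3).  A bound
    P_n - E(p_n) <= (a / N) P_n is preserved from n to n + 1 when a is large,
    because E(P) P E(P)' is smaller than Phi(P) by a fixed fraction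
    ([bias_le]). *)

(** * Freezing one of two independent sources of randomness *)
Section freezing.
Context (F : realType) (dp : measure_display) (T : measurableType dp)
  (P : probability T F).

Definition product_rule (G1 G2 : set (set T)) :=
  forall A B, G1 A -> G2 B -> P (A `&` B) = (P A * P B)%E.

Lemma product_rule_sym G1 G2 : product_rule G1 G2 -> product_rule G2 G1.
Proof. by move=> h A B GA GB; rewrite setIC h// muleC. Qed.

Record pi_system (G : set (set T)) : Prop := PiSystem {
  pi_measurable : G `<=` measurable ;
  pi_setT : G setT ;
  pi_setI : setI_closed G }.

Lemma g_sigma_sub (G : set (set T)) : G `<=` measurable -> <<s G >> `<=` measurable.
Proof. move=> Gm; apply: smallest_sub => //; exact: sigma_algebra_measurable. Qed.

(** For a fixed event of [G2], both sides are finite measures of the other event,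
    and they agree on a pi-system. *)
Lemma product_rule_sigma G1 G2 : pi_system G1 -> pi_system G2 ->
  product_rule G1 G2 -> product_rule <<s G1 >> G2.
Proof.
move=> [G1m G1T G1I] [G2m G2T G2I] h A B sA GB.
have mB := G2m _ GB.
have PB0 : 0 <= fine (P B) by apply: fine_ge0; exact: measure_ge0.
pose m1 : {measure set T -> \bar F} := mrestr P mB.
pose m2 : {measure set T -> \bar F} := mscale (NngNum PB0) P.
have fPB : ((fine (P B))%:E = P B)%E by rewrite fineK// fin_num_measure.
suff: m1 A = m2 A.
  by rewrite /m1 /m2 /= /mrestr /mscale/= fPB muleC.
apply: (g_sigma_algebra_measure_unique G1 G1m (fun=> setT)) => //.
- by apply/seteqP; split => // x _; exists 0%N.
- by move=> C GC; rewrite /m1 /m2 /= /mrestr /mscale/= fPB muleC h.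
- move=> _; rewrite /m1 /= /mrestr (le_lt_trans _ (ltry 1))//.
  by apply: probability_le1; exact: measurableI.
Qed.

Lemma pi_system_sigma G : pi_system G -> pi_system <<s G >>.
Proof.
move=> [Gm GT GI]; split; first exact: g_sigma_sub.
  exact: sub_sigma_algebra.
move=> A B sA sB.
exact: (@measurableI _ (g_sigma_algebraType G) A B).
Qed.

(** The law of the diagonal map from T to the product of T with itself, the two
    factors carrying the sigma-algebras generated by [G1] and [G2], is the
    product of the restrictions of [P]: both agree on rectangles.  Tonelli's
    theorem then separates the variables.  Working with coarser sigma-algebras
    on T itself makes it unnecessary to name the random variables that generate
    them. *)
Lemma freezing G1 G2 (h : T -> T -> \bar F) :
  pi_system G1 -> pi_system G2 -> product_rule G1 G2 ->
  measurable_fun setT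
    ((fun x => h x.1 x.2) : g_sigma_algebraType G1 * g_sigma_algebraType G2 -> \bar F) ->
  (forall x y, (0 <= h x y)%E) ->
  (\int[P]_w h w w = \int[P]_w \int[P]_v h w v)%E.
Proof.
move=> pG1 pG2 r mh h0.
pose T1 : measurableType _ := g_sigma_algebraType G1.
pose T2 : measurableType _ := g_sigma_algebraType G2.
have mi1 : measurable_fun setT (id : T -> T1).
  by move=> _ A mA; rewrite setTI; apply: (g_sigma_sub (pi_measurable pG1)).
have mi2 : measurable_fun setT (id : T -> T2).
  by move=> _ A mA; rewrite setTI; apply: (g_sigma_sub (pi_measurable pG2)).
have md : measurable_fun setT (fun w : T => (w, w) : T1 * T2).
  exact: measurable_fun_pair.
pose X1 : {mfun T >-> T1} := HB.pack (id : T -> T1) (isMeasurableFun.Build _ _ _ _ _ mi1).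
pose X2 : {mfun T >-> T2} := HB.pack (id : T -> T2) (isMeasurableFun.Build _ _ _ _ _ mi2).
pose X : {mfun T >-> (T1 * T2)%type} := HB.pack (fun w : T => (w, w) : (T1 * T2)%type) (isMeasurableFun.Build _ _ _ _ _ md).
pose P1 : probability T1 F := distribution P X1.
pose P2 : probability T2 F := distribution P X2.
pose Q : probability (T1 * T2)%type F := distribution P X.
have E : forall A, measurable A -> (P1 \x P2)%E A = Q A.
  apply: product_measure_unique => A B mA mB.
  have := product_rule_sigma pG2 (pi_system_sigma pG1)
    (product_rule_sym (product_rule_sigma pG1 pG2 r)).
  move=> /product_rule_sym /(_ A B mA mB).
  exact.
transitivity (\int[Q]_x h x.1 x.2)%E.
  by rewrite /Q /= /distribution ge0_integral_pushforward.
transitivity (\int[(P1 \x P2)%E]_x h x.1 x.2)%E.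
  by apply: eq_measure_integral => A mA _; apply: esym; exact: E.
rewrite fubini_tonelli1//=.
rewrite /P1 /distribution/= ge0_integral_pushforward//; last 2 first.
  exact: (@measurable_fun_fubini_tonelli_F _ _ _ _ _ P2).
  by move=> y _; exact: integral_ge0.
rewrite preimage_setT; apply: eq_integral => w _.
rewrite /fubini_F/= /P2 /distribution/= ge0_integral_pushforward//.
exact: (measurableT_comp mh (measurable_pair1 (w : T1))).
Qed.

End freezing.

(** * Independent families of sigma-algebras *)
Section cylinders.
Context (F : realType) (dp : measure_display) (T : measurableType dp)
  (P : probability T F) (I : eqType) (G : I -> set (set T)).
Hypothesis piG : forall a, pi_system (G a).
Hypothesis indepG : mutually_independent P G.

(** Indexing every intersection by all labels, with finitely many factors other
    than [setT], makes the stability under intersection immediate. *)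
Definition cylinders (J : set I) : set (set T) :=
  [set A | exists s : seq I, exists E : I -> set T,
    [/\ forall a, G a (E a), forall a, a \in s -> J a,
        forall a, a \notin s -> E a = setT
      & A = \bigcap_(a in [set: I]) E a]].

Lemma cylinderE (s : seq I) (E : I -> set T) :
  (forall a, a \notin s -> E a = setT) ->
  \bigcap_(a in [set: I]) E a = \bigcap_(a in [set` s]) E a.
Proof.
move=> Es; apply/seteqP; split=> x Ex a => [_|_]; first exact: Ex.
by have [/Ex //|/Es ->] := boolP (a \in s).
Qed.

Lemma cylinders_pi J : pi_system (cylinders J).
Proof.
split.
- move=> _ [s [E [GE _ Es ->]]]; rewrite (cylinderE Es).
  
  apply: fin_bigcap_measurable; first exact: finite_seq.
  by move=> a _; exact: (pi_measurable (piG a)).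
- exists [::], (fun=> setT); split => //; first by move=> a; exact: pi_setT.
  by apply/seteqP; split.
- move=> _ _ [s1 [E1 [GE1 J1 Es1 ->]]] [s2 [E2 [GE2 J2 Es2 ->]]].
  exists (s1 ++ s2), (fun a => E1 a `&` E2 a); split.
  + by move=> a; exact: (pi_setI (piG a)).
  + by move=> a; rewrite mem_cat => /orP[/J1|/J2].
  + by move=> a; rewrite mem_cat negb_or => /andP[/Es1 -> /Es2 ->]; rewrite setIT.
  + apply/seteqP; split => [x [h1 h2] a _|x h]; first by split; [exact: h1|exact: h2].
    by split=> a _; case: (h a Logic.I).
Qed.

Lemma independent_bigcap (s : seq I) (E : I -> set T) : uniq s ->
  (forall a, G a (E a)) ->
  P (\bigcap_(a in [set` s]) E a) = (\prod_(a <- s) P (E a))%E.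
Proof.
move=> us GE; rewrite big_tnth.
rewrite -(@indepG _ (tnth (in_tuple s))); last 2 first.
- by apply/injectiveP; rewrite /injectiveb /dinjectiveb map_tnth_enum.
- by move=> l; exact: GE.
congr (P _); apply/seteqP; split=> x h.
  by move=> l _; apply: h => /=; exact: mem_tnth.
move=> a /= as_; have /tnthP[l ->] : a \in in_tuple s by []. exact: h.
Qed.

(** After restriction to the finitely many labels that matter, the two families
    of events are concatenated into one family without repetition. *)
Lemma cylinders_product J1 J2 : J1 `&` J2 = set0 ->
  product_rule P (cylinders J1) (cylinders J2).
Proof.
move=> J12 _ _ [s1 [E1 [GE1 Js1 Es1 ->]]] [s2 [E2 [GE2 Js2 Es2 ->]]].
pose u1 := undup s1; pose u2 := undup s2.
have E1u a : a \notin u1 -> E1 a = setT by rewrite mem_undup; exact: Es1.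
have E2u a : a \notin u2 -> E2 a = setT by rewrite mem_undup; exact: Es2.
have dis a : a \in u1 -> a \in u2 -> False.
  rewrite !mem_undup => /Js1 h1 /Js2 h2.
  by have : (J1 `&` J2) a by []; rewrite J12.
have -> : \bigcap_(a in [set: I]) E1 a `&` \bigcap_(a in [set: I]) E2 a =
    \bigcap_(a in [set` u1 ++ u2]) (E1 a `&` E2 a).
  rewrite -cylinderE; last first.
    by move=> a; rewrite mem_cat negb_or => /andP[/E1u -> /E2u ->]; rewrite setIT.
  by rewrite bigcapI.
rewrite independent_bigcap; last 2 first.
- rewrite cat_uniq !undup_uniq/= andbT; apply/hasPn => a a2; apply/negP => a1.
  exact: dis a1 a2.
- by move=> a; exact: (pi_setI (piG a)).
rewrite big_cat/= (cylinderE E1u) (cylinderE E2u) !independent_bigcap ?undup_uniq//.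
congr (_ * _)%E; rewrite [LHS]big_seq [RHS]big_seq; apply: eq_bigr => a au.
  by rewrite (E2u a) ?setIT//; apply/negP => /(dis _ au).
by rewrite (E1u a) ?setTI//; apply/negP => a1; exact: dis a1 au.
Qed.

Lemma sub_cylinders J a A : J a -> G a A -> cylinders J A.
Proof.
move=> Ja GA; exists [:: a], (fun b => if b == a then A else setT); split.
- by move=> b; case: eqVneq => [->//|_]; exact: pi_setT.
- by move=> b; rewrite inE => /eqP ->.
- by move=> b; rewrite inE => /negbTE ->.
- apply/seteqP; split => [x Ax b _|x /(_ a)]; first by case: ifP.
  by rewrite eqxx; apply.
Qed.

(** The sample space, with the information carried by the labels of [J]. *)
Definition label_space J : measurableType _ := g_sigma_algebraType (cylinders J).

Definition label_measurable d' (U : measurableType d') J (f : T -> U) :=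
  measurable_fun [set: label_space J] f.

Lemma label_measurableT d' (U : measurableType d') J (f : T -> U) :
  label_measurable J f -> measurable_fun setT f.
Proof.
move=> mf _ A mA; have := mf measurableT A mA; rewrite setTI => h.
by apply: (g_sigma_sub (pi_measurable (cylinders_pi J))).
Qed.

Lemma label_measurableS d' (U : measurableType d') J J' (f : T -> U) : J `<=` J' ->
  label_measurable J f -> label_measurable J' f.
Proof.
move=> JJ mf _ A mA; have := mf measurableT A mA; rewrite !setTI.
apply: sub_sigma_algebra2 => //.
move=> B [s [E [h1 h2 h3 h4]]]; exists s, E; split => // a /h2; exact: JJ.
Qed.

Lemma label_freezing J1 J2 (h : T -> T -> \bar F) : J1 `&` J2 = set0 ->
  measurable_fun setT
    ((fun x => h x.1 x.2) : label_space J1 * label_space J2 -> \bar F) ->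
  (forall x y, (0 <= h x y)%E) ->
  (\int[P]_w h w w = \int[P]_w \int[P]_v h w v)%E.
Proof.
move=> J12; apply: freezing; [exact: cylinders_pi|exact: cylinders_pi|].
exact: cylinders_product.
Qed.

End cylinders.

(** * Inequalities between powers *)
Section power_inequalities.
Context (F : realType).
Implicit Types (s x y : F).

(** The larger of the two absolute values absorbs the other one. *)
Lemma normr_mulX_le s x k i : (i <= k)%N ->
  `|s ^+ (k - i) * x ^+ i| <= `|s| ^+ k + `|x| ^+ k.
Proof.
move=> ik; rewrite normrM !normrX.
have [sx|/ltW xs] := leP `|s| `|x|.
  apply: (@le_trans _ _ (`|x| ^+ k)); last by rewrite lerDr exprn_ge0.
  rewrite -[in leRHS](subnK ik) exprD ler_wpM2r ?exprn_ge0//.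
  by rewrite lerXn2r ?nnegrE.
apply: (@le_trans _ _ (`|s| ^+ k)); last by rewrite lerDl exprn_ge0.
rewrite -[in leRHS](subnK ik) exprD ler_wpM2l ?exprn_ge0//.
by rewrite lerXn2r ?nnegrE.
Qed.

Lemma even_expr_ge0 x k : 0 <= x ^+ k.*2.
Proof. by rewrite exprn_even_ge0 ?odd_double. Qed.

Lemma even_exprN x k : (- x) ^+ k.*2 = x ^+ k.*2.
Proof. by rewrite exprNn -signr_odd odd_double mul1r. Qed.

Lemma even_expr_norm x k : `|x| ^+ k.*2 = x ^+ k.*2.
Proof. by rewrite -normrX ger0_norm// even_expr_ge0. Qed.

(** Every term of the binomial expansion of order at least 2 in [x] is dominated
    by s ^ (2k) x ^ 2 + x ^ (2k + 2).  The linear term is kept apart: it vanishes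
    in expectation when [x] is centred and independent of [s]. *)
Lemma even_expr_taylor k s x :
  (s + x) ^+ k.*2.+2 <= s ^+ k.*2.+2 + (k.*2.+2)%:R * s ^+ k.*2.+1 * x
    + (2 ^ k.*2.+2)%:R * (s ^+ k.*2 * x ^+ 2 + x ^+ k.*2.+2).
Proof.
rewrite exprDn big_ord_recl big_ord_recl /= !subn0 expr0 mulr1 bin0 mulr1n.
rewrite /bump /= !add1n expr1 subn1/= bin1 addrA.
rewrite -[X in _ + X + _]mulr_natl mulrA lerD2l.
apply: (@le_trans _ _ (\sum_(i < k.*2.+1) (s ^+ k.*2 * x ^+ 2 + x ^+ k.*2.+2) *+ 'C(k.*2.+2, i.+2))).
  apply: ler_sum => i _; rewrite /bump /= !add1n; apply: ler_wMn2r.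
  have x2 j : x ^+ j.+2 = x ^+ j * x ^+ 2 by rewrite -exprD addn2.
  rewrite !subSS [x ^+ i.+2]x2 [x ^+ k.*2.+2]x2 mulrA.
  apply: le_trans (ler_norm _) _.
  rewrite normrM [X in _ * X]ger0_norm ?sqr_ge0//.
  rewrite -mulrDl -(even_expr_norm x) -(even_expr_norm s).
  by rewrite ler_wpM2r ?sqr_ge0// normr_mulX_le// -ltnS.
rewrite sumrMnr mulr_natl; apply: ler_wpMn2l.
  apply: addr_ge0; last exact: (even_expr_ge0 x k.+1).
  by rewrite mulr_ge0 ?sqr_ge0 ?even_expr_ge0.
rewrite -[2%N]/(1 + 1)%N expnDn.
rewrite [leqRHS]big_ord_recl [X in (_ <= _ + X)%N]big_ord_recl /= /bump /=.
apply: leq_trans (leq_addl _ _); apply: leq_trans (leq_addl _ _).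
by apply: leq_sum => i _; rewrite !add1n !exp1n !muln1.
Qed.

Lemma exprD_le x y n : 0 <= x -> 0 <= y -> (x + y) ^+ n <= 2 ^+ n * (x ^+ n + y ^+ n).
Proof.
move=> x0 y0.
wlog xy : x y x0 y0 / x <= y.
  move=> H; have [|/ltW] := leP x y; first exact: H.
  by rewrite addrC [_ ^+ n + _]addrC; exact: H.
apply: (@le_trans _ _ ((2 * y) ^+ n)).
  by rewrite lerXn2r ?nnegrE ?addr_ge0 ?mulr_ge0// mulr_natl mulr2n lerD2r.
by rewrite exprMn ler_wpM2l ?exprn_ge0// lerDr exprn_ge0.
Qed.

Lemma even_exprD_le x y k : (x + y) ^+ k.*2 <= 2 ^+ k.*2 * (x ^+ k.*2 + y ^+ k.*2).
Proof.
rewrite -even_expr_norm -(even_expr_norm x) -(even_expr_norm y); apply: le_trans (exprD_le _ _ _) => //.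
by rewrite lerXn2r ?nnegrE ?addr_ge0 ?ler_normD.
Qed.

Lemma even_sumX_le (I : Type) k (r : seq I) : (0 < k)%N -> exists2 C : F, 0 <= C &
  forall f : I -> F, (\sum_(i <- r) f i) ^+ k.*2 <= C * \sum_(i <- r) f i ^+ k.*2.
Proof.
move=> k0; elim: r => [|a r [C C0 IH]].
  by exists 0 => // f; rewrite !big_nil mul0r expr0n double_eq0 -leqn0 leqNgt k0.
exists (2 ^+ k.*2 * (1 + C)) => [|f]; first by rewrite mulr_ge0 ?exprn_ge0 ?addr_ge0.
rewrite !big_cons; apply: le_trans (even_exprD_le _ _ _) _.
have e (z : F) := even_expr_ge0 z k.
have s0 : 0 <= \sum_(i <- r) f i ^+ k.*2 by rewrite sumr_ge0.
rewrite -mulrA ler_wpM2l ?exprn_ge0//.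
have := IH f; have := e (f a); nra.
Qed.

(** The induction step is Chebyshev's inequality
    (x - y) (x ^ n - y ^ n) >= 0. *)
Lemma convex_expr n (t x y : F) : 0 <= t <= 1 -> 0 <= x -> 0 <= y ->
  ((1 - t) * x + t * y) ^+ n <= (1 - t) * x ^+ n + t * y ^+ n.
Proof.
move=> /andP[t0 t1] x0 y0; elim: n => [|n IH]; first by rewrite !expr0; lra.
have c0 : 0 <= (1 - t) * x + t * y by rewrite addr_ge0 ?mulr_ge0 ?subr_ge0.
rewrite exprS; apply: le_trans (ler_wpM2l c0 IH) _.
rewrite !exprS.
have : 0 <= (x - y) * (x ^+ n - y ^+ n).
  have [xy|/ltW xy] := leP x y.
    by rewrite mulr_le0// subr_le0// lerXn2r ?nnegrE.
  by rewrite mulr_ge0// subr_ge0// lerXn2r ?nnegrE.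
set X := x ^+ n; set Y := y ^+ n => h.
rewrite -subr_ge0.
have -> : (1 - t) * (x * X) + t * (y * Y) - ((1 - t) * x + t * y) * ((1 - t) * X + t * Y)
  = t * (1 - t) * ((x - y) * (X - Y)) by ring.
by rewrite mulr_ge0// mulr_ge0// subr_ge0.
Qed.

End power_inequalities.

(** * Moments of sums of independent variables *)
Section expectations.
Context (F : realType) (dp : measure_display) (T : measurableType dp)
  (P : probability T F).
Implicit Types (X Y f g : T -> F).

(** The integral of a nonnegative function is a supremum over the simple functions
    below it, hence monotone without any measurability.  In this way a matrix
    norm can be bounded without a proof that it is measurable. *)
Lemma ge0_le_integral_pointwise (f g : T -> \bar F) :
  (forall x, 0 <= f x)%E -> (forall x, f x <= g x)%E ->
  (\int[P]_x f x <= \int[P]_x g x)%E.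
Proof.
move=> f0 fg; have g0 x : (0 <= g x)%E := le_trans (f0 x) (fg x).
rewrite !ge0_integralTE//; apply: le_ereal_sup => _ [h hf <-].
by exists h => // x; exact: le_trans (hf x) (fg x).
Qed.

Lemma integrable_real_ge0 f (M : F) : measurable_fun setT f -> (forall x, 0 <= f x) ->
  (\int[P]_x (f x)%:E <= M%:E)%E -> P.-integrable setT (EFin \o f).
Proof.
move=> mf f0 fM; apply/integrableP; split; first exact/measurable_EFinP.
under eq_integral do rewrite /= ger0_norm//.
by apply: le_lt_trans fM _; exact: ltry.
Qed.

Lemma integrable_dom f g : measurable_fun setT f -> P.-integrable setT (EFin \o g) ->
  (forall x, `|f x| <= g x) -> P.-integrable setT (EFin \o f).
Proof.
move=> mf ig fg; apply: le_integrable ig => //; first exact/measurable_EFinP.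
move=> x _ /=; rewrite lee_fin; apply: le_trans (fg x) _; exact: ler_norm.
Qed.

Lemma integrable_cst_real (a : F) : P.-integrable setT (EFin \o cst a).
Proof. exact: finite_measure_integrable_cst. Qed.

Lemma integrable_real_lin f g (a b : F) : P.-integrable setT (EFin \o f) ->
  P.-integrable setT (EFin \o g) ->
  P.-integrable setT (EFin \o (fun x => a * f x + b * g x)).
Proof.
move=> i1 i2.
have -> : EFin \o (fun x => a * f x + b * g x) =
   ((fun x => a%:E * (EFin \o f) x) \+ (fun x => b%:E * (EFin \o g) x))%E.
  by apply/funext.
by apply: integrableD => //; exact: integrableZl.
Qed.

Lemma integral_real_lin f g (a b : F) : P.-integrable setT (EFin \o f) ->
  P.-integrable setT (EFin \o g) ->
  (\int[P]_x (a * f x + b * g x)%:E =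
   a%:E * \int[P]_x (f x)%:E + b%:E * \int[P]_x (g x)%:E)%E.
Proof.
move=> i1 i2; rewrite -integralZl// -[X in (_ + X)%E]integralZl// -integralD//=;
 exact: integrableZl.
Qed.

Lemma integrable_of_sqr f : measurable_fun setT f ->
  P.-integrable setT (EFin \o (fun x => f x ^+ 2)) -> P.-integrable setT (EFin \o f).
Proof.
move=> mf if2.
have i3 : P.-integrable setT (EFin \o (fun x => 1 * cst 1 x + 1 * f x ^+ 2)).
  exact: integrable_real_lin (integrable_cst_real _) if2.
apply: integrable_dom i3 _ => // x /=; set z := f x.
have := sqr_ge0 (z - 1); have := sqr_ge0 (z + 1).
by rewrite ler_norml => *; apply/andP; split; nra.
Qed.

Lemma integral_cst_real (a : F) : (\int[P]_x a%:E = a%:E)%E.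
Proof. by rewrite integral_cst//= probability_setT mule1. Qed.

End expectations.

Section independent_sums.
Context (F : realType).

Section defs.
Context (dp : measure_display) (T : measurableType dp) (P : probability T F).

(** Independence in the form in which it is used, as the freezing formula for
    nonnegative functions. *)
Definition independent_pair (X Y : T -> F) := forall h : F -> F -> F,
  measurable_fun setT (fun x : F * F => h x.1 x.2) -> (forall x y, 0 <= h x y) ->
  (\int[P]_w (h (X w) (Y w))%:E = \int[P]_w \int[P]_v (h (X w) (Y v))%:E)%E.

Definition independent_family (I : eqType) (Y : I -> T -> F) :=
  forall (i : I) (s : seq I) (c : I -> F), i \notin s ->
    independent_pair (fun w => \sum_(j <- s) c j * Y j w) (Y i).

End defs.

Lemma measurable_sum_scale (dp : measure_display) (T : measurableType dp)
  (I : Type) (s : seq I) (c : I -> F) (Y : I -> T -> F) :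
  (forall i, measurable_fun setT (Y i)) ->
  measurable_fun setT (fun w => \sum_(j <- s) c j * Y j w).
Proof.
by move=> mY; apply: measurable_sum => i; apply: measurable_funM.
Qed.

(** One variable is added at a time: by freezing, the others become part of the
    constant [b]. *)
Lemma second_moment_sum (dp : measure_display) (T : measurableType dp)
  (P : probability T F) (I : eqType) (Y : I -> T -> F) (v : I -> F) :
  independent_family P Y -> (forall i, measurable_fun setT (Y i)) ->
  (forall i, \int[P]_w (Y i w)%:E = 0)%E ->
  (forall i, \int[P]_w (Y i w ^+ 2)%:E = (v i)%:E)%E ->
  forall s (c : I -> F) (b : F), uniq s ->
  (\int[P]_w ((b + \sum_(j <- s) c j * Y j w) ^+ 2)%:E
    = (b ^+ 2 + \sum_(j <- s) c j ^+ 2 * v j)%:E)%E.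
Proof.
move=> ind mY Y1 Y2 + c; elim=> [|i s IH] b /=.
  move=> _; under eq_integral do rewrite big_nil addr0.
  by rewrite big_nil addr0 integral_cst_real.
move=> /andP[is_ us].
have iY2 : P.-integrable setT (EFin \o (fun w => Y i w ^+ 2)).
  apply: (@integrable_real_ge0 _ _ _ _ _ (v i)) => [|x|]; last by rewrite Y2.
    exact: measurable_funX.
  exact: sqr_ge0.
have iY := integrable_of_sqr (mY i) iY2.
under eq_integral do rewrite big_cons.
pose h x y : F := (b + (c i * y + x)) ^+ 2.
rewrite (ind i s c is_ h); last 2 first.
- apply: measurable_funX; apply: measurable_funD => //; apply: measurable_funD => //.
  by apply: measurable_funM.
- by move=> x y; exact: sqr_ge0.
rewrite big_cons.
transitivity (\int[P]_w (1 * (b + \sum_(j <- s) c j * Y j w) ^+ 2 + (c i ^+ 2 * v i) * cst 1 w)%:E)%E.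
  apply: eq_integral => w _; rewrite /h; set S := \sum_(j <- s) _.
  transitivity (\int[P]_u (1 * (1 * (cst ((b + S) ^+ 2) u) + (2 * (b + S) * c i) * Y i u) + c i ^+ 2 * Y i u ^+ 2)%:E)%E.
    by apply: eq_integral => u _; congr EFin => /=; ring.
  rewrite integral_real_lin//; last first.
    by apply: integrable_real_lin => //; exact: integrable_cst_real.
  rewrite integral_real_lin//; last exact: integrable_cst_real.
  rewrite Y1 Y2 integral_cst_real mule0 adde0 mul1e mul1e -!EFinM -EFinD.
  by congr EFin; rewrite /= mul1r mulr1.
rewrite integral_real_lin; last 2 first.
- apply: (@integrable_real_ge0 _ _ _ _ _ (b ^+ 2 + \sum_(j <- s) c j ^+ 2 * v j)).
  + by apply: measurable_funX; apply: measurable_funD => //; exact: measurable_sum_scale.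
  + by move=> x; exact: sqr_ge0.
  + by rewrite IH.
- exact: integrable_cst_real.
rewrite IH// integral_cst_real -!EFinM -EFinD; congr EFin => /=; ring.
Qed.

(** A Marcinkiewicz-Zygmund bound, with a constant that depends on the moments
    only.  Adding the variable c Y to a sum S raises the moment of order 2q + 2 by
    at most a multiple of c ^ 2 E(S ^ (2q)) + c ^ (2q + 2), by [even_expr_taylor],
    and (c ^ 2 + A) ^ (q + 1) exceeds A ^ (q + 1) by at least c ^ 2 A ^ q and by at
    least c ^ (2q + 2). *)
Lemma even_moment_sum (M : nat -> F) (q : nat) : exists2 C : F, 0 <= C &
  forall (dp : measure_display) (T : measurableType dp)
    (P : probability T F) (I : eqType) (Y : I -> T -> F),
  independent_family P Y -> (forall i, measurable_fun setT (Y i)) ->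
  (forall i, \int[P]_w (Y i w)%:E = 0)%E ->
  (forall i k, \int[P]_w (Y i w ^+ k.*2)%:E <= (M k)%:E)%E ->
  forall s (c : I -> F), uniq s ->
  (\int[P]_w ((\sum_(j <- s) c j * Y j w) ^+ q.*2)%:E
    <= (C * (\sum_(j <- s) c j ^+ 2) ^+ q)%:E)%E.
Proof.
elim: q => [|q [C C0 IHq]].
  exists 1 => // dp T P I Y ind mY Y1 YM s c us.
  under eq_integral do rewrite expr0.
  by rewrite expr0 mulr1 integral_cst_real.
pose K : F := (2 ^ q.*2.+2)%:R.
pose D := K * (C * `|M 1%N| + `|M q.+1|).
have K0 : 0 <= K by rewrite /K.
have D0 : 0 <= D by rewrite mulr_ge0// addr_ge0// mulr_ge0.
exists D => // dp T P I Y ind mY Y1 YM s c.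
elim: s => [|i s IHs].
  move=> _; under eq_integral do rewrite big_nil expr0n.
  by rewrite big_nil expr0n mulr0 integral0.
move=> /= /andP[is_ us].
have ev := @even_expr_ge0 F.
have iYk k : P.-integrable setT (EFin \o (fun w => Y i w ^+ k.*2)).
  apply: (@integrable_real_ge0 _ _ _ _ _ (M k)) => [|x|] //.
  exact: measurable_funX.
have iY : P.-integrable setT (EFin \o Y i).
  exact: integrable_of_sqr (mY i) (iYk 1%N).
under eq_integral do rewrite big_cons addrC.
pose h x y : F := (x + c i * y) ^+ q.+1.*2.
rewrite (ind i s c is_ h); last 2 first.
- by apply: measurable_funX; apply: measurable_funD => //; apply: measurable_funM.
- by move=> x y; exact: ev.
rewrite big_cons; set A := \sum_(j <- s) c j ^+ 2.
have A0 : 0 <= A by apply: sumr_ge0 => j _; exact: sqr_ge0.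
pose S w := \sum_(j <- s) c j * Y j w.
have mS : measurable_fun setT S by exact: measurable_sum_scale.
have iS : P.-integrable setT (EFin \o (fun w => S w ^+ q.+1.*2)).
  apply: (@integrable_real_ge0 _ _ _ _ _ (D * A ^+ q.+1)) => [|x|] //.
    exact: measurable_funX.
  exact: IHs.
have iSq : P.-integrable setT (EFin \o (fun w => S w ^+ q.*2)).
  apply: (@integrable_real_ge0 _ _ _ _ _ (C * A ^+ q)) => [|x|] //.
    exact: measurable_funX.
  exact: IHq.
apply: (@le_trans _ _ (\int[P]_w (1 * (1 * S w ^+ q.+1.*2 + (K * c i ^+ 2 * `|M 1%N|) * S w ^+ q.*2) +
    (K * c i ^+ q.+1.*2 * `|M q.+1|) * cst 1 w)%:E)%E).
  apply: ge0_le_integral_pointwise => w.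
    by apply: integral_ge0 => v _; rewrite lee_fin ev.
  rewrite -/(S w) /h; set x := S w.
  apply: (@le_trans _ _ (\int[P]_v (1 * (1 * cst (x ^+ q.+1.*2) v + ((q.*2.+2)%:R * x ^+ q.*2.+1 * c i) * Y i v) +
     1 * ((K * c i ^+ 2 * x ^+ q.*2) * Y i v ^+ 1.*2 + (K * c i ^+ q.+1.*2) * Y i v ^+ q.+1.*2))%:E)%E).
    apply: ge0_le_integral_pointwise => v; first by rewrite lee_fin ev.
    rewrite lee_fin; apply: le_trans (even_expr_taylor _ _ _) _.
    rewrite -/K exprMn [(c i * Y i v) ^+ q.*2.+2]exprMn /= doubleS.
    by rewrite le_eqVlt; apply/orP; left; apply/eqP; ring.
  have i1 := integrable_cst_real P (x ^+ q.+1.*2).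
  rewrite integral_real_lin; last 2 first.
  - exact: integrable_real_lin.
  - exact: integrable_real_lin.
  rewrite integral_real_lin// integral_real_lin// Y1 mule0 adde0 !mul1e integral_cst_real.
  rewrite /= !mul1r mulr1 !EFinD -addeA; apply: leeD => //; apply: leeD.
  - apply: (@le_trans _ _ ((K * c i ^+ 2 * x ^+ q.*2)%:E * `|M 1%N|%:E)%E).
      apply: lee_wpmul2l; first by rewrite lee_fin mulr_ge0 ?ev// mulr_ge0// sqr_ge0.
      by apply: le_trans (YM i 1%N) _; rewrite lee_fin; exact: ler_norm.
    by rewrite -EFinM lee_fin; rewrite le_eqVlt; apply/predU1P; left; ring.
  - rewrite [leRHS]EFinM; apply: lee_wpmul2l.
      by rewrite lee_fin mulr_ge0 ?ev.
    apply: le_trans (YM i _) _; rewrite lee_fin; exact: ler_norm.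
rewrite integral_real_lin; last 2 first.
- exact: integrable_real_lin.
- exact: integrable_cst_real.
rewrite integral_real_lin// !mul1e integral_cst_real mule1.
apply: (@le_trans _ _ ((D * A ^+ q.+1)%:E + (K * c i ^+ 2 * `|M 1%N|)%:E * (C * A ^+ q)%:E +
    (K * c i ^+ q.+1.*2 * `|M q.+1|)%:E)%E).
  apply: leeD => //; apply: leeD; first exact: IHs.
  apply: lee_wpmul2l; last exact: IHq.
  by rewrite lee_fin mulr_ge0// mulr_ge0// sqr_ge0.
rewrite -EFinM -!EFinD lee_fin.
set a := c i ^+ 2; have a0 : 0 <= a by exact: sqr_ge0.
have -> : c i ^+ q.+1.*2 = a ^+ q.+1 by rewrite -exprM mul2n.
set B := A ^+ q; have B0 : 0 <= B by rewrite exprn_ge0.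
have h1 : a * B + A ^+ q.+1 <= (a + A) ^+ q.+1.
  rewrite [leRHS]exprS mulrDl lerD//; last rewrite exprS.
    by rewrite ler_wpM2l// lerXn2r ?nnegrE ?addr_ge0// lerDr.
  by rewrite ler_wpM2l// lerXn2r ?nnegrE ?addr_ge0// lerDr.
have h2 : a ^+ q.+1 + A ^+ q.+1 <= (a + A) ^+ q.+1.
  rewrite [leRHS]exprS mulrDl lerD// exprS ler_wpM2l// lerXn2r ?nnegrE ?addr_ge0//.
    by rewrite lerDl.
  by rewrite lerDr.
have M1 : 0 <= `|M 1%N| by [].
have Mq : 0 <= `|M q.+1| by [].
rewrite /D; move: M1 Mq h1 h2 B0 K0 C0.
set m1 := `|M 1%N|; set mq := `|M q.+1|; set X := (a + A) ^+ q.+1; set Y' := A ^+ q.+1; set Z := a ^+ q.+1.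
move=> m10 mq0 h1 h2 B0 K0 C0.
have e1 : K * C * m1 * (a * B + Y') <= K * C * m1 * X by rewrite ler_wpM2l// !mulr_ge0.
have e2 : K * mq * (Z + Y') <= K * mq * X by rewrite ler_wpM2l// !mulr_ge0.
by have := lerD e1 e2; lra.
Qed.

End independent_sums.

(** * Sample variance of independent variables *)
Section independent_family_labels.
Context (F : realType) (dp : measure_display) (T : measurableType dp)
  (P : probability T F) (I : eqType) (G : I -> set (set T)).
Hypothesis piG : forall a, pi_system (G a).
Hypothesis indepG : mutually_independent P G.

(** A linear combination of the Y_j only uses the labels of the J_j. *)
Lemma independent_family_labels (K : eqType) (Y : K -> T -> F) (J : K -> set I) :
  (forall i j, i != j -> J i `&` J j = set0) ->
  (forall i, label_measurable G (J i) (Y i)) ->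
  independent_family P Y.
Proof.
move=> Jdis mY i s c is_ h mh h0.
pose J1 := \bigcup_(j in [set` s]) J j.
have mS : label_measurable G J1 (fun w => \sum_(j <- s) c j * Y j w).
  (* Outside of s the variables are replaced by 0, so that all of them depend on J1 only. *)
  have E w : \sum_(j <- s) c j * Y j w = \sum_(j <- s) c j * (if j \in s then Y j w else 0).
    by rewrite !big_seq; apply: eq_bigr => j ->.
  rewrite (funext E); apply: measurable_sum_scale => j.
  have [js|_] := boolP (j \in s); last exact: measurable_cst.
  by apply: label_measurableS (mY j) => a Ja; exists j.
apply: (label_freezing piG indepG (J1 := J1) (J2 := J i)
  (h := fun w v => (h (\sum_(j <- s) c j * Y j w) (Y i v))%:E)).
- rewrite setI_bigcupl; apply: bigcup0 => j /= js; apply: Jdis.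
  by apply: contraNneq is_ => <-.
- apply/measurable_EFinP.
  apply: (measurableT_comp (f := fun x : F * F => h x.1 x.2)
     (g := (fun x : label_space G J1 * label_space G (J i) =>
        (\sum_(j <- s) c j * Y j x.1, Y i x.2)))) => //.
  apply: measurable_fun_pair => /=.
    exact: (measurableT_comp mS measurable_fst).
  exact: (measurableT_comp (mY i) measurable_snd).
- by move=> x y; rewrite lee_fin.
Qed.

End independent_family_labels.

Section sample_variance.
Context (F : realType).

Definition smean N (f : 'I_N.+1 -> F) := N.+1%:R^-1 * \sum_i f i.
Definition svar N (f : 'I_N.+1 -> F) := N%:R^-1 * \sum_i (f i - smean f) ^+ 2.

Lemma svar_ge0 N (f : 'I_N.+1 -> F) : 0 <= svar f.
Proof. by rewrite mulr_ge0 ?invr_ge0// sumr_ge0// => i _; rewrite sqr_ge0. Qed.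

Lemma smeanD N (f g : 'I_N.+1 -> F) : smean (fun i => f i + g i) = smean f + smean g.
Proof. by rewrite /smean big_split/= mulrDr. Qed.

Lemma smean_cst N (a : F) : smean (fun _ : 'I_N.+1 => a) = a.
Proof. by rewrite /smean sumr_const card_ord -[a *+ _]mulr_natl mulKf// pnatr_eq0. Qed.

Lemma svar_shift N (f : 'I_N.+1 -> F) a : svar (fun i => f i + a) = svar f.
Proof.
rewrite /svar smeanD smean_cst; congr (_ * _); apply: eq_bigr => i _.
by congr (_ ^+ 2); ring.
Qed.

Lemma svar0 N : svar (fun _ : 'I_N.+1 => 0) = 0.
Proof.
by rewrite /svar big1 ?mulr0 // => i _; rewrite smean_cst subrr expr0n.
Qed.

Lemma sum_center N (f : 'I_N.+1 -> F) : \sum_i (f i - smean f) = 0.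
Proof.
rewrite big_split/= sumrN sumr_const card_ord -[smean f *+ _]mulr_natl.
by rewrite /smean mulrA mulfV ?pnatr_eq0// mul1r subrr.
Qed.

Lemma sum_sqr_center N (f : 'I_N.+1 -> F) :
  \sum_i (f i - smean f) ^+ 2 = \sum_i f i ^+ 2 - N.+1%:R^-1 * (\sum_i f i) ^+ 2.
Proof.
have e : \sum_i (f i - smean f) ^+ 2 = \sum_i f i ^+ 2 + \sum_i (- smean f) * (f i - smean f)
   + (- smean f) * \sum_i f i.
  rewrite mulr_sumr -!big_split/=; apply: eq_bigr => i _; ring.
by rewrite e -mulr_sumr sum_center mulr0 addr0 /smean mulNr expr2 mulrA.
Qed.

Lemma svarD N (y g : 'I_N.+1 -> F) : (0 < N)%N -> 
  svar (fun i => y i + g i) =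
  svar y + N%:R^-1 * \sum_i (2 * (y i - smean y)) * g i + svar g.
Proof.
move=> N0; rewrite /svar -!mulrDr; congr (_ * _).
have -> : \sum_i (2 * (y i - smean y)) * g i =
  \sum_i (2 * (y i - smean y)) * (g i - smean g).
  under [RHS]eq_bigr do rewrite mulrBr.
  rewrite big_split/= sumrN -mulr_suml -mulr_sumr sum_center mulr0 mul0r.
  by rewrite subr0.
rewrite smeanD -!big_split/=; apply: eq_bigr => i _; ring.
Qed.

Section random.
Context (dp : measure_display) (T : measurableType dp) (P : probability T F)
  (N : nat) (g : 'I_N.+1 -> T -> F) (s : F).
Hypothesis N0 : (0 < N)%N.
Hypothesis ind : independent_family P g.
Hypothesis mg : forall i, measurable_fun setT (g i).
Hypothesis g1 : (forall i, \int[P]_w (g i w)%:E = 0)%E.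
Hypothesis g2 : (forall i, \int[P]_w (g i w ^+ 2)%:E = s%:E)%E.

(** Each deviation from the sample mean is a constant plus a combination of the
    independent g_j, with coefficients delta_ij - 1 / (N + 1) whose squares add up
    to N / (N + 1). *)
Lemma svar_expectation (y : 'I_N.+1 -> F) :
  (\int[P]_w (svar (fun i => y i + g i w))%:E = (svar y + s)%:E)%E.
Proof.
pose c (i j : 'I_N.+1) : F := (i == j)%:R - N.+1%:R^-1.
have N1 : N.+1%:R != 0 :> F by rewrite pnatr_eq0.
have NN : N%:R != 0 :> F by rewrite pnatr_eq0 -lt0n.
have E i w : y i + g i w - smean (fun i => y i + g i w) = (y i - smean y) + \sum_j c i j * g j w.
  rewrite smeanD /c; under eq_bigr do rewrite mulrBl.
  rewrite big_split/= sumrN -mulr_sumr -/(smean (g ^~ w)).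
  rewrite (bigD1 i)//= eqxx mul1r big1 ?addr0; first by ring.
  by move=> j; rewrite eq_sym => /negbTE ->; rewrite mul0r.
have sc i : \sum_j c i j ^+ 2 = N%:R / N.+1%:R.
  rewrite (bigD1 i)//= /c eqxx (eq_bigr (fun=> (N.+1%:R^-1) ^+ 2)); last first.
    by move=> j; rewrite eq_sym => /negbTE ->; rewrite sub0r sqrrN.
  rewrite sumr_const cardC1 card_ord/= -[_ *+ N]mulr_natl.
  have -> : N.+1%:R = N%:R + 1 :> F by rewrite natr1. field. by rewrite natr1.
have e2 w : (svar (fun i => y i + g i w))%:E =
   (\sum_i (N%:R^-1)%:E * (((y i - smean y) + \sum_j c i j * g j w) ^+ 2)%:E)%E.
  rewrite /svar mulr_sumr -sumEFin; apply: eq_bigr => i _.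
  by rewrite E EFinM.
under eq_integral do rewrite e2.
have mi i : measurable_fun setT (fun w => ((y i - smean y) + \sum_j c i j * g j w) ^+ 2).
  apply: measurable_funX; apply: measurable_funD => //; exact: measurable_sum_scale.
rewrite ge0_integral_sum//; last 2 first.
- by move=> i; apply: measurable_funeM; apply/measurable_EFinP.
- by move=> i w _; rewrite mule_ge0// lee_fin ?sqr_ge0 ?invr_ge0.
transitivity (\sum_(i < N.+1) (N%:R^-1 * (((y i - smean y) ^+ 2) + s * (N%:R / N.+1%:R)))%:E)%E.
  apply: eq_bigr => i _; rewrite ge0_integralZl//; last 2 first.
  - exact/measurable_EFinP.
  - by move=> w _; rewrite lee_fin sqr_ge0.
  by rewrite (second_moment_sum ind mg g1 g2) ?index_enum_uniq// -mulr_suml sc mulrC EFinM mulrC.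
rewrite sumEFin; congr EFin; rewrite -mulr_sumr big_split/= sumr_const card_ord.
rewrite mulrDr -/(svar y); congr (_ + _).
rewrite -[_ *+ _]mulr_natl.
have e : N.+1%:R = N%:R + 1 :> F by rewrite natr1.
by move: N1; rewrite e => N1'; field; rewrite NN N1'.
Qed.

End random.

(** By [svarD], the deviation is, up to signs, the sum of four terms: a cross term
    (2 / N) sum_i (y_i - mean) g_i, whose coefficients have squares of sum
    4 svar(y) / N; the sum of the g_i ^ 2 - s, divided by N; the constant s / N; and
    (sum_i g_i) ^ 2 / (N (N + 1)).  [even_moment_sum] applies to the first two with
    exponent q and to the last one with exponent 2q. *)
Lemma svar_fluctuation (M : nat -> F) (L s0 : F) (q : nat) : (0 < q)%N ->
  exists2 C : F, 0 <= C &
  forall (dp : measure_display) (T : measurableType dp)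
    (P : probability T F) (N : nat) (g : 'I_N.+1 -> T -> F) (s : F) (y : 'I_N.+1 -> F),
  (0 < N)%N -> 0 <= s <= s0 ->
  independent_family P g -> independent_family P (fun i w => g i w ^+ 2 - s) ->
  (forall i, measurable_fun setT (g i)) ->
  (forall i, \int[P]_w (g i w)%:E = 0)%E ->
  (forall i, \int[P]_w (g i w ^+ 2)%:E = s%:E)%E ->
  (forall i k, \int[P]_w (g i w ^+ k.*2)%:E <= (M k)%:E)%E ->
  svar y <= L ->
  (\int[P]_w ((svar (fun i => y i + g i w) - (svar y + s)) ^+ q.*2)%:E
    <= (C / N%:R ^+ q)%:E)%E.
Proof.
move=> q0.
pose M2 k : F := 2 ^+ k.*2 * (M k.*2 + s0 ^+ k.*2).
have [C1 C10 H1] := even_moment_sum M q.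
have [C2 C20 H2] := even_moment_sum M2 q.
have [C3 C30 H3] := even_moment_sum M q.*2.
pose K : F := 2 ^+ q.*2.
have K0 : 0 <= K by rewrite exprn_ge0.
pose CC := K * (K * (C1 * (4 * `|L|) ^+ q + C2 * 2 ^+ q) + K * (`|s0| ^+ q.*2 + C3)).
exists CC.
  by rewrite !(mulr_ge0, addr_ge0, exprn_ge0).
move=> dp T P N g s y N0 /andP[s_ge0 ss0] ind1 ind2 mg g1 g2 gM yL.
have NN : 0 < N%:R :> F by rewrite ltr0n.
have N1 : 0 < N.+1%:R :> F by rewrite ltr0n.
have NN0 : N%:R != 0 :> F by rewrite gt_eqF.
have N10 : N.+1%:R != 0 :> F by rewrite gt_eqF.
have s00 : 0 <= s0 by exact: le_trans ss0.
have ev := @even_expr_ge0 F.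
pose t1 w := \sum_(i < N.+1) (2 * (y i - smean y)) * g i w.
pose t2 w := \sum_(i < N.+1) 1 * (g i w ^+ 2 - s).
pose t3 w := \sum_(i < N.+1) 1 * g i w.
have mt1 : measurable_fun setT t1 by exact: measurable_sum_scale.
have mt2 : measurable_fun setT t2.
  by apply: measurable_sum_scale => i; apply: measurable_funB => //; exact: measurable_funX.
have mt3 : measurable_fun setT t3 by exact: measurable_sum_scale.
have dec w : svar (fun i => y i + g i w) - (svar y + s) =
   (N%:R^-1 * t1 w + N%:R^-1 * t2 w) + (N%:R^-1 * s + (- (N%:R^-1 * N.+1%:R^-1)) * t3 w ^+ 2).
  rewrite svarD// {2}/svar sum_sqr_center -/(t1 w).
  have -> : t3 w = \sum_i g i w by apply: eq_bigr => i _; rewrite mul1r.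
  have -> : t2 w = \sum_i g i w ^+ 2 - N.+1%:R * s.
    rewrite /t2 -mulr_sumr mul1r big_split/= sumr_const card_ord.
    by rewrite -[_ *+ _]mulr_natl mulrN.
  have e : N.+1%:R = N%:R + 1 :> F by rewrite natr1.
  by move: N10; rewrite e => N1'; field; rewrite NN0 N1'.
have b1 : (\int[P]_w (t1 w ^+ q.*2)%:E <= (C1 * (N%:R * (4 * `|L|)) ^+ q)%:E)%E.
  apply: le_trans (H1 _ _ _ _ _ ind1 mg g1 gM _ _ (index_enum_uniq _)) _.
  rewrite lee_fin ler_wpM2l//; apply: lerXn2r; rewrite ?nnegrE.
  - by rewrite sumr_ge0// => i _; rewrite sqr_ge0.
  - by rewrite !mulr_ge0.
  have -> : \sum_(j < N.+1) (2 * (y j - smean y)) ^+ 2 = N%:R * (4 * svar y).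
    under eq_bigr do rewrite exprMn.
    by rewrite -mulr_sumr /svar; field.
  by rewrite ler_wpM2l ?ler0n// ler_wpM2l// (le_trans yL)// ler_norm.
have gsM i k : (\int[P]_w ((g i w ^+ 2 - s) ^+ k.*2)%:E <= (M2 k)%:E)%E.
  apply: (@le_trans _ _ (\int[P]_w (2 ^+ k.*2 * g i w ^+ k.*2.*2 + (2 ^+ k.*2 * s0 ^+ k.*2) * cst 1 w)%:E)%E).
    apply: ge0_le_integral_pointwise => w; first by rewrite lee_fin ev.
    rewrite lee_fin /= mulr1; apply: le_trans (even_exprD_le _ _ _) _.
    rewrite -mulrDr ler_wpM2l ?exprn_ge0// lerD//.
      by rewrite -exprM mul2n.
    by rewrite even_exprN lerXn2r ?nnegrE.
  rewrite integral_real_lin; last 2 first.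
  - apply: (@integrable_real_ge0 _ _ _ _ _ (M k.*2)) => [|x|] //.
    exact: measurable_funX.
  - exact: integrable_cst_real.
  rewrite integral_cst_real mule1 /M2 mulrDr EFinD leeD//.
  by rewrite [leRHS]EFinM; apply: lee_wpmul2l; rewrite ?lee_fin ?exprn_ge0.
have ig2 i : P.-integrable setT (EFin \o (fun w => g i w ^+ 2)).
  apply: (@integrable_real_ge0 _ _ _ _ _ s) => [|x|]; last by rewrite g2.
    exact: measurable_funX.
  exact: sqr_ge0.
have gs1 i : (\int[P]_w (g i w ^+ 2 - s)%:E = 0)%E.
  transitivity (\int[P]_w (1 * g i w ^+ 2 + (- s) * cst 1 w)%:E)%E.
    by apply: eq_integral => w _; congr EFin; rewrite /=; ring.
  rewrite integral_real_lin//; last exact: integrable_cst_real.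
  by rewrite g2 integral_cst_real -!EFinM -EFinD; congr EFin; ring.
have b2 : (\int[P]_w (t2 w ^+ q.*2)%:E <= (C2 * (N%:R * 2) ^+ q)%:E)%E.
  have mgs i : measurable_fun setT (fun w => g i w ^+ 2 - s).
    by apply: measurable_funB => //; exact: measurable_funX.
  apply: le_trans (H2 _ _ _ _ _ ind2 mgs gs1 gsM _ _ (index_enum_uniq _)) _.
  rewrite lee_fin ler_wpM2l//; apply: lerXn2r; rewrite ?nnegrE.
  - by rewrite sumr_ge0// => i _; rewrite sqr_ge0.
  - by rewrite mulr_ge0 ?ler0n.
  rewrite (eq_bigr (fun=> 1)); last by move=> *; rewrite expr1n.
  rewrite sumr_const card_ord -natrM ler_nat muln2 -addnn -addn1.
  by rewrite leq_add2l.
have b3 : (\int[P]_w (t3 w ^+ q.*2.*2)%:E <= (C3 * N.+1%:R ^+ q.*2)%:E)%E.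
  apply: le_trans (H3 _ _ _ _ _ ind1 mg g1 gM _ _ (index_enum_uniq _)) _.
  rewrite (eq_bigr (fun=> 1)); last by move=> *; rewrite expr1n.
  by rewrite sumr_const card_ord.
have it1 : P.-integrable setT (EFin \o (fun w => t1 w ^+ q.*2)).
  by apply: integrable_real_ge0 b1 => //; exact: measurable_funX.
have it2 : P.-integrable setT (EFin \o (fun w => t2 w ^+ q.*2)).
  by apply: integrable_real_ge0 b2 => //; exact: measurable_funX.
have it3 : P.-integrable setT (EFin \o (fun w => t3 w ^+ q.*2.*2)).
  by apply: integrable_real_ge0 b3 => //; exact: measurable_funX.
pose n1 : F := N%:R^-1; pose n2 : F := N.+1%:R^-1.
have n10 : 0 <= n1 by rewrite invr_ge0.
have n20 : 0 <= n2 by rewrite invr_ge0.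
have ic := integrable_cst_real P ((n1 * s) ^+ q.*2).
pose a1 := K * K * n1 ^+ q.*2.
pose a3 := K * K * (n1 * n2) ^+ q.*2.
apply: (@le_trans _ _ (\int[P]_w (1 * (a1 * t1 w ^+ q.*2 + a1 * t2 w ^+ q.*2)
   + 1 * ((K * K) * cst ((n1 * s) ^+ q.*2) w + a3 * t3 w ^+ q.*2.*2))%:E)%E).
  apply: ge0_le_integral_pointwise => w; first by rewrite lee_fin ev.
  rewrite lee_fin dec -/n1 -/n2; apply: le_trans (even_exprD_le _ _ _) _.
  rewrite -/K !mul1r /a1 /a3 /cst.
  have := even_exprD_le (n1 * t1 w) (n1 * t2 w) q.
  have := even_exprD_le (n1 * s) (- (n1 * n2) * t3 w ^+ 2) q.
  have -> : (- (n1 * n2) * t3 w ^+ 2) ^+ q.*2 = (n1 * n2) ^+ q.*2 * t3 w ^+ q.*2.*2.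
    by rewrite exprMn even_exprN -exprM mul2n.
  rewrite -/K [(n1 * t1 w) ^+ _]exprMn [(n1 * t2 w) ^+ _]exprMn => h1 h2.
  apply: le_trans (ler_wpM2l K0 (lerD h2 h1)) _.
  by rewrite le_eqVlt; apply/orP; left; apply/eqP; ring.
rewrite integral_real_lin; [|exact: integrable_real_lin..].
rewrite integral_real_lin// integral_real_lin// !mul1e integral_cst_real.
have P1 : (a1%:E * (\int[P]_w (t1 w ^+ q.*2)%:E) <= a1%:E * (C1 * (N%:R * (4 * `|L|)) ^+ q)%:E)%E.
  by apply: lee_wpmul2l => //; rewrite lee_fin !mulr_ge0.
have P2 : (a1%:E * (\int[P]_w (t2 w ^+ q.*2)%:E) <= a1%:E * (C2 * (N%:R * 2) ^+ q)%:E)%E.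
  by apply: lee_wpmul2l => //; rewrite lee_fin !mulr_ge0.
have P3 : (a3%:E * (\int[P]_w (t3 w ^+ q.*2.*2)%:E) <= a3%:E * (C3 * N.+1%:R ^+ q.*2)%:E)%E.
  by apply: lee_wpmul2l => //; rewrite lee_fin !mulr_ge0.
apply: le_trans (leeD (leeD P1 P2) (leeD (lexx _) P3)) _.
rewrite -!EFinM -!EFinD lee_fin.
have e1 : n1 ^+ q.*2 * N%:R ^+ q = n1 ^+ q.
  by rewrite -addnn exprD -mulrA -exprMn mulVf// expr1n mulr1.
have e2 : n1 ^+ q.*2 <= n1 ^+ q.
  by rewrite ler_wiXn2l// ?invf_le1 ?ler1n// -addnn leq_addl.
have e3 : n2 ^+ q.*2 * N.+1%:R ^+ q.*2 = 1 by rewrite -exprMn mulVf// expr1n.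
have -> : CC / N%:R ^+ q = CC * n1 ^+ q by rewrite exprVn.
rewrite /a1 /a3 !exprMn in e1 e2 e3 *.
have s2 : s ^+ q.*2 <= `|s0| ^+ q.*2 by rewrite lerXn2r ?nnegrE// ger0_norm.
rewrite /CC !exprMn; move: e1 e2 e3 s2.
have : 0 <= n1 ^+ q.*2 by exact: ev.
set u := n1 ^+ q.*2; set v := n1 ^+ q; set x := N%:R ^+ q.
set z := n2 ^+ q.*2; set t := N.+1%:R ^+ q.*2; set S := s ^+ q.*2; set S0 := `|s0| ^+ q.*2.
move=> u0 e1 e2 e3 s2.
have S_ge0 : 0 <= S by exact: ev.
have f1 : u * S <= v * S0 by apply: ler_pM.
have f2 : u * C3 <= v * C3 by apply: ler_wpM2r.
have -> : K * K * u * (C1 * (x * (4 ^+ q * `|L| ^+ q))) + K * K * u * (C2 * (x * 2 ^+ q)) +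
    (K * K * (u * S) + K * K * (u * z) * (C3 * t))
 = K * K * ((u * x) * (C1 * 4 ^+ q * `|L| ^+ q + C2 * 2 ^+ q) + u * S + u * C3 * (z * t)) by ring.
rewrite e1 e3 mulr1.
have -> : K * (K * (C1 * (4 ^+ q * `|L| ^+ q) + C2 * 2 ^+ q) + K * (S0 + C3)) * v =
   K * K * (v * (C1 * 4 ^+ q * `|L| ^+ q + C2 * 2 ^+ q) + v * S0 + v * C3) by ring.
by rewrite ler_wpM2l ?mulr_ge0// !lerD.
Qed.

End sample_variance.

(** * Moments of the normal law *)
Section gaussian_moments.
Context (F : realType).

(** The density and the Radon-Nikodym derivative have the same integral over every
    measurable set, hence agree almost everywhere. *)
Lemma normal_prob_density (m s : F) (h : F -> F) : s != 0 ->
  measurable_fun setT h -> (forall x, 0 <= h x) ->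
  (\int[normal_prob m s]_x (h x)%:E =
   \int[lebesgue_measure]_x (h x * normal_pdf m s x)%:E)%E.
Proof.
move=> s0 mh h0.
have dom := @normal_prob_dominates F m s.
have mhE : measurable_fun setT (EFin \o h) by exact/measurable_EFinP.
have iRN := Radon_Nikodym_SigmaFinite.f_integrable dom.
rewrite -(Radon_Nikodym_SigmaFinite.change_of_variables dom)//.
have mp : measurable_fun setT (EFin \o normal_pdf m s).
  by apply/measurable_EFinP; exact: measurable_normal_pdf.
apply: ae_eq_integral => //.
- by apply: emeasurable_funM => //; exact: measurable_int iRN.
- apply/measurable_EFinP; apply: measurable_funM => //; exact: measurable_normal_pdf.
- have : ae_eq (@lebesgue_measure F) setT
    (Radon_Nikodym_SigmaFinite.f (normal_prob m s) lebesgue_measure)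
    (EFin \o normal_pdf m s).
    apply: integral_ae_eq => //.
    move=> E _ mE; rewrite -Radon_Nikodym_SigmaFinite.f_integral//.
  by apply: filterS => x /= H /H ->; rewrite EFinM.
Qed.

(** Multiplying a normal density by an exponential of a linear function shifts it,
    and by an exponential of a quadratic function rescales it.  Since every normal
    density has integral 1, this gives the expectation of such exponentials
    without computing an integral. *)
Lemma normal_pdf_tilt (m s a x : F) : s != 0 ->
  expR (a * (x - m) - a ^+ 2 * s ^+ 2 / 2) * normal_pdf m s x =
  normal_pdf (m + a * s ^+ 2) s x.
Proof.
move=> s0; rewrite !normal_pdfE// mulrCA; congr (_ * _).
rewrite /normal_fun -expRD; congr expR; field.
by rewrite s0.
Qed.

Lemma normal_pdf_rescale (m s t x : F) : s != 0 -> 0 < t ->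
  expR (- (t ^- 2 - 1) * ((x - m) ^+ 2 / (2 * s ^+ 2))) * normal_pdf m s x =
  t * normal_pdf m (t * s) x.
Proof.
move=> s0 t0; have t00 : t != 0 by rewrite gt_eqF.
rewrite !normal_pdfE ?mulf_neq0// mulrCA [RHS]mulrA; congr (_ * _).
  rewrite /normal_peak (_ : (t * s) ^+ 2 * pi *+ 2 = t ^+ 2 * (s ^+ 2 * pi *+ 2)); last first.
    by rewrite -mulrnAr; ring.
  by rewrite [in RHS]sqrtrM ?sqr_ge0// sqrtr_sqr gtr0_norm// invfM mulVKf.
rewrite /normal_fun -expRD; congr expR; field.
by rewrite s0.
Qed.

Section law.
Context (dp : measure_display) (T : measurableType dp) (P : probability T F)
  (Y : T -> F) (m v : F).
Hypothesis mY : measurable_fun setT Y.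
Hypothesis v0 : 0 <= v.
Hypothesis lawY : forall E : set (measurableTypeR F), measurable E ->
  P [set w | E (Y w)] = normal_law m v E.

Let mY' : measurable_fun setT (Y : T -> measurableTypeR F).
Proof. by move=> mD A mA; exact: mY. Qed.

Let Y' : {mfun T >-> measurableTypeR F} :=
  HB.pack (Y : T -> measurableTypeR F) (isMeasurableFun.Build _ _ _ _ _ mY').

Lemma law_dirac (h : F -> F) : v = 0 -> measurable_fun setT h -> (forall x, 0 <= h x) ->
  (\int[P]_w (h (Y w))%:E = (h m)%:E)%E.
Proof.
move=> v_0 mh h0.
transitivity (\int[distribution P Y']_x (h x)%:E)%E.
  rewrite /distribution ge0_integral_pushforward//.
  - exact/measurable_EFinP.
  - by move=> x _; rewrite lee_fin.
transitivity (\int[\d_(m : measurableTypeR F)]_x (h x)%:E)%E.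
  apply: eq_measure_integral => E mE _; rewrite /distribution/= /pushforward.
  by have := lawY mE; rewrite /normal_law v_0 eqxx.
rewrite integral_dirac//; last exact/measurable_EFinP.
by rewrite diracT mul1e.
Qed.

Lemma law_density (h : F -> F) : v != 0 -> measurable_fun setT h -> (forall x, 0 <= h x) ->
  (\int[P]_w (h (Y w))%:E =
   \int[lebesgue_measure]_x (h x * normal_pdf m (Num.sqrt v) x)%:E)%E.
Proof.
move=> v_0 mh h0.
transitivity (\int[distribution P Y']_x (h x)%:E)%E.
  rewrite /distribution ge0_integral_pushforward//.
  - exact/measurable_EFinP.
  - by move=> x _; rewrite lee_fin.
rewrite -normal_prob_density//; last by rewrite gt_eqF// sqrtr_gt0 lt_neqAle eq_sym v_0.
apply: eq_measure_integral => E mE _; rewrite /distribution/= /pushforward.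
by have := lawY mE; rewrite /normal_law (negbTE v_0).
Qed.

Let sqrtv0 : v != 0 -> Num.sqrt v != 0.
Proof. by move=> h; rewrite gt_eqF// sqrtr_gt0 lt_neqAle eq_sym h. Qed.

Lemma law_tilt (a : F) :
  (\int[P]_w (expR (a * (Y w - m) - a ^+ 2 * v / 2))%:E = 1)%E.
Proof.
have mh : measurable_fun setT (fun x : F => expR (a * (x - m) - a ^+ 2 * v / 2)).
  apply: measurableT_comp => //; apply: measurable_funB => //; apply: measurable_funM => //.
  exact: measurable_funB.
have [v_0|v_0] := eqVneq v 0.
  rewrite (law_dirac v_0 mh) => [|x]; last exact: expR_ge0.
  by rewrite subrr v_0 !mulr0 mul0r subr0 expR0.
rewrite (law_density v_0 mh) => [|x]; last exact: expR_ge0.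
rewrite -[RHS](integral_normal_pdf (m + a * v) (Num.sqrt v)).
apply: eq_integral => x _; congr EFin.
by rewrite -[in a ^+ 2 * v](sqr_sqrtr v0) normal_pdf_tilt ?sqrtv0// sqr_sqrtr.
Qed.

Lemma law_rescale (t : F) : v != 0 -> 0 < t ->
  (\int[P]_w (expR (- (t ^- 2 - 1) * ((Y w - m) ^+ 2 / (2 * v))))%:E = t%:E)%E.
Proof.
move=> v_0 t0.
have mh : measurable_fun setT (fun x : F => expR (- (t ^- 2 - 1) * ((x - m) ^+ 2 / (2 * v)))).
  apply: measurableT_comp => //; apply: measurable_funM => //; apply: measurable_funM => //.
  by apply: measurable_funX; exact: measurable_funB.
rewrite (law_density v_0 mh) => [|x]; last exact: expR_ge0.
transitivity (\int[lebesgue_measure]_x (t%:E * (normal_pdf m (t * Num.sqrt v) x)%:E))%E.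
  apply: eq_integral => x _; rewrite -EFinM; congr EFin.
  by rewrite -normal_pdf_rescale ?sqrtv0// sqr_sqrtr.
rewrite ge0_integralZl//=; last 3 first.
- by apply/measurable_EFinP; exact: measurable_normal_pdf.
- by move=> x _; rewrite lee_fin normal_pdf_ge0.
- by rewrite lee_fin ltW.
by rewrite integral_normal_pdf mule1.
Qed.

(** Bound on the moment of order 2k of the centred normal law of variance 1: with
    y = 3 x ^ 2 / 8, one has y ^ k <= k! e ^ y and, by [law_rescale] for t = 2, the
    expectation of e ^ y is 2. *)
Definition gauss_moment_bound (k : nat) : F := 2 * (8 / 3) ^+ k * (k`!)%:R.

Lemma expr_le_expR (x : F) k : 0 <= x -> x ^+ k <= (k`!)%:R * expR x.
Proof.
move=> x0; case: k => [|k].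
  by rewrite expr0 fact0 mul1r -[leLHS]expR0 ler_expR.
rewrite -ler_pdivrMl ?ltr0n ?fact_gt0// mulrC.
by apply: le_trans (expR_ge1Dxn k x0); rewrite lerDr.
Qed.

Lemma law_even_moment k :
  (\int[P]_w ((Y w - m) ^+ k.*2)%:E <= (gauss_moment_bound k * v ^+ k)%:E)%E.
Proof.
have ev := @even_expr_ge0 F.
have [v_0|v_0] := eqVneq v 0.
  rewrite (@law_dirac (fun x => (x - m) ^+ k.*2)) ?v_0//.
    rewrite subrr lee_fin !expr0n double_eq0; case: (k == 0%N) / eqP => [->|].
      by rewrite /gauss_moment_bound expr0 fact0 !mulr1 ler1n.
    by rewrite mulr0.
  by apply: measurable_funX; exact: measurable_funB.
have vgt0 : 0 < v by rewrite lt_neqAle eq_sym v_0.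
pose c : F := (8 / 3 * v) ^+ k * (k`!)%:R.
apply: (@le_trans _ _ (\int[P]_w (c%:E * (expR (- (2 ^- 2 - 1) * ((Y w - m) ^+ 2 / (2 * v))))%:E))%E).
  apply: ge0_le_integral_pointwise => w; first by rewrite lee_fin ev.
  rewrite -EFinM lee_fin; set z := _ * (_ / (2 * v)).
  have z0 : 0 <= z.
    rewrite /z mulr_ge0//; last by rewrite divr_ge0 ?sqr_ge0 ?mulr_ge0.
    by rewrite oppr_ge0 subr_le0 invf_le1// -natrX ler1n.
  have -> : (Y w - m) ^+ k.*2 = (8 / 3 * v) ^+ k * z ^+ k.
    rewrite -mul2n exprM -exprMn; congr (_ ^+ k); rewrite /z; field.
    by rewrite v_0.
  by rewrite /c -[leRHS]mulrA ler_wpM2l ?exprn_ge0 ?mulr_ge0// expr_le_expR.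
rewrite ge0_integralZl//=; last 2 first.
- apply/measurable_EFinP; apply: measurableT_comp => //; apply: measurable_funM => //; apply: measurable_funM => //.
  by apply: measurable_funX; exact: measurable_funB.
- by rewrite lee_fin !mulr_ge0 ?exprn_ge0 ?mulr_ge0.
rewrite law_rescale// -EFinM lee_fin /c /gauss_moment_bound exprMn.
by rewrite le_eqVlt; apply/orP; left; apply/eqP; ring.
Qed.

Let m2 : F := fine (\int[P]_w ((Y w - m) ^+ 2)%:E)%E.

Let m2E : (\int[P]_w ((Y w - m) ^+ 2)%:E = m2%:E)%E.
Proof.
rewrite /m2 fineK// ge0_fin_numE; last by apply: integral_ge0 => w _; rewrite lee_fin sqr_ge0.
exact: le_lt_trans (law_even_moment 1) (ltry _).
Qed.

Let iY2 : P.-integrable setT (EFin \o (fun w => (Y w - m) ^+ 2)).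
Proof.
apply: integrable_real_ge0 (law_even_moment 1) => [|w]; last exact: sqr_ge0.
by apply: measurable_funX; exact: measurable_funB.
Qed.

Let iY : P.-integrable setT (EFin \o (fun w => Y w - m)).
Proof.
by apply: integrable_of_sqr iY2; exact: measurable_funB.
Qed.

(** Together with 1 + x <= e ^ x, [law_tilt] gives a E(Y - m) <= a ^ 2 v / 2 for
    every real a, which forces E(Y - m) = 0. *)
Lemma law_mean : (\int[P]_w (Y w - m)%:E = 0)%E.
Proof.
have fn := integrable_fin_num measurableT iY.
set e := fine (\int[P]_w (Y w - m)%:E)%E.
have eE : (\int[P]_w (Y w - m)%:E = e%:E)%E by rewrite /e fineK.
have H a : a * e <= a ^+ 2 * v / 2.
  have : (\int[P]_w (a * (Y w - m) + (1 - a ^+ 2 * v / 2) * cst 1 w)%:E <= 1)%E.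
    rewrite -(law_tilt a); apply: le_integral => //.
    - apply: integrable_real_lin => //; exact: integrable_cst_real.
    - apply: (@integrable_real_ge0 _ _ _ _ _ 1) => [|w|]; last by rewrite law_tilt.
        apply: measurableT_comp => //; apply: measurable_funB => //; apply: measurable_funM => //.
        exact: measurable_funB.
      exact: expR_ge0.
    - move=> w _; rewrite lee_fin; apply: le_trans (expR_ge1Dx _).
      by rewrite /cst le_eqVlt; apply/orP; left; apply/eqP; ring.
  rewrite integral_real_lin//; last exact: integrable_cst_real.
  rewrite eE integral_cst_real -!EFinM -EFinD lee_fin; lra.
rewrite eE; congr EFin; apply/eqP.
have [//|e0] := eqVneq e 0; exfalso.
have v1 : 0 < v + 1 by rewrite ltr_pwDr.
have v1n : v + 1 != 0 by rewrite gt_eqF.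
(* The term of order 1 wins for a small multiple a of e. *)
have := H (e / (v + 1)).
have -> : (e / (v + 1)) ^+ 2 * v / 2 = (e ^+ 2 / (v + 1)) * (v / (2 * (v + 1))) by field; rewrite v1n.
have -> : e / (v + 1) * e = (e ^+ 2 / (v + 1)) * 1 by field; rewrite v1n.
rewrite ler_pM2l; last by rewrite divr_gt0// exprn_even_gt0.
rewrite ler_pdivlMr ?mulr_gt0// => h; move: h v0 v1 => + +; lra.
Qed.

(** Together with 1 + x <= e ^ x, [law_rescale] says that r = E((Y - m) ^ 2) / v
    satisfies (t - 1) (t ^ 2 - (1 + t) r / 2) >= 0 for every t > 0.  This is the
    tangency at t = 1 of two curves, which forces r = 1. *)
Lemma law_variance : (\int[P]_w ((Y w - m) ^+ 2)%:E = v%:E)%E.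
Proof.
have [v_0|v_0] := eqVneq v 0.
  rewrite (@law_dirac (fun x => (x - m) ^+ 2)) ?v_0//.
  - by rewrite subrr expr0n.
  - by apply: measurable_funX; exact: measurable_funB.
  - by move=> x; exact: sqr_ge0.
have vgt0 : 0 < v by rewrite lt_neqAle eq_sym v_0.
pose r := m2 / v.
have H t : 0 < t -> 0 <= (t - 1) * (t ^+ 2 - (1 + t) * r / 2).
  move=> t0; have tn : t != 0 by rewrite gt_eqF.
  have : (\int[P]_w ((- (t ^- 2 - 1) / (2 * v)) * (Y w - m) ^+ 2 + 1 * cst 1 w)%:E <= t%:E)%E.
    rewrite -(law_rescale v_0 t0); apply: le_integral => //.
    - apply: integrable_real_lin => //; exact: integrable_cst_real.
    - apply: (@integrable_real_ge0 _ _ _ _ _ t) => [|w|]; last by rewrite law_rescale.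
        apply: measurableT_comp => //; apply: measurable_funM => //; apply: measurable_funM => //.
        by apply: measurable_funX; exact: measurable_funB.
      exact: expR_ge0.
    - move=> w _; rewrite lee_fin; apply: le_trans (expR_ge1Dx _).
      by rewrite /cst le_eqVlt; apply/orP; left; apply/eqP; ring.
  rewrite integral_real_lin//; last exact: integrable_cst_real.
  rewrite m2E integral_cst_real -!EFinM -EFinD lee_fin mulr1.
  have -> : - (t ^- 2 - 1) / (2 * v) * m2 = (1 - t ^- 2) * r / 2 by rewrite /r; field; rewrite ?v_0 ?tn.
  move=> h.
  have -> : (t - 1) * (t ^+ 2 - (1 + t) * r / 2) = t ^+ 2 * (t - ((1 - t ^- 2) * r / 2 + 1)).
    by field; rewrite tn.
  by rewrite mulr_ge0 ?sqr_ge0// subr_ge0.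
suff r1 : r = 1 by rewrite m2E; congr EFin; rewrite -[LHS](divfK v_0) -/r r1 mul1r.
have r0 : 0 <= r.
  by rewrite divr_ge0// /m2 fine_ge0// integral_ge0// => w _; rewrite lee_fin sqr_ge0.
have [//|r1] := eqVneq r 1; exfalso.
(* At this point the expression above is - (r - 1) ^ 2 / 8. *)
pose t := (1 + r) / 2.
have t0 : 0 < t by rewrite divr_gt0// ltr_pwDl.
have := H t t0.
have -> : (t - 1) * (t ^+ 2 - (1 + t) * r / 2) = - ((r - 1) ^+ 2 / 8) by rewrite /t; field.
by rewrite oppr_ge0 leNgt divr_gt0// exprn_even_gt0//= subr_eq0.
Qed.

End law.
End gaussian_moments.

(** * Quadratic forms and positive definite matrices *)
Section quadratic_forms.
Context (F : realType).

Definition qf k (M : 'M[F]_k) (u : 'cV[F]_k) : F := (u^T *m M *m u) 0 0.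
Definition sqnorm k (u : 'cV[F]_k) : F := (u^T *m u) 0 0.

Section size.
Variable k : nat.
Implicit Types (M D : 'M[F]_k) (u v : 'cV[F]_k).

Lemma qfD M D u : qf (M + D) u = qf M u + qf D u.
Proof. by rewrite /qf mulmxDr mulmxDl mxE. Qed.

Lemma qfN M u : qf (- M) u = - qf M u.
Proof. by rewrite /qf mulmxN mulNmx mxE. Qed.

Lemma qfB M D u : qf (M - D) u = qf M u - qf D u.
Proof. by rewrite qfD qfN. Qed.

Lemma qfZ a M u : qf (a *: M) u = a * qf M u.
Proof. by rewrite /qf -scalemxAr -scalemxAl mxE. Qed.

Lemma qf1 u : qf 1%:M u = sqnorm u.
Proof. by rewrite /qf mulmx1. Qed.

Lemma sqnormE u : sqnorm u = \sum_i u i 0 ^+ 2.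
Proof. by rewrite /sqnorm mxE; apply: eq_bigr => i _; rewrite mxE expr2. Qed.

Lemma sqnorm_ge0 u : 0 <= sqnorm u.
Proof. by rewrite sqnormE sumr_ge0// => i _; rewrite sqr_ge0. Qed.

Lemma sqnorm_gt0 u : u != 0 -> 0 < sqnorm u.
Proof.
move=> u0; rewrite lt_neqAle sqnorm_ge0 andbT eq_sym; apply: contraNneq u0.
rewrite sqnormE => /eqP; rewrite psumr_eq0; last by move=> i _; rewrite sqr_ge0.
move=> /allP h; apply/eqP/matrixP => i j; rewrite mxE ord1.
by have := h i (mem_index_enum _); rewrite sqrf_eq0 => /eqP.
Qed.

Lemma qfE M u : qf M u = \sum_i \sum_j M i j * (u i 0 * u j 0).
Proof.
rewrite /qf mxE exchange_big/=; apply: eq_bigr => j _; rewrite mxE mulr_suml.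
by apply: eq_bigr => i _; rewrite mxE; ring.
Qed.

Definition mx_l1 M : F := \sum_i \sum_j `|M i j|.

Lemma mx_l1_ge0 M : 0 <= mx_l1 M.
Proof. by apply: sumr_ge0 => i _; apply: sumr_ge0. Qed.

Lemma normr_qf_le M u : `|qf M u| <= mx_l1 M * sqnorm u.
Proof.
rewrite qfE /mx_l1 mulr_suml; apply: le_trans (ler_norm_sum _ _ _) _.
apply: ler_sum => i _; rewrite mulr_suml; apply: le_trans (ler_norm_sum _ _ _) _.
apply: ler_sum => j _; rewrite normrM ler_wpM2l//.
have h a : u a 0 ^+ 2 <= sqnorm u.
  by rewrite sqnormE (bigD1 a)//= lerDl sumr_ge0// => b _; rewrite sqr_ge0.
have := h i; have := h j; have := sqr_ge0 (u i 0 - u j 0); have := sqr_ge0 (u i 0 + u j 0).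
by rewrite ler_norml => *; apply/andP; split; nra.
Qed.

Definition basis_vec i : 'cV[F]_k := delta_mx i 0.

Lemma qf_basis M i : qf M (basis_vec i) = M i i.
Proof.
rewrite qfE (bigD1 i)//= [X in _ + X]big1; last first.
  by move=> a ai; apply: big1 => b _; rewrite !mxE (negbTE ai) mul0r mulr0.
rewrite addr0 (bigD1 i)//= big1; last first.
  by move=> b bi; rewrite !mxE (negbTE bi) !mulr0.
by rewrite !mxE !eqxx !mulr1 addr0.
Qed.

Lemma qf_add M u v : M^T = M -> qf M (u + v) = qf M u + qf M v + 2 * (u^T *m M *m v) 0 0.
Proof.
move=> sM; have e (X Y : 'M[F]_1) : (X + Y) 0 0 = X 0 0 + Y 0 0 by rewrite mxE.
rewrite /qf [(u + v)^T]linearD /= !mulmxDl !mulmxDr !e.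
have -> : (v^T *m M *m u) 0 0 = (u^T *m M *m v) 0 0.
  transitivity ((v^T *m M *m u)^T 0 0); first by rewrite [in RHS]mxE.
  by rewrite !trmx_mul trmxK sM mulmxA.
by ring.
Qed.

(** Symmetric matrices are handled through their quadratic forms; this identity
    recovers the entries. *)
Lemma polarization M i j : M^T = M ->
  M i j = (qf M (basis_vec i + basis_vec j) - qf M (basis_vec i) - qf M (basis_vec j)) / 2.
Proof.
move=> sM; rewrite qf_add//.
have -> : ((basis_vec i)^T *m M *m basis_vec j) 0 0 = M i j.
  rewrite /basis_vec trmx_delta -rowE mxE (bigD1 j)//= big1 => [|a aj].
    by rewrite !mxE !eqxx mulr1 addr0.
  by rewrite !mxE (negbTE aj) mulr0.
by field.
Qed.

Lemma sqnorm_basis i : sqnorm (basis_vec i) = 1.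
Proof. by rewrite -qf1 qf_basis mxE eqxx. Qed.

Lemma sqnorm_basis2 i j : sqnorm (basis_vec i + basis_vec j) <= 4.
Proof.
have h : sqnorm (basis_vec i + basis_vec j) <=
    2 * sqnorm (basis_vec i) + 2 * sqnorm (basis_vec j).
  rewrite !sqnormE !mulr_sumr -big_split/=; apply: ler_sum => a _; rewrite mxE.
  by have := sqr_ge0 (basis_vec i a 0 - basis_vec j a 0); nra.
by apply: le_trans h _; rewrite !sqnorm_basis; lra.
Qed.

Lemma psd_symm M : psdmx M -> M^T = M. Proof. by case. Qed.
Lemma psd_ge0 M u : psdmx M -> 0 <= qf M u. Proof. by move=> [_ h]; exact: h. Qed.
Lemma pd_symm M : pdmx M -> M^T = M. Proof. by case. Qed.
Lemma pd_gt0 M u : pdmx M -> u != 0 -> 0 < qf M u. Proof. by case=> _; apply. Qed.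

Lemma pd_psd M : pdmx M -> psdmx M.
Proof.
move=> [sM pM]; split => // u; have [->|u0] := eqVneq u 0; last exact: ltW (pM _ u0).
by rewrite mulmx0 mxE.
Qed.

Lemma loewner_leE M1 M2 : M1^T = M1 -> M2^T = M2 ->
  (forall u, qf M1 u <= qf M2 u) -> M1 <=L M2.
Proof.
move=> s1 s2 h; split; first by rewrite linearB/= s1 s2.
by move=> u; have := h u; rewrite -subr_ge0 -qfB.
Qed.

Lemma pd_add M D : pdmx M -> psdmx D -> pdmx (M + D).
Proof.
move=> [sM pM] [sD pD]; split; first by rewrite linearD/= sM sD.
by move=> u u0; rewrite -/(qf _ _) qfD ltr_wpDr// ?pD// pM.
Qed.

Lemma pd_unit M : pdmx M -> M \in unitmx.
Proof.
move=> [sM pM]; rewrite -row_free_unit -kermx_eq0; apply/rowV0P => v /sub_kermxP vM.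
apply/eqP; apply: contraT => v0.
have := pM v^T; rewrite trmxK vM mul0mx mxE ltxx => h.
by apply: h; apply: contraNneq v0 => e; rewrite -[v]trmxK e trmx0.
Qed.

Lemma symm_inv M : M^T = M -> (invmx M)^T = invmx M.
Proof. by move=> sM; rewrite trmx_inv sM. Qed.

Lemma pd_inv M : pdmx M -> pdmx (invmx M).
Proof.
move=> pM; have uM := pd_unit pM; have sM := pd_symm pM.
split; first exact: symm_inv.
move=> u u0; have := @pd_gt0 _ (invmx M *m u) pM.
rewrite /qf trmx_mul symm_inv// mulmxA mulmxKV//; apply.
by apply: contraNneq u0 => /(congr1 (mulmx M)); rewrite mulKVmx// mulmx0 => ->.
Qed.

(** The quadratic polynomial t |-> (t u + v)' M (t u + v) is nonnegative. *)
Lemma psd_cauchy_schwarz M u v : psdmx M ->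
  ((u^T *m M *m v) 0 0) ^+ 2 <= qf M u * qf M v.
Proof.
move=> pM; have sM := psd_symm pM; set b := (u^T *m M *m v) 0 0.
have H t : 0 <= t ^+ 2 * qf M u + 2 * t * b + qf M v.
  have := psd_ge0 (t *: u + v) pM; rewrite qf_add// /b.
  have -> : qf M (t *: u) = t ^+ 2 * qf M u.
    by rewrite /qf [(t *: u)^T]linearZ /= -!scalemxAl -scalemxAr scalerA mxE expr2.
  have e (X : 'M[F]_1) : (t *: X) 0 0 = t * X 0 0 by rewrite mxE.
  rewrite [(t *: u)^T]linearZ /= -!scalemxAl e -/b => h; apply: le_trans h _.
  by rewrite le_eqVlt; apply/orP; left; apply/eqP; ring.
have qv := psd_ge0 v pM; have qu := psd_ge0 u pM.
have [q0|q0] := eqVneq (qf M u) 0.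
  rewrite q0 mul0r; suff -> : b = 0 by rewrite expr0n.
  apply/eqP; apply: contraT => b0.
  have := H (- (qf M v + 1) / (2 * b)); rewrite q0 mulr0 add0r.
  have -> : 2 * (- (qf M v + 1) / (2 * b)) * b = - (qf M v + 1) by field.
  lra.
have := H (- b / qf M u).
have -> : (- b / qf M u) ^+ 2 * qf M u + 2 * (- b / qf M u) * b + qf M v =
  (qf M u * qf M v - b ^+ 2) / qf M u by field.
by rewrite pmulr_lge0 ?invr_gt0 ?subr_ge0// lt_neqAle eq_sym q0.
Qed.

(** Compactness of the sphere is replaced by the Cauchy-Schwarz inequality between
    u and M^-1 u: |u| ^ 4 <= (u' M u) (u' M^-1 u). *)
Lemma pd_coercive M : pdmx M -> exists2 r : F, 0 < r & forall u, r * sqnorm u <= qf M u.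
Proof.
move=> pM; have uM := pd_unit pM; have sM := pd_symm pM.
exists (mx_l1 (invmx M) + 1)^-1 => [|u]; first by rewrite invr_gt0 ltr_wpDl ?mx_l1_ge0.
have l0 := mx_l1_ge0 (invmx M).
have [->|u0] := eqVneq u 0; first by rewrite /qf /sqnorm !mulmx0 !mxE mulr0.
have s0 := sqnorm_gt0 u0.
have := psd_cauchy_schwarz u (invmx M *m u) (pd_psd pM).
have -> : (u^T *m M *m (invmx M *m u)) 0 0 = sqnorm u by rewrite !mulmxA mulmxK.
have -> : qf M (invmx M *m u) = qf (invmx M) u.
  by rewrite /qf trmx_mul symm_inv// !mulmxA mulmxKV.
have h := le_trans (ler_norm _) (normr_qf_le (invmx M) u).
have qu := psd_ge0 u (pd_psd pM) => H.
rewrite ler_pdivrMl ?ltr_wpDl// mulrC.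
rewrite -(ler_pM2l s0) -expr2; apply: le_trans H _.
rewrite mulrCA ler_wpM2l// mulrC; apply: le_trans h _.
by nra.
Qed.

End size.

Lemma qf_mul k l (C : 'M[F]_(l, k)) (M : 'M[F]_k) (u : 'cV[F]_l) :
  qf (C *m M *m C^T) u = qf M (C^T *m u).
Proof. by rewrite /qf trmx_mul trmxK !mulmxA. Qed.

Lemma qf_mulT k l (C : 'M[F]_(k, l)) (M : 'M[F]_k) (u : 'cV[F]_l) :
  qf (C^T *m M *m C) u = qf M (C *m u).
Proof. by rewrite -{2}[C]trmxK qf_mul trmxK. Qed.

End quadratic_forms.

(** * The Riccati map *)
Section riccati_map.
Context (F : realType) (d d0 : nat) (A : 'M[F]_d) (B : 'M[F]_(d0, d))
  (R : 'M[F]_d) (R0 : 'M[F]_d0).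
Hypotheses (R_pd : pdmx R) (R0_pd : pdmx R0) (S_pd : pdmx (obs_S B R0)).

(** The computations use the positive definite matrix X(p) = S^-1 + p, which is
    affine in p, instead of I + p S = X(p) S, which is not symmetric. *)
Let S := obs_S B R0.
Let Si := invmx S.
Let X (p : 'M[F]_d) := Si + p.
Let Z (p : 'M[F]_d) := invmx (X p).
Let Phi := riccati A B R R0.

Let uS : S \in unitmx. Proof. exact: pd_unit. Qed.
Let sS : S^T = S. Proof. exact: pd_symm. Qed.
Let Si_pd : pdmx Si. Proof. exact: pd_inv. Qed.
Let sSi : Si^T = Si. Proof. exact: pd_symm. Qed.

Section one.
Variable p : 'M[F]_d.
Hypothesis p_psd : psdmx p.

Let X_pd : pdmx (X p). Proof. exact: pd_add. Qed.
Let uX : X p \in unitmx. Proof. exact: pd_unit. Qed.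
Let sX : (X p)^T = X p. Proof. exact: pd_symm. Qed.
Let Z_pd : pdmx (Z p). Proof. exact: pd_inv. Qed.
Let sZ : (Z p)^T = Z p. Proof. exact: pd_symm. Qed.
Let sp : p^T = p. Proof. exact: psd_symm. Qed.

Let XS : 1%:M + p *m S = X p *m S.
Proof. by rewrite /X mulmxDl mulVmx. Qed.

Lemma unit_1DPS : 1%:M + p *m S \in unitmx.
Proof. by rewrite XS unitmx_mul uX uS. Qed.

Let invE : invmx (1%:M + p *m S) = Si *m Z p.
Proof.
have h : (1%:M + p *m S) *m (Si *m Z p) = 1%:M.
  by rewrite XS -mulmxA [S *m _]mulmxA mulmxV// mul1mx mulmxV.
by rewrite -[RHS](mulKmx unit_1DPS) h mulmx1.
Qed.

Let invpE : invmx (1%:M + p *m S) *m p = Si - Si *m Z p *m Si.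
Proof.
rewrite invE.
transitivity (Si *m Z p *m (X p - Si)); first by rewrite [X p]addrC addrK.
by rewrite mulmxBr -[Si *m Z p *m X p]mulmxA mulVmx// mulmx1.
Qed.

(** In this form Phi is visibly monotone and concave, the inverse being
    antitone and convex on positive definite matrices. *)
Lemma riccatiE : Phi p = A *m (Si - Si *m Z p *m Si) *m A^T + R.
Proof. by rewrite /Phi /riccati -invpE !mulmxA. Qed.

Lemma riccati_symm : (Phi p)^T = Phi p.
Proof.
rewrite riccatiE linearD/= !trmx_mul trmxK linearB/= !trmx_mul sSi sZ (pd_symm R_pd).
by rewrite !mulmxA.
Qed.

(** Evaluated at [u], the quadratic form E(p) M E(p)' of the closed loop matrix
    E(p) = A (I + p S)^-1 is the one of [M] at this vector. *)
Definition closed_loop (u : 'cV[F]_d) : 'cV[F]_d :=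
  (A *m invmx (1%:M + p *m S))^T *m u.

Let clE u : closed_loop u = Z p *m (Si *m (A^T *m u)).
Proof. by rewrite /closed_loop invE !trmx_mul sSi sZ !mulmxA. Qed.

Let XclE u : X p *m closed_loop u = Si *m (A^T *m u).
Proof. by rewrite clE mulmxA mulmxV// mul1mx. Qed.

Let qf_symm k (M : 'M[F]_k) (C : 'M[F]_k) w : C^T = C -> qf (C *m M *m C) w = qf M (C *m w).
Proof. by move=> sC; rewrite -{2}sC qf_mul sC. Qed.

Lemma qf_riccati u : qf (Phi p) u =
  qf Si (A^T *m u) - qf (Z p) (X p *m closed_loop u) + qf R u.
Proof.
rewrite riccatiE qfD qf_mul qfB; congr (_ - _ + _).
by rewrite qf_symm// XclE.
Qed.

Lemma qf_Z_closed_loop u : qf (Z p) (X p *m closed_loop u) = qf (X p) (closed_loop u).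
Proof.
rewrite -qf_symm//; congr qf.
by rewrite mulmxV// mul1mx.
Qed.

Let XSX : X p *m S *m X p = X p + p + p *m S *m p.
Proof.
rewrite {1 2}/X !mulmxDl mulVmx// mul1mx mulmxDr -[p *m S *m Si]mulmxA mulmxV// mulmx1.
by rewrite [p + _]addrC /X -!addrA; congr (_ + _); congr (_ + _); rewrite addrC.
Qed.

(** Joseph's form of the Riccati map. *)
Lemma riccati_joseph u : qf (Phi p) u =
  qf p (closed_loop u) + qf S (p *m closed_loop u) + qf R u.
Proof.
rewrite qf_riccati qf_Z_closed_loop; congr (_ + _).
have -> : qf Si (A^T *m u) = qf (X p *m S *m X p) (closed_loop u).
  rewrite qf_symm// XclE -[A^T *m u in LHS](mulKVmx uS).
  rewrite -qf_symm//; congr qf.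
  by rewrite mulmxV// mul1mx.
by rewrite XSX !qfD [qf (p *m S *m p) _]qf_symm//; ring.
Qed.

(** Read along the trajectory P_n, where R dominates a fixed fraction of Phi(P_n),
    this says that the closed loop contracts. *)
Lemma riccati_lower u : qf p (closed_loop u) + qf R u <= qf (Phi p) u.
Proof.
rewrite riccati_joseph lerD2r lerDl; exact/psd_ge0/pd_psd.
Qed.

Lemma riccati_geR u : qf R u <= qf (Phi p) u.
Proof. by apply: le_trans (riccati_lower u); rewrite lerDr psd_ge0. Qed.

Lemma riccati_upper u : qf (Phi p) u <= qf (A *m Si *m A^T + R) u.
Proof.
rewrite [leRHS]qfD qf_mul qf_riccati lerD2r gerBl; exact/psd_ge0/pd_psd.
Qed.

(** Indeed X S X - X = p + p S p is positive semi-definite. *)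
Lemma Z_leS w : qf (Z p) w <= qf S w.
Proof.
have e : X p *m (Z p *m w) = w by rewrite mulmxA mulmxV// mul1mx.
rewrite -[w in leRHS]e -qf_symm// XSX (qfD (X p + p)) (qfD (X p)).
have -> : qf (X p) (Z p *m w) = qf (Z p) w.
  by rewrite -qf_symm//; congr qf; rewrite mulVmx// mul1mx.
rewrite -addrA lerDl addr_ge0//; first exact: psd_ge0.
rewrite qf_symm//; exact/psd_ge0/pd_psd.
Qed.

Lemma Z_ge0 w : 0 <= qf (Z p) w.
Proof. exact/psd_ge0/pd_psd. Qed.

Lemma riccati_psd : psdmx (Phi p).
Proof.
split; first exact: riccati_symm.
move=> u; apply: le_trans (riccati_geR u); exact/psd_ge0/pd_psd.
Qed.

Lemma gain_unit : B *m p *m B^T + R0 \in unitmx.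
Proof.
apply: pd_unit; rewrite addrC; apply: pd_add => //; split.
  by rewrite !trmx_mul trmxK sp mulmxA.
by move=> u; rewrite -/(qf _ _) qf_mul psd_ge0.
Qed.

Lemma gainE : gain B R0 p = invmx (1%:M + p *m S) *m p *m B^T *m invmx R0.
Proof.
set J := invmx (1%:M + p *m S).
have uR0 : R0 \in unitmx by exact: pd_unit.
pose L := J *m p *m B^T *m invmx R0.
have inn := gain_unit.
have h : L *m (B *m p *m B^T + R0) = p *m B^T.
  rewrite mulmxDr /L -[_ *m invmx R0 *m R0]mulmxA mulVmx// mulmx1.
  have -> : J *m p *m B^T *m invmx R0 *m (B *m p *m B^T) = J *m (p *m S) *m (p *m B^T).
    by rewrite /S /obs_S !mulmxA.
  rewrite -[J *m p *m B^T]mulmxA -mulmxDl -{2}[J]mulmx1 -mulmxDr addrC.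
  by rewrite /J mulVmx ?mul1mx// unit_1DPS.
by rewrite /gain -h mulmxK.
Qed.

Lemma one_sub_gain : 1%:M - gain B R0 p *m B = invmx (1%:M + p *m S).
Proof.
rewrite gainE; set J := invmx _.
have -> : J *m p *m B^T *m invmx R0 *m B = J *m (p *m S) by rewrite /S /obs_S !mulmxA.
rewrite -{1}(mulVmx unit_1DPS) -/J mulmxDr mulmx1.
by rewrite addrK.
Qed.

(** The left-hand side is the conditional covariance of a particle after one step:
    the known part is transported by A (I - K B), the noise of the observation by
    A K. *)
Lemma riccati_gain u :
  qf p ((A *m (1%:M - gain B R0 p *m B))^T *m u) +
  qf R0 ((A *m gain B R0 p)^T *m u) + qf R u = qf (Phi p) u.
Proof.
rewrite one_sub_gain -/(closed_loop u) riccati_joseph; congr (_ + _ + _).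
have -> : (A *m gain B R0 p)^T *m u = invmx R0 *m (B *m (p *m closed_loop u)).
  rewrite /closed_loop gainE !trmx_mul trmxK sp (symm_inv (pd_symm R0_pd)).
  by rewrite !mulmxA.
have sR0 := symm_inv (pd_symm R0_pd).
rewrite -(@qf_symm _ R0 (invmx R0))// mulVmx ?pd_unit// mul1mx.
by rewrite /S /obs_S qf_mulT.
Qed.

End one.

(** With D = p - P and x = X(P)^-1 z, expand z' X(p)^-1 z for
    z = X(P) x = X(p) x - D x. *)
Lemma riccati_diff p P u : psdmx p -> psdmx P ->
  qf (Phi p) u - qf (Phi P) u =
  qf (p - P) (closed_loop P u) - qf (Z p) ((p - P) *m closed_loop P u).
Proof.
move=> hp hP; set x := closed_loop P u; set D := p - P.
have pX : pdmx (X p) by exact: pd_add.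
have uX : X p \in unitmx by exact: pd_unit.
have sX : (X p)^T = X p by exact: pd_symm.
have sZ : (Z p)^T = Z p by apply: symm_inv.
have uXP : X P \in unitmx by apply: pd_unit; exact: pd_add.
have XD : X p - D = X P.
  by rewrite /X /D opprB [LHS]addrC addrACA addNr addr0 addrC.
have e : X p *m closed_loop p u = X p *m x + - (D *m x).
  have -> : X p *m closed_loop p u = X P *m x.
    rewrite /x /closed_loop.
    have cl q : psdmx q -> X q *m ((A *m invmx (1%:M + q *m S))^T *m u) = Si *m (A^T *m u).
      move=> hq; have uXq : X q \in unitmx by apply: pd_unit; exact: pd_add.
      have sXq : (X q)^T = X q by apply: pd_symm; exact: pd_add.
      have -> : 1%:M + q *m S = X q *m S by rewrite /X mulmxDl mulVmx.
      have uq : X q *m S \in unitmx by rewrite unitmx_mul uXq uS.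
      have -> : invmx (X q *m S) = Si *m invmx (X q).
        rewrite -[RHS](mulKmx uq) -mulmxA [S *m _]mulmxA mulmxV// mul1mx mulmxV//.
        by rewrite mulmx1.
      by rewrite !trmx_mul sSi (symm_inv sXq) -!mulmxA mulKVmx.
    by rewrite !cl.
  by rewrite -mulNmx -mulmxDl XD.
rewrite !qf_riccati// [in X in _ - X = _]qf_Z_closed_loop// e qf_add// -/x.
have -> : qf (Z p) (- (D *m x)) = qf (Z p) (D *m x).
  by rewrite /qf [(- (D *m x))^T]linearN /= !mulNmx mulmxN opprK.
have -> : qf (Z p) (X p *m x) = qf (X p) x.
  by rewrite /qf trmx_mul sX -!mulmxA mulKmx.
have -> : ((X p *m x)^T *m Z p *m - (D *m x)) 0 0 = - qf D x.
  by rewrite /qf trmx_mul sX mulmxN mxE -!mulmxA mulKVmx.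
have -> : qf (X P) x = qf (X p) x - qf D x.
  by rewrite -qfB XD.
ring.
Qed.

Lemma riccati_tangent p P u : psdmx p -> psdmx P ->
  qf (Phi p) u <= qf (Phi P) u + qf (p - P) (closed_loop P u).
Proof.
by move=> hp hP; rewrite -lerBlDl riccati_diff// gerBl Z_ge0.
Qed.

Lemma riccati_remainder p P u : psdmx p -> psdmx P ->
  qf (Phi P) u + qf (p - P) (closed_loop P u)
    - qf S ((p - P) *m closed_loop P u) <= qf (Phi p) u.
Proof.
move=> hp hP; rewrite -[leRHS](subrK (qf (Phi P) u)) riccati_diff//.
rewrite [leRHS]addrC -addrA lerD2l lerD2l lerN2; exact: Z_leS.
Qed.

(** The upper bound combines the tangent at [P] with [riccati_lower].  For the
    lower bound, if t >= 1 then Phi(p) >= R >= del Phi(P) suffices; if t < 1, the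
    tangent at [p] is used instead, together with (1 - t) P <= p, which bounds
    P - p by a multiple of p. *)
Lemma riccati_contraction p P (del t : F) : psdmx p -> psdmx P ->
  0 <= t -> (forall u, del * qf (Phi P) u <= qf R u) -> 
  (forall u, `|qf (p - P) u| <= t * qf P u) ->
  forall u, `|qf (Phi p) u - qf (Phi P) u| <= (1 - del) * t * qf (Phi P) u.
Proof.
move=> hp hP t0 Hd Ht u.
have Phi0 : 0 <= qf (Phi P) u by exact/psd_ge0/riccati_psd.
have hR := Hd u.
rewrite ler_norml; apply/andP; split; last first.
  have h1 := riccati_tangent u hp hP.
  have h2 := riccati_lower hP u.
  have := Ht (closed_loop P u); rewrite ler_norml => /andP[_ h3].
  have h4 := ler_wpM2l t0 h2; have h5 := ler_wpM2l t0 hR; nra.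
have [t1|t1] := leP 1 t.
  have h1 := riccati_geR hp u.
  have h0 : 0 <= qf R u by exact/psd_ge0/pd_psd.
  have h2 : qf R u <= qf (Phi P) u by exact: riccati_geR.
  have h3 : 0 <= (1 - del) * qf (Phi P) u by rewrite mulrBl mul1r subr_ge0 (le_trans hR).
  have := ler_wpM2r h3 t1; nra.
have h1 := riccati_tangent u hP hp.
have h2 := riccati_lower hp u.
set y := closed_loop p u in h1 h2 *.
have := Ht y; rewrite qfB ler_norml => /andP[h3 _].
have h4 : (1 - t) * qf (P - p) y <= t * qf p y by rewrite qfB; lra.
have t1' : 0 <= 1 - t by lra.
have h5 := ler_wpM2l t1' h1.
have h6 := ler_wpM2l t0 h2.
have h7 := ler_wpM2l t0 hR.
lra.
Qed.

End riccati_map.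

(** * Measurability of matrix expressions *)
Section matrix_measurability.
Context (F : realType) (dp : measure_display) (T : measurableType dp).

Definition measurable_mx k l (M : T -> 'M[F]_(k, l)) :=
  forall i j, measurable_fun setT (fun w => M w i j).

Lemma measurable_mx_cst k l (M : 'M[F]_(k, l)) : measurable_mx (fun=> M).
Proof. by move=> i j; exact: measurable_cst. Qed.

Lemma measurable_mxD k l (M N : T -> 'M[F]_(k, l)) :
  measurable_mx M -> measurable_mx N -> measurable_mx (fun w => M w + N w).
Proof.
move=> mM mN i j; rewrite (_ : (fun _ => _) = (fun w => M w i j + N w i j)).
  exact: measurable_funD.
by apply/funext => w; rewrite mxE.
Qed.

Lemma measurable_mxN k l (M : T -> 'M[F]_(k, l)) :
  measurable_mx M -> measurable_mx (fun w => - M w).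
Proof.
move=> mM i j; rewrite (_ : (fun _ => _) = (fun w => - M w i j)).
  exact: measurable_funN.
by apply/funext => w; rewrite mxE.
Qed.

Lemma measurable_mxB k l (M N : T -> 'M[F]_(k, l)) :
  measurable_mx M -> measurable_mx N -> measurable_mx (fun w => M w - N w).
Proof. by move=> mM mN; apply: measurable_mxD => //; exact: measurable_mxN. Qed.

Lemma measurable_mxZ k l (a : T -> F) (M : T -> 'M[F]_(k, l)) :
  measurable_fun setT a -> measurable_mx M -> measurable_mx (fun w => a w *: M w).
Proof.
move=> ma mM i j; rewrite (_ : (fun _ => _) = (fun w => a w * M w i j)).
  exact: measurable_funM.
by apply/funext => w; rewrite mxE.
Qed.

Lemma measurable_mxM k l m (M : T -> 'M[F]_(k, l)) (N : T -> 'M[F]_(l, m)) :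
  measurable_mx M -> measurable_mx N -> measurable_mx (fun w => M w *m N w).
Proof.
move=> mM mN i j; rewrite (_ : (fun _ => _) = (fun w => \sum_a M w i a * N w a j)).
  by apply: measurable_sum => a; exact: measurable_funM.
by apply/funext => w; rewrite mxE.
Qed.

Lemma measurable_mxT k l (M : T -> 'M[F]_(k, l)) :
  measurable_mx M -> measurable_mx (fun w => (M w)^T).
Proof.
move=> mM i j; rewrite (_ : (fun _ => _) = (fun w => M w j i)); first exact: mM.
by apply/funext => w; rewrite mxE.
Qed.

Lemma measurable_mx_sum k l (I : Type) (r : seq I) (M : I -> T -> 'M[F]_(k, l)) :
  (forall a, measurable_mx (M a)) -> measurable_mx (fun w => \sum_(a <- r) M a w).
Proof.
move=> mM i j; rewrite (_ : (fun _ => _) = (fun w => \sum_(a <- r) M a w i j)).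
  by apply: measurable_sum => a; exact: mM.
by apply/funext => w; rewrite summxE.
Qed.

Lemma measurable_det k (M : T -> 'M[F]_k) :
  measurable_mx M -> measurable_fun setT (fun w => \det (M w)).
Proof.
move=> mM; apply: measurable_sum => s; apply: measurable_funM => //.
by apply: measurable_prod => i _; exact: mM.
Qed.

(** Off 0, the inverse of x is x times a power of x ^ 2. *)
Lemma measurable_inv (f : T -> F) :
  measurable_fun setT f -> measurable_fun setT (fun w => (f w)^-1).
Proof.
move=> mf; rewrite (_ : (fun _ => _) = (fun w => f w * (f w ^+ 2) `^ (-1))).
  apply: measurable_funM => //; apply: (measurableT_comp (measurable_powR _)).
  exact: measurable_funX.
apply/funext => w; have [->|f0] := eqVneq (f w) 0; first by rewrite invr0 mul0r.
by rewrite powR_inv1 ?sqr_ge0// expr2 invfM mulrA mulfV// mul1r.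
Qed.

Lemma measurable_mx_inv k (M : T -> 'M[F]_k) : (forall w, M w \in unitmx) ->
  measurable_mx M -> measurable_mx (fun w => invmx (M w)).
Proof.
move=> uM mM i j.
rewrite (_ : (fun _ => _) = (fun w => (\det (M w))^-1 * cofactor (M w) j i)).
  apply: measurable_funM; first exact/measurable_inv/measurable_det.
  apply: measurable_funM => //; apply: measurable_det => a b.
  rewrite (_ : (fun _ => _) = (fun w => M w (lift j a) (lift i b))); first exact: mM.
  by apply/funext => w; rewrite !mxE.
by apply/funext => w; rewrite /invmx uM !mxE.
Qed.

Lemma measurable_qf k (M : T -> 'M[F]_k) u :
  measurable_mx M -> measurable_fun setT (fun w => qf (M w) u).
Proof.
move=> mM; apply: (measurable_mxM _ (measurable_mx_cst u)) => //.
exact: (measurable_mxM (measurable_mx_cst u^T) mM).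
Qed.

Lemma measurable_sample_cov d N (xi : T -> 'I_N.+1 -> 'cV[F]_d) :
  (forall i, measurable_mx (fun w => xi w i)) ->
  measurable_mx (fun w => sample_cov (xi w)).
Proof.
move=> mxi; apply: measurable_mxZ => //; apply: measurable_mx_sum => i.
have mm : measurable_mx (fun w => xi w i - sample_mean (xi w)).
  apply: measurable_mxB => //; apply: measurable_mxZ => //.
  exact: measurable_mx_sum.
by apply: measurable_mxM => //; exact: measurable_mxT.
Qed.

End matrix_measurability.

Lemma measurable_mx_comp (F : realType) (d1 d2 : measure_display)
  (T1 : measurableType d1) (T2 : measurableType d2) k l (M : T2 -> 'M[F]_(k, l)) (f : T1 -> T2) :
  measurable_fun setT f -> measurable_mx M -> measurable_mx (fun w => M (f w)).
Proof. by move=> mf mM i j; exact: (measurableT_comp (mM i j) mf). Qed.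

(** * Sample covariances *)
Section sample_covariance.
Context (F : realType) (d N : nat).
Implicit Types xi : 'I_N.+1 -> 'cV[F]_d.

Lemma qf_sample_cov xi u :
  qf (sample_cov xi) u = svar (fun i => (u^T *m xi i) 0 0).
Proof.
rewrite /sample_cov qfZ; congr (_ * _).
have -> : qf (\sum_i (xi i - sample_mean xi) *m (xi i - sample_mean xi)^T) u =
   \sum_i qf ((xi i - sample_mean xi) *m (xi i - sample_mean xi)^T) u.
  by rewrite /qf mulmx_sumr mulmx_suml summxE.
have e (X Y : 'M[F]_1) : X 0 0 - Y 0 0 = (X - Y) 0 0 by rewrite !mxE.
apply: eq_bigr => i _.
have -> : smean (fun i => (u^T *m xi i) 0 0) = (u^T *m sample_mean xi) 0 0.
  by rewrite /smean /sample_mean -scalemxAr mulmx_sumr mxE summxE.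
set x := xi i - _.
have -> : (u^T *m xi i) 0 0 - (u^T *m sample_mean xi) 0 0 = (u^T *m x) 0 0.
  by rewrite /x mulmxBr e.
have -> : qf (x *m x^T) u = ((u^T *m x) *m (u^T *m x)^T) 0 0.
  by rewrite /qf trmx_mul trmxK !mulmxA.
by rewrite mxE big_ord_recl big_ord0 addr0 [X in _ * X]mxE expr2.
Qed.

Lemma sample_cov_symm xi : (sample_cov xi)^T = sample_cov xi.
Proof.
rewrite /sample_cov linearZ/= linear_sum/=; congr (_ *: _).
by apply: eq_bigr => i _; rewrite trmx_mul trmxK.
Qed.

Lemma sample_cov_psd xi : psdmx (sample_cov xi).
Proof.
split; first exact: sample_cov_symm.
by move=> u; rewrite -/(qf _ _) qf_sample_cov svar_ge0.
Qed.

Lemma symm_eq (M1 M2 : 'M[F]_d) : M1^T = M1 -> M2^T = M2 -> (forall u, qf M1 u = qf M2 u) -> M1 = M2.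
Proof.
by move=> s1 s2 h; apply/matrixP => i j; rewrite !polarization// !h.
Qed.

Lemma sample_cov_shift xi c : sample_cov (fun i => xi i + c) = sample_cov xi.
Proof.
apply: symm_eq; [exact: sample_cov_symm..|] => u; rewrite !qf_sample_cov.
rewrite -(svar_shift (fun i => (u^T *m xi i) 0 0) ((u^T *m c) 0 0)); congr svar.
by apply/funext => i; rewrite mulmxDr mxE.
Qed.

End sample_covariance.

(** * The random inputs of the filter *)
Section gaussian_functional.
Context (F : realType) (dp : measure_display) (T : measurableType dp)
  (P : probability T F).

(** What the estimates on sample variances require of a noise term. *)
Record centered_moments (Y : T -> F) (v : F) (M : nat -> F) : Prop := CenteredMoments {
  cm_measurable : measurable_fun setT Y ;
  cm_mean : (\int[P]_w (Y w)%:E = 0)%E ;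
  cm_variance : (\int[P]_w (Y w ^+ 2)%:E = v%:E)%E ;
  cm_even : forall k, (\int[P]_w (Y w ^+ k.*2)%:E <= (M k)%:E)%E }.

Lemma measurable_functional k (X : T -> 'cV[F]_k) (u : 'cV[F]_k) :
  random_vector X -> measurable_fun setT (fun w => (u^T *m X w) 0 0).
Proof.
move=> mX; rewrite (_ : (fun _ => _) = (fun w => \sum_i u i 0 * X w i 0)).
  by apply: measurable_sum => i; apply: measurable_funM.
by apply/funext => w; rewrite mxE; apply: eq_bigr => i _; rewrite mxE.
Qed.

Lemma gaussian_functional k (X : T -> 'cV[F]_k) (m : 'cV[F]_k) (C : 'M[F]_k) u :
  gaussian_vector P X m C -> psdmx C ->
  centered_moments (fun w => (u^T *m X w) 0 0 - (u^T *m m) 0 0) (qf C u)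
    (fun k => gauss_moment_bound F k * qf C u ^+ k).
Proof.
move=> [mX gX] C_psd; have mY := measurable_functional u mX.
have v0 := psd_ge0 u C_psd; have lawY := gX u.
split.
- exact: measurable_funB.
- exact: (law_mean mY v0 lawY).
- exact: (law_variance mY v0 lawY).
- exact: (law_even_moment mY v0 lawY).
Qed.

(** The variance is the case of two variables with coefficients 1 and -1 of
    [second_moment_sum]. *)
Lemma centered_moments_sub (Y1 Y2 : T -> F) v1 v2 M1 M2 :
  centered_moments Y1 v1 M1 -> centered_moments Y2 v2 M2 ->
  independent_family P (fun b : bool => if b then Y1 else Y2) ->
  centered_moments (fun w => Y1 w - Y2 w) (v1 + v2)
    (fun k => 2 ^+ k.*2 * (M1 k + M2 k)).
Proof.
move=> [m1 e1 s1 k1] [m2 e2 s2 k2] ind.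
have ev := @even_expr_ge0 F.
have ik1 k : P.-integrable setT (EFin \o (fun w => Y1 w ^+ k.*2)).
  by apply: (integrable_real_ge0 _ _ (k1 k)) => //; exact: measurable_funX.
have ik2 k : P.-integrable setT (EFin \o (fun w => Y2 w ^+ k.*2)).
  by apply: (integrable_real_ge0 _ _ (k2 k)) => //; exact: measurable_funX.
split.
- exact: measurable_funB.
- transitivity (\int[P]_w (1 * Y1 w + (- 1) * Y2 w)%:E)%E.
    by apply: eq_integral => w _; congr EFin; ring.
  rewrite integral_real_lin; [|exact: integrable_of_sqr (ik1 1%N)|exact: integrable_of_sqr (ik2 1%N)].
  by rewrite e1 e2 !mule0 adde0.
- pose c (b : bool) : F := if b then 1 else -1.
  have mb (b : bool) : measurable_fun setT (if b then Y1 else Y2) by case: b.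
  have eb (b : bool) : (\int[P]_w ((if b then Y1 else Y2) w)%:E = 0)%E by case: b.
  have sb (b : bool) : (\int[P]_w ((if b then Y1 else Y2) w ^+ 2)%:E = (if b then v1 else v2)%:E)%E by case: b.
  have := second_moment_sum ind mb eb sb c 0 (s := [:: true; false]) erefl.
  rewrite !big_cons big_nil /c /= !expr1n sqrrN expr1n expr0n/= !mul1r addr0 add0r => <-.
  apply: eq_integral => w _; congr EFin; rewrite !big_cons big_nil /=; ring.
- move=> k.
  apply: (@le_trans _ _ (\int[P]_w (2 ^+ k.*2 * Y1 w ^+ k.*2 + 2 ^+ k.*2 * Y2 w ^+ k.*2)%:E)%E).
    apply: ge0_le_integral_pointwise => w; first by rewrite lee_fin ev.
    rewrite lee_fin -mulrDr; apply: le_trans (even_exprD_le _ _ _) _.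
    by rewrite even_exprN.
  rewrite integral_real_lin// mulrDr EFinD !EFinM.
  by apply: leeD; apply: lee_wpmul2l; rewrite ?lee_fin ?exprn_ge0.
Qed.

End gaussian_functional.

Section noise_labels.
Context (F : realType) (d d0 : nat) (R : 'M[F]_d) (R0 : 'M[F]_d0)
  (m0 : 'cV[F]_d) (P0 : 'M[F]_d) (N : nat) (E : enkf_input R R0 m0 P0 N).

Local Notation Om := (Omega E).
Local Notation P := (Prob E).

(** The labels are given a decidable equality classically, in order to form
    duplicate-free lists of them. *)
Definition noise_sigma (a : {classic noise_label N}) : set (set Om) :=
  match a with
  | LabX0 => sigma_vector (@X0 _ _ _ _ _ _ _ _ E)
  | LabW n => sigma_vector (@W _ _ _ _ _ _ _ _ E n)
  | LabV n => sigma_vector (@V _ _ _ _ _ _ _ _ E n)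
  | LabXi0 i => sigma_vector (@xi0 _ _ _ _ _ _ _ _ E i)
  | LabCW n i => sigma_vector (@calW _ _ _ _ _ _ _ _ E n i)
  | LabCV n i => sigma_vector (@calV _ _ _ _ _ _ _ _ E n i)
  end.

Lemma sigma_vector_pi k (X : Om -> 'cV[F]_k) : random_vector X -> pi_system (sigma_vector X).
Proof.
move=> mX; rewrite /sigma_vector /g_sigma_preimage.
set G := (\big[setU/set0]_(i < k) _).
have Gm : G `<=` measurable.
  move=> A.
  rewrite /G; elim/big_ind : _ => [//|B C hB hC [/hB //|/hC //]|i _ [D mD <-]].
  rewrite setTI; have := mX i measurableT D mD; by rewrite setTI.
split.
- exact: g_sigma_sub.
- exact: (@measurableT _ (g_sigma_algebraType G)).
- move=> A C; exact: (@measurableI _ (g_sigma_algebraType G)).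
Qed.

Lemma noise_sigma_pi a : pi_system (noise_sigma a).
Proof.
case: a => [|n|n|i|n i|n i] /=; apply: sigma_vector_pi.
- exact: (X0_gaussian E).1.
- exact: (W_gaussian E n).1.
- exact: (V_gaussian E n).1.
- exact: (xi0_gaussian E i).1.
- exact: (calW_gaussian E n i).1.
- exact: (calV_gaussian E n i).1.
Qed.

Lemma noise_sigma_indep : mutually_independent P noise_sigma.
Proof. exact: (@inputs_independent _ _ _ _ _ _ _ _ E). Qed.

Lemma noise_measurable k (X : Om -> 'cV[F]_k) (J : set {classic noise_label N}) a :
  noise_sigma a = sigma_vector X -> J a ->
  measurable_mx (X : label_space noise_sigma J -> 'cV[F]_k).
Proof.
move=> aX Ja i j; rewrite ord1 => _ A mA; rewrite setTI.
apply: sub_sigma_algebra; apply: (sub_cylinders noise_sigma_pi Ja); rewrite aX.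
apply: sub_sigma_algebra; rewrite (bigD1 i)//=; left.
by exists A => //; rewrite setTI.
Qed.

End noise_labels.

(** * One step of the ensemble *)
Section ensemble.
Context (F : realType) (d d0 : nat)
  (A : 'M[F]_d) (B : 'M[F]_(d0, d)) (R : 'M[F]_d) (R0 : 'M[F]_d0)
  (m0 : 'cV[F]_d) (P0 : 'M[F]_d).
Hypotheses (R_pd : pdmx R) (R0_pd : pdmx R0) (P0_pd : pdmx P0)
  (S_pd : pdmx (obs_S B R0)).

Section fixed_input.
Context (N : nat) (E : enkf_input R R0 m0 P0 N).

Local Notation Om := (Omega E).
Local Notation P := (Prob E).
Local Notation label := {classic noise_label N}.

Definition filter_step (xi : 'I_N.+1 -> 'cV[F]_d) (v : 'I_N.+1 -> 'cV[F]_d0)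
    (w : 'I_N.+1 -> 'cV[F]_d) (i : 'I_N.+1) : 'cV[F]_d :=
  let K := gain B R0 (sample_cov xi) in
  A *m (1%:M - K *m B) *m xi i + (w i - A *m K *m v i).

(** The particles from which everything that is common to all of them, in
    particular the observation, has been removed. *)
Fixpoint free_particles (n : nat) (w : Om) : 'I_N.+1 -> 'cV[F]_d :=
  if n is k.+1 then
    filter_step (free_particles k w) (fun i => calV (e:=E) k i w) (fun i => calW (e:=E) k.+1 i w)
  else fun i => xi0 (e:=E) i w.

(** The gain depends on the particles through their sample covariance only, so a
    common translation is transported to a common translation. *)
Lemma particles_shift n w : exists c, forall i,
  particles A B n w i = free_particles n w i + c.
Proof.
elim: n => [|n [c IH]]; first by exists 0 => i; rewrite addr0.
have sc : sample_cov (particles A B n w) = sample_cov (free_particles n w).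
  by rewrite -[RHS](sample_cov_shift _ c); congr sample_cov; apply/funext.
pose K := gain B R0 (sample_cov (free_particles n w)).
exists (A *m (1%:M - K *m B) *m c + A *m K *m observation A B n w) => i.
rewrite /= /enkf_step sc -/K IH /filter_step -/K.
have h (K' : 'M[F]_(d, d0)) (x : 'cV[F]_d) (y z : 'cV[F]_d0) : A *m (x + K' *m (y - (B *m x + z))) =
    A *m (1%:M - K' *m B) *m x + (A *m K' *m y - A *m K' *m z).
  rewrite (mulmxDr A) (mulmxBr K') (mulmxDr K') (mulmxBr A) (mulmxDr A).
  rewrite (mulmxBr A 1%:M) mulmx1 mulmxBl !mulmxA.
  set a1 := A *m x; set a2 := A *m K' *m y; set a3 := _ *m B *m x; set a4 := _ *m z.
  move: a1 a2 a3 a4 => a1 a2 a3 a4.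
  by apply/matrixP => i' j'; rewrite !mxE; ring.
rewrite h mulmxDr.
set a1 := _ *m free_particles _ _ _; set a2 := _ *m c; set a3 := _ *m observation _ _ _ _.
set a4 := _ *m calV _ _ _; set a5 := calW _ _ _.
move: a1 a2 a3 a4 a5 => a1 a2 a3 a4 a5.
by apply/matrixP => i' j'; rewrite !mxE; ring.
Qed.

Lemma enkf_covE n w : enkf_cov A B n w = sample_cov (free_particles n w).
Proof.
have [c h] := particles_shift n w.
by rewrite -[RHS](sample_cov_shift _ c) /enkf_cov; congr sample_cov; apply/funext.
Qed.

(** The inputs that determine the free particles at time n, and those that enter
    between the times n and n + 1. *)
Definition past (n : nat) : set label := fun a =>
  match (a : noise_label N) with
  | LabXi0 _ => True
  | LabCW k _ => (k <= n)%N
  | LabCV k _ => (k < n)%N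
  | _ => False
  end.

Definition fresh (n : nat) : set label := fun a =>
  match (a : noise_label N) with
  | LabCW k _ => k = n.+1
  | LabCV k _ => k = n
  | _ => False
  end.

Lemma past_fresh n : past n `&` fresh n = set0.
Proof.
apply/seteqP; split=> // -[|k|k|i|k i|k i] [] //=; first by move=> + ke; rewrite ke ltnn.
by move=> + ke; rewrite ke ltnn.
Qed.

Lemma measurable_filter_step dp (T : measurableType dp)
    (xi : 'I_N.+1 -> T -> 'cV[F]_d) (v : 'I_N.+1 -> T -> 'cV[F]_d0)
    (w : 'I_N.+1 -> T -> 'cV[F]_d) i :
  (forall i, measurable_mx (xi i)) -> (forall i, measurable_mx (v i)) ->
  (forall i, measurable_mx (w i)) ->
  measurable_mx (fun t => filter_step (xi ^~ t) (v ^~ t) (w ^~ t) i).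
Proof.
move=> mxi mv mw.
have mp : measurable_mx (fun t => sample_cov (xi ^~ t)).
  exact: (measurable_sample_cov (xi := fun t => xi ^~ t)).
have mK : measurable_mx (fun t => gain B R0 (sample_cov (xi ^~ t))).
  apply: measurable_mxM; first by apply: measurable_mxM => //; exact: measurable_mx_cst.
  apply: measurable_mx_inv.
    by move=> t; apply: gain_unit => //; exact: sample_cov_psd.
  apply: measurable_mxD; last exact: measurable_mx_cst.
  apply: measurable_mxM; last exact: measurable_mx_cst.
  by apply: measurable_mxM => //; exact: measurable_mx_cst.
apply: measurable_mxD; last apply: measurable_mxB => //.
  apply: measurable_mxM => //; apply: measurable_mxM; first exact: measurable_mx_cst.
  apply: measurable_mxB; first exact: measurable_mx_cst.
  by apply: measurable_mxM => //; exact: measurable_mx_cst.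
apply: measurable_mxM => //; apply: measurable_mxM => //; exact: measurable_mx_cst.
Qed.

Lemma measurable_free_particles n i :
  measurable_mx (fun w : label_space (@noise_sigma _ _ _ _ _ _ _ _ E) (past n) =>
    free_particles n w i).
Proof.
elim: n i => [|n IH] i.
  exact: (@noise_measurable _ _ _ _ _ _ _ _ E _ _ (past 0) (LabXi0 i)).
have sub : past n `<=` past n.+1.
  by move=> [|k|k|j|k j|k j] //= h; [exact: leqW|exact: ltnW].
apply: measurable_filter_step => j.
- by move=> a b; apply: (label_measurableS sub); exact: IH.
- by apply: (@noise_measurable _ _ _ _ _ _ _ _ E _ _ (past n.+1) (LabCV n j)) => /=.
- by apply: (@noise_measurable _ _ _ _ _ _ _ _ E _ _ (past n.+1) (LabCW n.+1 j)) => /=.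
Qed.

Lemma measurable_free_particlesT n i : measurable_mx (fun w : Om => free_particles n w i).
Proof.
move=> a b; apply: (label_measurableT (@noise_sigma_pi _ _ _ _ _ _ _ _ E)).
exact: measurable_free_particles.
Qed.

Lemma label_functional k (X : Om -> 'cV[F]_k) (J : set label) a (u : 'cV[F]_k) :
  noise_sigma (E:=E) a = sigma_vector X -> J a ->
  label_measurable (@noise_sigma _ _ _ _ _ _ _ _ E) J (fun w => (u^T *m X w) 0 0).
Proof.
move=> aX Ja.
have mX := noise_measurable aX Ja.
have mu := @measurable_mx_cst _ _ (label_space (@noise_sigma _ _ _ _ _ _ _ _ E) J) _ _ u^T.
exact: (measurable_mxM mu mX 0 0).
Qed.

Definition step_noise n (u : 'cV[F]_d) (v : 'cV[F]_d0) (i : 'I_N.+1) (w : Om) : F :=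
  (u^T *m calW (e:=E) n.+1 i w) 0 0 - (v^T *m calV (e:=E) n i w) 0 0.

Lemma step_noise_moments n u v i :
  centered_moments P (step_noise n u v i) (qf R u + qf R0 v)
    (fun k => 2 ^+ k.*2 * (gauss_moment_bound F k * qf R u ^+ k + gauss_moment_bound F k * qf R0 v ^+ k)).
Proof.
apply: centered_moments_sub.
- have := gaussian_functional u (calW_gaussian E n.+1 i) (pd_psd R_pd).
  by rewrite mulmx0 mxE; under eq_fun do rewrite subr0.
- have := gaussian_functional v (calV_gaussian E n i) (pd_psd R0_pd).
  by rewrite mulmx0 mxE; under eq_fun do rewrite subr0.
- apply: (independent_family_labels (@noise_sigma_pi _ _ _ _ _ _ _ _ E)
     (@noise_sigma_indep _ _ _ _ _ _ _ _ E)
     (J := fun b : bool => if b then [set (LabCW n.+1 i : label)] else [set (LabCV n i : label)])).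
  + by move=> [] [] // _; apply/seteqP; split=> // a [/= -> ].
  + by move=> []; [exact: (@label_functional _ _ _ (LabCW n.+1 i))|exact: (@label_functional _ _ _ (LabCV n i))].
Qed.

Lemma step_noise_label n u v i : label_measurable (@noise_sigma _ _ _ _ _ _ _ _ E)
  [set (LabCW n.+1 i : label); (LabCV n i : label)] (step_noise n u v i).
Proof.
apply: measurable_funB.
- by apply: (@label_functional _ _ _ (LabCW n.+1 i)) => //; left.
- by apply: (@label_functional _ _ _ (LabCV n i)) => //; right.
Qed.

Lemma step_noise_disjoint n (i j : 'I_N.+1) : i != j ->
  [set (LabCW n.+1 i : label); (LabCV n i : label)] `&`
  [set (LabCW n.+1 j : label); (LabCV n j : label)] = set0.
Proof.
move=> ij; apply/seteqP; split => // a [/= [->|->] [] // [ji]];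
by move: ij; rewrite ji eqxx.
Qed.

Lemma step_noise_indep n u v : independent_family P (step_noise n u v).
Proof.
apply: (independent_family_labels (@noise_sigma_pi _ _ _ _ _ _ _ _ E)
     (@noise_sigma_indep _ _ _ _ _ _ _ _ E)
     (J := fun i => [set (LabCW n.+1 i : label); (LabCV n i : label)])).
- exact: step_noise_disjoint.
- exact: step_noise_label.
Qed.

Lemma step_noise_indep2 n u v s :
  independent_family P (fun i w => step_noise n u v i w ^+ 2 - s).
Proof.
apply: (independent_family_labels (@noise_sigma_pi _ _ _ _ _ _ _ _ E)
     (@noise_sigma_indep _ _ _ _ _ _ _ _ E)
     (J := fun i => [set (LabCW n.+1 i : label); (LabCV n i : label)])).
- exact: step_noise_disjoint.
- move=> i; apply: measurable_funB => //; apply: measurable_funX.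
  exact: step_noise_label.
Qed.

Definition initial_noise (u : 'cV[F]_d) (i : 'I_N.+1) (w : Om) : F :=
  (u^T *m xi0 (e:=E) i w) 0 0 - (u^T *m m0) 0 0.

Lemma initial_noise_moments u i :
  centered_moments P (initial_noise u i) (qf P0 u)
    (fun k => gauss_moment_bound F k * qf P0 u ^+ k).
Proof. exact: gaussian_functional (xi0_gaussian E i) (pd_psd P0_pd). Qed.

Lemma initial_noise_label u i : label_measurable (@noise_sigma _ _ _ _ _ _ _ _ E)
  [set (LabXi0 i : label)] (initial_noise u i).
Proof.
by apply: measurable_funB => //; exact: (@label_functional _ _ _ (LabXi0 i)).
Qed.

Lemma initial_noise_disjoint (i j : 'I_N.+1) : i != j ->
  [set (LabXi0 i : label)] `&` [set (LabXi0 j : label)] = set0.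
Proof.
move=> ij; apply/seteqP; split => // a [/= -> [ji]].
by move: ij; rewrite ji eqxx.
Qed.

Lemma initial_noise_indep u : independent_family P (initial_noise u).
Proof.
apply: (independent_family_labels (@noise_sigma_pi _ _ _ _ _ _ _ _ E)
     (@noise_sigma_indep _ _ _ _ _ _ _ _ E)
     (J := fun i => [set (LabXi0 i : label)])).
- exact: initial_noise_disjoint.
- exact: initial_noise_label.
Qed.

Lemma initial_noise_indep2 u s :
  independent_family P (fun i w => initial_noise u i w ^+ 2 - s).
Proof.
apply: (independent_family_labels (@noise_sigma_pi _ _ _ _ _ _ _ _ E)
     (@noise_sigma_indep _ _ _ _ _ _ _ _ E)
     (J := fun i => [set (LabXi0 i : label)])).
- exact: initial_noise_disjoint.
- move=> i; apply: measurable_funB => //; apply: measurable_funX.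
  exact: initial_noise_label.
Qed.

Lemma qf_initial_cov u w :
  qf (sample_cov (free_particles 0 w)) u = svar (fun i => 0 + initial_noise u i w).
Proof.
rewrite qf_sample_cov -(svar_shift _ (- (u^T *m m0) 0 0)); congr svar.
by apply/funext => i; rewrite add0r.
Qed.

(** In a given direction, the sample covariance after one step is the sample
    variance of a known part plus independent noises. *)
Lemma qf_step_cov n xi u w (K := gain B R0 (sample_cov xi)) :
  qf (sample_cov (filter_step xi (fun i => calV (e:=E) n i w) (fun i => calW (e:=E) n.+1 i w))) u =
  svar (fun i => (((A *m (1%:M - K *m B))^T *m u)^T *m xi i) 0 0 + step_noise n u ((A *m K)^T *m u) i w).
Proof.
rewrite qf_sample_cov; congr svar; apply/funext => i.
have e (X Y : 'M[F]_1) : X 0 0 + Y 0 0 = (X + Y) 0 0 by rewrite mxE.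
have e' (X Y : 'M[F]_1) : X 0 0 - Y 0 0 = (X - Y) 0 0 by rewrite !mxE.
rewrite /step_noise e' e; congr (fun_of_matrix _ 0 0).
by rewrite /filter_step -/K !(trmx_mul, trmxK) mulmxDr (mulmxBr u^T) !mulmxA.
Qed.

Hypothesis N_gt0 : (0 < N)%N.

Lemma initial_expectation u :
  (\int[P]_w (qf (sample_cov (free_particles 0 w)) u)%:E = (qf P0 u)%:E)%E.
Proof.
under eq_integral do rewrite qf_initial_cov.
rewrite (svar_expectation N_gt0 (initial_noise_indep u)
  (fun i => cm_measurable (initial_noise_moments u i))
  (fun i => cm_mean (initial_noise_moments u i))
  (fun i => cm_variance (initial_noise_moments u i)) (fun=> 0)).
by rewrite svar0 add0r.
Qed.

(** With the particles at time n fixed, the expectation is taken over the noises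
    of the step only. *)
Lemma frozen_expectation n xi u :
  (\int[P]_w (qf (sample_cov (filter_step xi (fun i => calV (e:=E) n i w) (fun i => calW (e:=E) n.+1 i w))) u)%:E
   = (qf (riccati A B R R0 (sample_cov xi)) u)%:E)%E.
Proof.
under eq_integral do rewrite qf_step_cov.
set v := (A *m gain B R0 (sample_cov xi))^T *m u.
rewrite (svar_expectation N_gt0 (step_noise_indep n u v)
  (fun i => cm_measurable (step_noise_moments n u v i))
  (fun i => cm_mean (step_noise_moments n u v i))
  (fun i => cm_variance (step_noise_moments n u v i))).
rewrite -qf_sample_cov -(riccati_gain A R R0_pd S_pd (sample_cov_psd xi)) -/v.
by congr EFin; ring.
Qed.

End fixed_input.
End ensemble.

(** * Fluctuations of the sample covariance *)
Section unfreezing.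
Context (F : realType) (d d0 : nat)
  (A : 'M[F]_d) (B : 'M[F]_(d0, d)) (R : 'M[F]_d) (R0 : 'M[F]_d0)
  (m0 : 'cV[F]_d) (P0 : 'M[F]_d).
Hypotheses (R_pd : pdmx R) (R0_pd : pdmx R0) (P0_pd : pdmx P0)
  (S_pd : pdmx (obs_S B R0)).

Local Notation Phi := (riccati A B R R0).
Local Notation Mmax := (A *m invmx (obs_S B R0) *m A^T + R).

Lemma measurable_riccati dp (T : measurableType dp) (M : T -> 'M[F]_d) :
  (forall w, psdmx (M w)) -> measurable_mx M -> measurable_mx (fun w => Phi (M w)).
Proof.
move=> pM mM; apply: measurable_mxD; last exact: measurable_mx_cst.
apply: measurable_mxM; last exact: measurable_mx_cst.
apply: measurable_mxM => //; apply: measurable_mxM; first exact: measurable_mx_cst.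
apply: measurable_mx_inv => [w|]; first exact: (unit_1DPS S_pd).
apply: measurable_mxD; first exact: measurable_mx_cst.
by apply: measurable_mxM => //; exact: measurable_mx_cst.
Qed.

Section fixed_input.
Context (N : nat) (E : enkf_input R R0 m0 P0 N).
Local Notation eta := (@free_particles F d d0 A B R R0 m0 P0 N E).
Local Notation cov n w := (sample_cov (eta n w)).

Lemma measurable_cov n : measurable_mx (fun w => cov n w).
Proof.
by apply: measurable_sample_cov => i; exact: measurable_free_particlesT.
Qed.

(** The measurability of [Psi] is required on every measurable space because it is
    used on the product of two copies of the sample space. *)
Lemma unfreezing n (Psi : 'M[F]_d -> 'M[F]_d -> F) :
  (forall dp (T : measurableType dp) (M1 M2 : T -> 'M[F]_d),
     (forall w, psdmx (M1 w)) -> measurable_mx M1 -> measurable_mx M2 ->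
     measurable_fun setT (fun w => Psi (M1 w) (M2 w))) ->
  (forall p p', 0 <= Psi p p') ->
  (\int[Prob E]_w (Psi (cov n w) (cov n.+1 w))%:E =
   \int[Prob E]_w \int[Prob E]_v (Psi (cov n w)
     (sample_cov (filter_step A B R0 (eta n w) (fun i => calV (e:=E) n i v)
        (fun i => calW (e:=E) n.+1 i v))))%:E)%E.
Proof.
move=> mPsi Psi0.
pose sig := @noise_sigma _ _ _ _ _ _ _ _ E.
pose h w v := (Psi (cov n w) (sample_cov (filter_step A B R0 (eta n w)
  (fun i => calV (e:=E) n i v) (fun i => calW (e:=E) n.+1 i v))))%:E.
rewrite -[LHS]/(\int[Prob E]_w h w w)%E -[RHS]/(\int[Prob E]_w \int[Prob E]_v h w v)%E.
refine (label_freezing (@noise_sigma_pi _ _ _ _ _ _ _ _ E) (@noise_sigma_indep _ _ _ _ _ _ _ _ E)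
   (past_fresh N n) (h := h) _ _); last by move=> x y; rewrite lee_fin.
apply/measurable_EFinP.
pose L1 := label_space sig (@past N n); pose L2 := label_space sig (@fresh N n).
have m1 i : measurable_mx (fun x : L1 * L2 => eta n x.1 i).
  apply: (measurable_mx_comp (f := fst) (M := fun w : L1 => eta n w i)) => //.
  exact: measurable_free_particles.
have m2 i : measurable_mx (fun x : L1 * L2 => calV (e:=E) n i x.2).
  apply: (measurable_mx_comp (f := snd) (M := fun w : L2 => calV (e:=E) n i w)) => //.
  exact: (@noise_measurable _ _ _ _ _ _ _ _ E _ _ (@fresh N n) (LabCV n i)).
have m3 i : measurable_mx (fun x : L1 * L2 => calW (e:=E) n.+1 i x.2).
  apply: (measurable_mx_comp (f := snd) (M := fun w : L2 => calW (e:=E) n.+1 i w)) => //.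
  exact: (@noise_measurable _ _ _ _ _ _ _ _ E _ _ (@fresh N n) (LabCW n.+1 i)).
apply: mPsi.
- by move=> w; exact: sample_cov_psd.
- exact: (measurable_sample_cov (xi := fun x : L1 * L2 => eta n x.1)).
- apply: (measurable_sample_cov (xi := fun x : L1 * L2 => filter_step A B R0 (eta n x.1)
    (fun i => calV (e:=E) n i x.2) (fun i => calW (e:=E) n.+1 i x.2))) => i.
  refine (@measurable_filter_step F d d0 A B R0 R0_pd N _ (L1 * L2)%type (fun i x => eta n x.1 i)
    (fun i x => calV (e:=E) n i x.2) (fun i x => calW (e:=E) n.+1 i x.2) i _ _ _) => //.
Qed.

Hypothesis N_gt0 : (0 < N)%N.

(** The conditional expectation of p_(n+1) given the past is Phi(p_n). *)
Lemma expectation_step n u :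
  (\int[Prob E]_w (qf (cov n.+1 w) u)%:E = \int[Prob E]_w (qf (Phi (cov n w)) u)%:E)%E.
Proof.
pose Psi (p p' : 'M[F]_d) := `|qf p' u|.
have ge0 xi : 0 <= qf (@sample_cov F d N xi) u by exact/psd_ge0/sample_cov_psd.
transitivity (\int[Prob E]_w (Psi (cov n w) (cov n.+1 w))%:E)%E.
  by apply: eq_integral => w _; rewrite /Psi ger0_norm ?ge0.
rewrite unfreezing; last 2 first.
- move=> dp T M1 M2 _ _ mM2; apply: measurableT_comp => //; exact: measurable_qf.
- by move=> p p'; rewrite /Psi normr_ge0.
apply: eq_integral => w _; rewrite -(frozen_expectation A R_pd R0_pd S_pd E N_gt0 n).
by apply: eq_integral => v _; rewrite /Psi ger0_norm ?ge0.
Qed.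

End fixed_input.

(** Moments of the noise in a direction in which the two variances involved are at
    most [L]. *)
Definition noise_bound (L : F) k : F := 2 ^+ k.*2 * (gauss_moment_bound F k * L ^+ k + gauss_moment_bound F k * L ^+ k).

Lemma gauss_moment_bound_ge0 k : 0 <= gauss_moment_bound F k.
Proof. by rewrite !mulr_ge0 ?exprn_ge0. Qed.

(** [svar_fluctuation] is applied conditionally on the past.  Its constant does not
    depend on the past because the variances of the known part and of the noise
    add up to u' Phi(p_n) u <= u' (A S^-1 A' + R) u. *)
Lemma covariance_fluctuation (L : F) q : (0 < q)%N -> exists2 C : F, 0 <= C &
  forall N (E : enkf_input R R0 m0 P0 N) u, (0 < N)%N ->
    qf P0 u <= L -> qf Mmax u <= L ->
  (\int[Prob E]_w ((qf (sample_cov (free_particles A B (E:=E) 0 w)) u - qf P0 u) ^+ q.*2)%:E <= (C / N%:R ^+ q)%:E)%E /\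
  forall n,
  (\int[Prob E]_w ((qf (sample_cov (free_particles A B (E:=E) n.+1 w)) u -
    qf (Phi (sample_cov (free_particles A B (E:=E) n w))) u) ^+ q.*2)%:E <= (C / N%:R ^+ q)%:E)%E.
Proof.
move=> q0; have [C C0 H] := svar_fluctuation (noise_bound L) L L q0.
exists C => // N E u N0 uP0 uM.
have GL a k : 0 <= a <= L -> gauss_moment_bound F k * a ^+ k <= gauss_moment_bound F k * L ^+ k.
  move=> /andP[a0 aL]; rewrite ler_wpM2l ?gauss_moment_bound_ge0// lerXn2r ?nnegrE//.
  exact: le_trans aL.
have P00 : 0 <= qf P0 u by exact/psd_ge0/pd_psd.
have L0 : 0 <= L by exact: le_trans uP0.
split.
  have z := svar0 F N.
  apply: le_trans (H _ _ _ _ (initial_noise (E:=E) u) (qf P0 u) (fun=> 0) N0 _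
    (initial_noise_indep E u) (initial_noise_indep2 E u _)
    (fun i => cm_measurable (initial_noise_moments P0_pd E u i))
    (fun i => cm_mean (initial_noise_moments P0_pd E u i))
    (fun i => cm_variance (initial_noise_moments P0_pd E u i)) _ _).
  - by under eq_integral do rewrite qf_initial_cov -[X in _ - X]add0r -{2}z.
  - by rewrite P00.
  - move=> i k; apply: le_trans (cm_even (initial_noise_moments P0_pd E u i) k) _.
    rewrite lee_fin; apply: le_trans (GL _ k _) _; first by rewrite P00.
    rewrite /noise_bound; set g := _ * L ^+ k.
    have g0 : 0 <= g by rewrite mulr_ge0 ?gauss_moment_bound_ge0 ?exprn_ge0.
    have : 1 <= 2 ^+ k.*2 :> F by rewrite exprn_ege1// ler1n.
    by nra.
  - by rewrite z.
move=> n; pose Psi (p p' : 'M[F]_d) := (qf p' u - qf (Phi p) u) ^+ q.*2.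
rewrite (@unfreezing N E n Psi); last 2 first.
- move=> dp T M1 M2 pM1 mM1 mM2; apply: measurable_funX; apply: measurable_funB.
    exact: measurable_qf.
  by apply: measurable_qf; exact: measurable_riccati.
- by move=> p p'; rewrite exprn_even_ge0 ?odd_double.
rewrite -[leRHS](integral_cst_real (Prob E)).
apply: ge0_le_integral_pointwise => w.
  by apply: integral_ge0 => v _; rewrite lee_fin exprn_even_ge0 ?odd_double.
set xi := free_particles _ _ _ _.
have xi_psd := sample_cov_psd xi.
set K := gain B R0 (sample_cov xi); set v := (A *m K)^T *m u.
have Rg := riccati_gain A R R0_pd S_pd xi_psd u.
have Rle : qf (Phi (sample_cov xi)) u <= L := le_trans (riccati_upper A R S_pd xi_psd u) uM.
have q1 : 0 <= qf (sample_cov xi) ((A *m (1%:M - K *m B))^T *m u) by exact: psd_ge0.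
have q2 : 0 <= qf R u by exact/psd_ge0/pd_psd.
have q3 : 0 <= qf R0 v by exact/psd_ge0/pd_psd.
rewrite -/K -/v in Rg.
pose y (i : 'I_N.+1) := (((A *m (1%:M - K *m B))^T *m u)^T *m xi i) 0 0.
have svy : svar y = qf (sample_cov xi) ((A *m (1%:M - K *m B))^T *m u).
  by rewrite qf_sample_cov.
apply: le_trans (H _ _ _ _ (step_noise (E:=E) n u v) (qf R u + qf R0 v) y N0 _
    (step_noise_indep E n u v) (step_noise_indep2 E n u v _)
    (fun i => cm_measurable (step_noise_moments R_pd R0_pd E n u v i))
    (fun i => cm_mean (step_noise_moments R_pd R0_pd E n u v i))
    (fun i => cm_variance (step_noise_moments R_pd R0_pd E n u v i)) _ _).
- rewrite le_eqVlt; apply/orP; left; apply/eqP; apply: eq_integral => w' _.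
  congr EFin; rewrite /Psi qf_step_cov -/K -/v -/y; congr (_ ^+ _).
  by rewrite -Rg svy; ring.
- by apply/andP; split; lra.
- move=> i k; apply: le_trans (cm_even (step_noise_moments R_pd R0_pd E n u v i) k) _.
  rewrite lee_fin ler_wpM2l ?exprn_ge0// lerD// GL//; apply/andP; split => //; lra.
- by rewrite svy; lra.
Qed.

End unfreezing.

(** * A scalar envelope of the error *)
Section envelope.
Context (F : realType) (d d0 : nat)
  (A : 'M[F]_d) (B : 'M[F]_(d0, d)) (R : 'M[F]_d) (R0 : 'M[F]_d0)
  (m0 : 'cV[F]_d) (P0 : 'M[F]_d).
Hypotheses (R_pd : pdmx R) (R0_pd : pdmx R0) (P0_pd : pdmx P0)
  (S_pd : pdmx (obs_S B R0)).

Local Notation Phi := (riccati A B R R0).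
Local Notation Mmax := (A *m invmx (obs_S B R0) *m A^T + R).
Local Notation Pn := (kalman_cov A B R R0 P0).

Lemma kalman_psd n : psdmx (Pn n).
Proof. by elim: n => [|n IH]; [exact: pd_psd|exact: riccati_psd]. Qed.

(** After time 0, the bounds from below come from P_(n+1) >= R and those from above
    from P_(n+1) <= A S^-1 A' + R; their comparison gives del. *)
Lemma kalman_bounds : exists rho Cm del : F,
  [/\ 0 < rho, 0 < Cm, 0 < del & del <= 1] /\
  forall n u, [/\ rho * sqnorm u <= qf (Pn n) u, qf (Pn n) u <= Cm * sqnorm u
    & del * qf (Pn n.+1) u <= qf R u].
Proof.
have [r1 r10 h1] := pd_coercive R_pd.
have [r2 r20 h2] := pd_coercive P0_pd.
pose rho := Num.min r1 r2.
have rho0 : 0 < rho by rewrite lt_min r10.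
pose Cm := mx_l1 Mmax + mx_l1 P0 + 1.
have l1 := mx_l1_ge0 Mmax; have l2 := mx_l1_ge0 P0.
have Cm0 : 0 < Cm by rewrite /Cm; lra.
pose del := rho / (rho + Cm).
have s0 : 0 < rho + Cm by lra.
have up n u : qf (Pn n) u <= Cm * sqnorm u.
  have su := sqnorm_ge0 u.
  case: n => [|n].
    apply: le_trans (ler_norm _) _; apply: le_trans (normr_qf_le P0 u) _.
    by rewrite ler_wpM2r// /Cm; lra.
  apply: le_trans (riccati_upper A R S_pd (kalman_psd n) u) _.
  apply: le_trans (ler_norm _) _; apply: le_trans (normr_qf_le _ u) _.
  by rewrite ler_wpM2r// /Cm; lra.
have rR u : rho * sqnorm u <= qf R u.
  apply: le_trans (h1 u); rewrite ler_wpM2r ?sqnorm_ge0//.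
  by rewrite /rho ge_min lexx.
exists rho, Cm, del; split.
  split => //; first by rewrite divr_gt0.
  by rewrite ler_pdivrMr// mul1r; lra.
move=> n u; split; last 2 first.
- exact: up.
- apply: le_trans (rR u).
  rewrite /del mulrAC ler_pdivrMr//.
  have := ler_wpM2l (ltW rho0) (up n.+1 u).
  have := mulr_ge0 (ltW rho0) (mulr_ge0 (ltW rho0) (sqnorm_ge0 u)).
  lra.
case: n => [|n].
  apply: le_trans (h2 u); rewrite ler_wpM2r ?sqnorm_ge0//.
  by rewrite /rho ge_min lexx orbT.
by apply: le_trans (rR u) _; exact: (riccati_geR A R S_pd (kalman_psd n)).
Qed.

Section fixed_input.
Context (N : nat) (E : enkf_input R R0 m0 P0 N).
Local Notation cov n w := (sample_cov (@free_particles F d d0 A B R R0 m0 P0 N E n w)).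

Definition fluctuation n (w : Omega E) : 'M[F]_d :=
  cov n w - (if n is k.+1 then Phi (cov k w) else P0).

Lemma fluctuation_symm n w : (fluctuation n w)^T = fluctuation n w.
Proof.
rewrite /fluctuation linearB/= sample_cov_symm; congr (_ - _).
case: n => [|n]; first exact: pd_symm.
by rewrite (riccati_symm _ R_pd S_pd (sample_cov_psd _)).
Qed.

Lemma measurable_fluctuation n : measurable_mx (fluctuation n).
Proof.
apply: measurable_mxB; first exact: measurable_cov.
case: n => [|n]; first exact: measurable_mx_cst.
apply: (measurable_riccati A R S_pd (M := fun w => cov n w)); last exact: measurable_cov.
by move=> w; exact: sample_cov_psd.
Qed.

(** The error relative to P_n is multiplied by at most 1 - del in each step, and
    increased by the fluctuation of that step. *)
Fixpoint envelope (rho del : F) (n : nat) (w : Omega E) : F :=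
  if n is k.+1 then (1 - del) * envelope rho del k w + mx_l1 (fluctuation k.+1 w) / rho
  else mx_l1 (fluctuation 0 w) / rho.

Variables rho Cm del : F.
Hypotheses (rho0 : 0 < rho) (del0 : 0 < del) (del1 : del <= 1).
Hypothesis lowP : forall n u, rho * sqnorm u <= qf (Pn n) u.
Hypothesis delR : forall n u, del * qf (Pn n.+1) u <= qf R u.

Local Notation env := (envelope rho del).

Lemma envelope_ge0 n w : 0 <= env n w.
Proof.
elim: n => [|n IH] /=; first by rewrite divr_ge0 ?mx_l1_ge0// ltW.
by rewrite addr_ge0 ?mulr_ge0 ?subr_ge0// ?invr_ge0 ?mx_l1_ge0// ltW.
Qed.

Lemma measurable_l1 dp (T : measurableType dp) k (M : T -> 'M[F]_k) :
  measurable_mx M -> measurable_fun setT (fun w => mx_l1 (M w)).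
Proof.
move=> mM; apply: measurable_sum => i; apply: measurable_sum => j.
exact: measurableT_comp.
Qed.

Lemma measurable_envelope n : measurable_fun setT (env n).
Proof.
have h k : measurable_fun setT (fun w => mx_l1 (fluctuation k w) / rho).
  by apply: measurable_funM => //; apply: measurable_l1; exact: measurable_fluctuation.
elim: n => [|n IH] /=; first exact: h.
by apply: measurable_funD; [exact: measurable_funM|exact: h].
Qed.

Lemma envelope_bound n w u : `|qf (cov n w - Pn n) u| <= env n w * qf (Pn n) u.
Proof.
have fl k v : `|qf (fluctuation k w) v| <= mx_l1 (fluctuation k w) / rho * qf (Pn k) v.
  apply: le_trans (normr_qf_le _ v) _; rewrite -mulrA ler_wpM2l ?mx_l1_ge0//.
  by rewrite mulrC ler_pdivlMr// mulrC.
elim: n u => [|n IH] u; first exact: (fl 0%N).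
have -> : cov n.+1 w - Pn n.+1 = fluctuation n.+1 w + (Phi (cov n w) - Phi (Pn n)).
  by rewrite /fluctuation addrA subrK.
rewrite qfD; apply: le_trans (ler_normD _ _) _.
rewrite /= mulrDl addrC; apply: lerD; last exact: (fl n.+1).
rewrite qfB; apply: riccati_contraction => //.
- exact: sample_cov_psd.
- exact: kalman_psd.
- exact: envelope_ge0.
- exact: delR.
Qed.

(** The envelope at time n + 1 is a convex combination, with weights 1 - del and
    del, of the envelope at time n and of the fluctuation divided by rho del.
    Convexity of the power gives the same recursion for the moments, and both
    bounds in the sum are needed: one for the start, one for the steps. *)
Lemma envelope_moment q (C : F) : 0 <= C ->
  (forall n, \int[Prob E]_w (mx_l1 (fluctuation n w) ^+ q)%:E <= C%:E)%E ->
  forall n, (\int[Prob E]_w (env n w ^+ q)%:E <= (C / rho ^+ q + C / (rho * del) ^+ q)%:E)%E.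
Proof.
move=> C0 HC; set K := _ + _.
have r0 : 0 <= rho^-1 by rewrite invr_ge0 ltW.
have rd0 : 0 <= (rho * del)^-1 by rewrite invr_ge0 mulr_ge0// ltW.
have a0 : 0 <= C / rho ^+ q by rewrite mulr_ge0// invr_ge0 exprn_ge0// ltW.
have b0 : 0 <= C / (rho * del) ^+ q by rewrite mulr_ge0// invr_ge0 exprn_ge0// mulr_ge0// ltW.
have il n : (Prob E).-integrable setT (EFin \o (fun w => mx_l1 (fluctuation n w) ^+ q)).
  apply: integrable_real_ge0 (HC n); last by move=> x; rewrite exprn_ge0// mx_l1_ge0.
  by apply: measurable_funX; apply: measurable_l1; exact: measurable_fluctuation.
elim=> [|n IH].
  apply: (@le_trans _ _ (\int[Prob E]_w ((rho^-1 ^+ q) * mx_l1 (fluctuation 0 w) ^+ q + 0 * mx_l1 (fluctuation 0 w) ^+ q)%:E)%E).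
    apply: ge0_le_integral_pointwise => w; first by rewrite lee_fin exprn_ge0// envelope_ge0.
    by rewrite lee_fin /= exprMn mul0r addr0 mulrC.
  rewrite integral_real_lin// mul0e adde0.
  apply: (@le_trans _ _ ((rho^-1 ^+ q)%:E * C%:E)%E).
    by apply: lee_wpmul2l => //; rewrite lee_fin exprn_ge0.
  by rewrite -EFinM lee_fin exprVn mulrC /K lerDl.
have ie : (Prob E).-integrable setT (EFin \o (fun w => env n w ^+ q)).
  apply: integrable_real_ge0 IH; last by move=> x; rewrite exprn_ge0// envelope_ge0.
  by apply: measurable_funX; exact: measurable_envelope.
apply: (@le_trans _ _ (\int[Prob E]_w ((1 - del) * env n w ^+ q +
    (del * (rho * del)^-1 ^+ q) * mx_l1 (fluctuation n.+1 w) ^+ q)%:E)%E).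
  apply: ge0_le_integral_pointwise => w; first by rewrite lee_fin exprn_ge0// envelope_ge0.
  rewrite lee_fin /=.
  have -> : mx_l1 (fluctuation n.+1 w) / rho = del * ((rho * del)^-1 * mx_l1 (fluctuation n.+1 w)).
    by field; rewrite !gt_eqF.
  apply: le_trans (convex_expr _ _ _ _) _.
  - by rewrite ltW.
  - exact: envelope_ge0.
  - by rewrite mulr_ge0// mx_l1_ge0.
  - by rewrite exprMn mulrA.
rewrite integral_real_lin//.
apply: (@le_trans _ _ ((1 - del)%:E * K%:E + (del * (rho * del)^-1 ^+ q)%:E * C%:E)%E).
  apply: leeD; apply: lee_wpmul2l => //; rewrite lee_fin ?subr_ge0//.
  by rewrite mulr_ge0 ?exprn_ge0// ltW.
rewrite -!EFinM -EFinD lee_fin exprVn.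
have : C / (rho * del) ^+ q <= K by rewrite /K lerDr.
move/(ler_wpM2l (ltW del0)); lra.
Qed.

End fixed_input.

(** By [polarization], the entries are combinations of quadratic forms at the
    vectors e_i, e_j and e_i + e_j, whose squared norms are at most 4. *)
Lemma fluctuation_moment q : (0 < q)%N -> exists2 C : F, 0 <= C &
  forall N (E : enkf_input R R0 m0 P0 N), (0 < N)%N -> forall n,
  (\int[Prob E]_w (mx_l1 (fluctuation (E:=E) n w) ^+ q.*2)%:E <= (C / N%:R ^+ q)%:E)%E.
Proof.
move=> q0.
pose L := 4 * mx_l1 Mmax + 4 * mx_l1 P0.
have l1 := mx_l1_ge0 Mmax; have l2 := mx_l1_ge0 P0.
have [C C0 H] := covariance_fluctuation A m0 R_pd R0_pd P0_pd S_pd L q0.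
have ev (z : F) := even_expr_ge0 z q.
have HF N (E : enkf_input R R0 m0 P0 N) u n : (0 < N)%N -> sqnorm u <= 4 ->
    (\int[Prob E]_w (qf (fluctuation (E:=E) n w) u ^+ q.*2)%:E <= (C / N%:R ^+ q)%:E)%E.
  move=> N0 u4; have su := sqnorm_ge0 u.
  have b1 : qf P0 u <= L.
    by apply: le_trans (ler_norm _) _; apply: le_trans (normr_qf_le _ _) _; rewrite /L; nra.
  have b2 : qf Mmax u <= L.
    by apply: le_trans (ler_norm _) _; apply: le_trans (normr_qf_le _ _) _; rewrite /L; nra.
  have [h0 hS] := H N E u N0 b1 b2.
  case: n => [|n].
    by apply: le_trans h0; rewrite /fluctuation; under eq_integral do rewrite qfB.
  by apply: le_trans (hS n); rewrite /fluctuation; under eq_integral do rewrite qfB.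
pose K : F := 2 ^+ q.*2.
have K0 : 0 <= K by rewrite exprn_ge0.
pose pr := index_enum ('I_d * 'I_d)%type.
have [C2 C20 H2] := @even_sumX_le F ('I_d * 'I_d)%type q pr q0.
exists (C2 * \sum_(p <- pr) (K * K * (3 * C))).
  by rewrite mulr_ge0// sumr_ge0// => p _; rewrite !mulr_ge0.
move=> N E N0 n; set CN := C / N%:R ^+ q.
have CN0 : 0 <= CN by rewrite divr_ge0// exprn_ge0.
pose f := fluctuation (E:=E) n.
have mf : measurable_mx f by exact: measurable_fluctuation.
have iq u : sqnorm u <= 4 -> (Prob E).-integrable setT (EFin \o (fun w => qf (f w) u ^+ q.*2)).
  move=> u4; apply: integrable_real_ge0 (HF N E u n N0 u4) => //.
  by apply: measurable_funX; exact: measurable_qf.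
have s1 (i : 'I_d) : sqnorm (basis_vec F i) <= 4 by rewrite sqnorm_basis; lra.
have entry (i j : 'I_d) : (\int[Prob E]_w (`|f w i j| ^+ q.*2)%:E <= (K * K * (3 * CN))%:E)%E.
  apply: (@le_trans _ _ (\int[Prob E]_w ((K * K) *
      (1 * qf (f w) (basis_vec F i + basis_vec F j) ^+ q.*2 + 1 * qf (f w) (basis_vec F i) ^+ q.*2) +
      (K * K) * qf (f w) (basis_vec F j) ^+ q.*2)%:E)%E).
    apply: ge0_le_integral_pointwise => w; first by rewrite lee_fin exprn_ge0.
    rewrite lee_fin even_expr_norm polarization ?fluctuation_symm//.
    set a := qf _ _; set b := qf _ _; set c := qf _ _.
    have e (z : F) := even_exprN z q.
    apply: (@le_trans _ _ ((a - b - c) ^+ q.*2)).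
      rewrite exprMn ler_piMr// exprn_ile1//; lra.
    apply: le_trans (even_exprD_le _ _ _) _; rewrite e -/K.
    have := even_exprD_le a (- b) q; rewrite e -/K => h.
    have K1 : 1 <= K by rewrite exprn_ege1// ler1n.
    have := ler_wpM2l K0 h; have := ev c; have := mulr_ge0 K0 (ev c).
    nra.
  have i2 := iq _ (sqnorm_basis2 F i j).
  have ii := iq _ (s1 i); have ij := iq _ (s1 j).
  have i3 := integrable_real_lin 1 1 i2 ii.
  rewrite (integral_real_lin _ _ i3 ij) (integral_real_lin _ _ i2 ii) !mul1e.
  apply: (@le_trans _ _ ((K * K)%:E * (CN%:E + CN%:E) + (K * K)%:E * CN%:E)%E).
    apply: leeD; apply: lee_wpmul2l; rewrite ?lee_fin ?mulr_ge0//.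
    - by apply: leeD; apply: HF => //; exact: sqnorm_basis2.
    - exact: HF.
  rewrite -EFinD lee_fin.
  by rewrite le_eqVlt; apply/orP; left; apply/eqP; ring.
apply: (@le_trans _ _ (\int[Prob E]_w (C2%:E * \sum_(p <- pr) (`|f w p.1 p.2| ^+ q.*2)%:E))%E).
  apply: ge0_le_integral_pointwise => w; first by rewrite lee_fin ev.
  rewrite sumEFin -EFinM lee_fin; apply: le_trans (H2 (fun p => `|f w p.1 p.2|)).
  by rewrite /mx_l1 pair_big.
rewrite ge0_integralZl//=; last 2 first.
- under eq_fun do rewrite sumEFin.
  apply/measurable_EFinP; apply: measurable_sum => p; apply: measurable_funX.
  by apply: measurableT_comp => //; exact: mf.
- by move=> w _; apply: sume_ge0 => p _; rewrite lee_fin exprn_ge0.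
rewrite ge0_integral_sum//; last first.
  move=> p; apply/measurable_EFinP; apply: measurable_funX.
  by apply: measurableT_comp => //; exact: mf.
rewrite -[X in (_ <= X%:E)%E]mulrA EFinM; apply: lee_wpmul2l; first by rewrite lee_fin.
rewrite mulr_suml -sumEFin; apply: lee_sum => p _.
by apply: le_trans (entry _ _) _; rewrite lee_fin /CN !mulrA.
Qed.

End envelope.

(** * Expectations of matrices and matrix norms *)
Section matrix_expectation.
Context (F : realType) (dp : measure_display) (T : measurableType dp)
  (P : probability T F) (k : nat).

Lemma integral_qf (M : T -> 'M[F]_k) u : mx_integrable P M ->
  (\int[P]_w (qf (M w) u)%:E = (qf (mx_expectation P M) u)%:E)%E.
Proof.
move=> iM.
have iMc i j (c : F) : P.-integrable setT (fun w => (M w i j * c)%:E).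
  under eq_fun do rewrite mulrC EFinM.
  by apply: integrableZl => //; exact: iM.
transitivity (\int[P]_w (\sum_i \sum_j (M w i j * (u i 0 * u j 0))%:E))%E.
  by apply: eq_integral => w _; rewrite qfE -sumEFin; apply: eq_bigr => i _; rewrite -sumEFin.
rewrite integral_sum//; last by move=> i; apply: integrable_sum => // j _; exact: iMc.
rewrite qfE -sumEFin; apply: eq_bigr => i _.
rewrite integral_sum//.
rewrite -sumEFin; apply: eq_bigr => j _.
under eq_integral do rewrite mulrC EFinM.
rewrite integralZl//.
rewrite [in RHS]EFinM [RHS]muleC; congr (_ * _)%E.
rewrite /mx_expectation mxE unlock fineK//.
exact: integrable_fin_num (iM i j).
Qed.

Lemma mx_expectation_symm (M : T -> 'M[F]_k) :
  (forall w, (M w)^T = M w) -> (mx_expectation P M)^T = mx_expectation P M.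
Proof.
move=> sM; apply/matrixP => i j; rewrite !mxE; congr (fine _); congr expectation.
by apply/funext => w; rewrite -[in LHS]sM mxE.
Qed.

(** The entries of a positive semi-definite matrix are dominated by its quadratic
    forms, which are nonnegative. *)
Lemma mx_integrable_psd (M : T -> 'M[F]_k) (b : 'cV[F]_k -> F) :
  (forall w, psdmx (M w)) -> measurable_mx M ->
  (forall u, (\int[P]_w (qf (M w) u)%:E <= (b u)%:E)%E) -> mx_integrable P M.
Proof.
move=> pM mM Mb i j.
have iq u : P.-integrable setT (EFin \o (fun w => qf (M w) u)).
  apply: integrable_real_ge0 (Mb u); first exact: measurable_qf.
  by move=> w; exact: psd_ge0.
have i1 := integrable_real_lin 1 1 (iq (basis_vec F i + basis_vec F j))
   (integrable_real_lin 1 1 (iq (basis_vec F i)) (iq (basis_vec F j))).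
apply: integrable_dom i1 _; first exact: mM.
move=> w; rewrite polarization ?(psd_symm (pM w))//.
have := psd_ge0 (basis_vec F i + basis_vec F j) (pM w).
have := psd_ge0 (basis_vec F i) (pM w); have := psd_ge0 (basis_vec F j) (pM w).
by move=> *; rewrite ler_norml; apply/andP; split; lra.
Qed.

End matrix_expectation.

Section deterministic.
Context (F : realType).

Lemma entry_le_qf k (D Q : 'M[F]_k) (t c : F) : D^T = D -> 0 <= t -> 0 <= c ->
  (forall u, `|qf D u| <= t * qf Q u) -> (forall u, qf Q u <= c * sqnorm u) ->
  forall i j, `|D i j| <= 3 * c * t.
Proof.
move=> sD t0 c0 Dt Qc i j.
have b u (a : F) : sqnorm u <= a -> `|qf D u| <= t * (c * a).
  move=> ua; apply: le_trans (Dt u) _; rewrite ler_wpM2l//.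
  by apply: le_trans (Qc u) _; rewrite ler_wpM2l.
have b1 := b _ _ (sqnorm_basis2 F i j).
have b2 := b (basis_vec F i) 1 ltac:(by rewrite sqnorm_basis).
have b3 := b (basis_vec F j) 1 ltac:(by rewrite sqnorm_basis).
rewrite polarization//; move: b1 b2 b3; rewrite !ler_norml.
move=> /andP[? ?] /andP[? ?] /andP[? ?]; apply/andP; split; lra.
Qed.

Lemma qf_image_le k (D Q : 'M[F]_k) (b : F) x : (forall i j, `|D i j| <= b) ->
  `|qf Q (D *m x)| <= mx_l1 Q * (k%:R ^+ 3 * b ^+ 2) * sqnorm x.
Proof.
move=> Db; rewrite -qf_mulT.
have [k0|k0] := posnP k.
  have -> : qf (D^T *m Q *m D) x = 0.
    by rewrite qfE big1// => i _; have := ltn_ord i; rewrite [X in (_ < X)%N]k0.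
  by rewrite normr0 mulr_ge0 ?sqnorm_ge0// mulr_ge0 ?mx_l1_ge0// mulr_ge0 ?sqr_ge0// exprn_ge0.
have b0 : 0 <= b by apply: le_trans (Db (Ordinal k0) (Ordinal k0)).
rewrite qf_mulT; apply: le_trans (normr_qf_le _ _) _.
rewrite -mulrA ler_wpM2l ?mx_l1_ge0//.
have -> : sqnorm (D *m x) = qf (D^T *m D) x.
  by rewrite -qf1 -qf_mulT mulmx1.
apply: le_trans (ler_norm _) _; apply: le_trans (normr_qf_le _ _) _.
rewrite ler_wpM2r ?sqnorm_ge0//.
apply: (@le_trans _ _ (\sum_(i < k) \sum_(j < k) (k%:R * b ^+ 2))); last first.
  rewrite !sumr_const !card_ord -[leLHS]mulr_natl -[X in _ * X]mulr_natl.
  by rewrite le_eqVlt; apply/orP; left; apply/eqP; ring.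
apply: ler_sum => i _; apply: ler_sum => j _; rewrite mxE.
apply: le_trans (ler_norm_sum _ _ _) _.
apply: (@le_trans _ _ (\sum_(a < k) b ^+ 2)); last by rewrite sumr_const card_ord mulr_natl.
by apply: ler_sum => a _; rewrite mxE normrM expr2 ler_pM.
Qed.

Lemma matrix_norm_ge0 k l (nu : 'M[F]_(k, l) -> F) M : matrix_norm nu -> 0 <= nu M.
Proof.
move=> [_ nZ nD].
have n0 : nu 0 = 0 by rewrite -(scale0r (0 : 'M[F]_(k, l))) nZ normr0 mul0r.
have := nD M (- M); rewrite subrr n0 -scaleN1r nZ normrN1 mul1r; lra.
Qed.

(** A norm is dominated by the entries, by decomposition along the elementary
    matrices. *)
Lemma matrix_norm_le k (nu : 'M[F]_k -> F) : matrix_norm nu ->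
  exists2 c : F, 0 <= c & forall (D : 'M[F]_k) (b : F), (forall i j, `|D i j| <= b) -> nu D <= c * b.
Proof.
move=> hn; have [_ nZ nD] := hn.
have n0 : nu 0 = 0 by rewrite -(scale0r (0 : 'M[F]_k)) nZ normr0 mul0r.
have nsum (I : Type) (r : seq I) (f : I -> 'M[F]_k) : nu (\sum_(i <- r) f i) <= \sum_(i <- r) nu (f i).
  elim: r => [|a r IH]; first by rewrite !big_nil n0.
  by rewrite !big_cons; apply: le_trans (nD _ _) _; rewrite lerD2l.
exists (\sum_i \sum_j nu (delta_mx i j)).
  by apply: sumr_ge0 => i _; apply: sumr_ge0 => j _; exact: matrix_norm_ge0.
move=> D b Db; rewrite [D]matrix_sum_delta; apply: le_trans (nsum _ _ _) _.
rewrite mulr_suml; apply: ler_sum => i _; apply: le_trans (nsum _ _ _) _.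
rewrite mulr_suml; apply: ler_sum => j _; rewrite nZ mulrC ler_wpM2l//.
exact: matrix_norm_ge0.
Qed.

(** With y = s x, this is y ^ r <= 1 + y ^ q; the scale [s] will be the square root
    of N, which makes the right-hand side bounded in expectation. *)
Lemma powR_le_scaled (s x r : F) q : 0 < s -> 0 <= x -> 1 <= r -> r <= q%:R ->
  x `^ r <= (s `^ r)^-1 * (1 + (s * x) ^+ q).
Proof.
move=> s0 x0 r1 rq; have sr0 : 0 < s `^ r by exact: powR_gt0.
rewrite ler_pdivlMl// -powRM//; last exact: ltW.
have y0 : 0 <= s * x by rewrite mulr_ge0// ltW.
set y := s * x in y0 *.
have [y1|/ltW y1] := leP y 1.
  apply: (@le_trans _ _ 1); last by rewrite lerDl exprn_ge0.
  have e : 1 `^ r = 1 :> F by rewrite powR1.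
  by rewrite -[leRHS]e ge0_ler_powR ?nnegrE// (le_trans ler01).
apply: (@le_trans _ _ (y ^+ q)); last by rewrite lerDr.
by rewrite -powR_mulrn//; exact: ler_powR.
Qed.

End deterministic.

(** * Bias and moments of the error *)
Section conclusions.
Context (F : realType) (d d0 : nat)
  (A : 'M[F]_d) (B : 'M[F]_(d0, d)) (R : 'M[F]_d) (R0 : 'M[F]_d0)
  (m0 : 'cV[F]_d) (P0 : 'M[F]_d).
Hypotheses (R_pd : pdmx R) (R0_pd : pdmx R0) (P0_pd : pdmx P0)
  (S_pd : pdmx (obs_S B R0)).

Local Notation Phi := (riccati A B R R0).
Local Notation Mmax := (A *m invmx (obs_S B R0) *m A^T + R).
Local Notation Pn := (kalman_cov A B R R0 P0).

Section fixed_input.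
Context (N : nat) (E : enkf_input R R0 m0 P0 N).
Hypothesis N_gt0 : (0 < N)%N.
Local Notation cov n w := (sample_cov (@free_particles F d d0 A B R R0 m0 P0 N E n w)).
Local Notation Ecov n := (mx_expectation (Prob E) (fun w => cov n w)).

Lemma cov_integrable n : mx_integrable (Prob E) (fun w => cov n w).
Proof.
apply: (@mx_integrable_psd _ _ _ _ _ _ (fun u => qf P0 u + qf Mmax u)).
- by move=> w; exact: sample_cov_psd.
- exact: measurable_cov.
have p0 u : 0 <= qf P0 u by exact/psd_ge0/pd_psd.
have pM u : 0 <= qf Mmax u.
  apply: le_trans (riccati_upper A R S_pd (pd_psd P0_pd) u).
  exact/psd_ge0/riccati_psd/pd_psd.
move=> u; case: n => [|n].
  by rewrite initial_expectation// lee_fin lerDl.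
rewrite expectation_step// -[leRHS](integral_cst_real (Prob E)).
apply: ge0_le_integral_pointwise => w; rewrite lee_fin.
  exact/psd_ge0/riccati_psd/sample_cov_psd.
apply: le_trans (riccati_upper A R S_pd (sample_cov_psd _) u) _.
by rewrite lerDr.
Qed.

Lemma Ecov_symm n : (Ecov n)^T = Ecov n.
Proof. by apply: mx_expectation_symm => w; exact: sample_cov_symm. Qed.

Lemma Ecov0 u : qf (Ecov 0) u = qf P0 u.
Proof.
have := integral_qf u (cov_integrable 0); rewrite initial_expectation//.
by case.
Qed.

Lemma EcovS n u : (\int[Prob E]_w (qf (Phi (cov n w)) u)%:E = (qf (Ecov n.+1) u)%:E)%E.
Proof. by rewrite -expectation_step// (integral_qf u (cov_integrable n.+1)). Qed.

Lemma measurable_qf_Phi n u : measurable_fun setT (fun w => qf (Phi (cov n w)) u).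
Proof.
apply: measurable_qf; apply: (measurable_riccati A R S_pd (M := fun w => cov n w)).
  by move=> w; exact: sample_cov_psd.
exact: measurable_cov.
Qed.

Lemma integrable_qf_cov n u : (Prob E).-integrable setT (EFin \o (fun w => qf (cov n w) u)).
Proof.
apply: (@integrable_real_ge0 _ _ _ _ _ (qf (Ecov n) u)).
- exact/measurable_qf/measurable_cov.
- by move=> w; exact/psd_ge0/sample_cov_psd.
- by rewrite (integral_qf u (cov_integrable n)).
Qed.

Lemma integrable_qf_Phi n u : (Prob E).-integrable setT (EFin \o (fun w => qf (Phi (cov n w)) u)).
Proof.
apply: (@integrable_real_ge0 _ _ _ _ _ (qf (Ecov n.+1) u)).
- exact: measurable_qf_Phi.
- by move=> w; exact/psd_ge0/riccati_psd/sample_cov_psd.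
- by rewrite EcovS.
Qed.

Lemma Ecov_geR n u : qf R u <= qf (Ecov n.+1) u.
Proof.
rewrite -lee_fin -EcovS -[leLHS](integral_cst_real (Prob E)).
apply: ge0_le_integral_pointwise => w; rewrite lee_fin.
  exact/psd_ge0/pd_psd.
exact: (riccati_geR A R S_pd (sample_cov_psd _)).
Qed.

(** The tangent at P_n bounds Phi(p_n) by an expression affine in p_n, whose
    expectation is known. *)
Lemma Ecov_le n u : qf (Ecov n) u <= qf (Pn n) u.
Proof.
elim: n u => [|n IH] u; first by rewrite Ecov0.
pose x := closed_loop A B R0 (Pn n) u.
have Ppsd := kalman_psd A R_pd P0_pd S_pd n.
rewrite -lee_fin -EcovS.
apply: (@le_trans _ _ (\int[Prob E]_w (1 * qf (cov n w) x + (qf (Phi (Pn n)) u - qf (Pn n) x) * cst 1 w)%:E)%E).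
  apply: ge0_le_integral_pointwise => w; rewrite lee_fin.
    exact/psd_ge0/riccati_psd/sample_cov_psd.
  apply: le_trans (riccati_tangent A R S_pd u (sample_cov_psd _) Ppsd) _.
  by rewrite qfB /cst -/x; lra.
rewrite integral_real_lin; [|exact: integrable_qf_cov|exact: integrable_cst_real].
rewrite (integral_qf x (cov_integrable n)) integral_cst_real -!EFinM -EFinD lee_fin.
have := IH x; rewrite /=; lra.
Qed.

(** With x = E(P_n)' u, the bias at time n + 1 in the direction u is at most the
    bias at time n in the direction x plus (c / N) |x| ^ 2.  The induction closes
    with a / N times P_n, a = c / (rho del), since |x| ^ 2 <= x' P_n x / rho and
    (1 + del) x' P_n x <= u' P_(n+1) u. *)
Lemma bias_le (rho Cm del K : F) : 0 < rho -> 0 < Cm -> 0 < del -> del <= 1 -> 0 <= K ->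
  (forall n u, rho * sqnorm u <= qf (Pn n) u) ->
  (forall n u, qf (Pn n) u <= Cm * sqnorm u) ->
  (forall n u, del * qf (Pn n.+1) u <= qf R u) ->
  (forall n, \int[Prob E]_w (envelope A B (E:=E) rho del n w ^+ 2)%:E <= (K / N%:R)%:E)%E ->
  let c := mx_l1 (obs_S B R0) * (d%:R ^+ 3 * (3 * Cm) ^+ 2) * K in
  forall n u, qf (Pn n) u - qf (Ecov n) u <= c / (rho * del) / N%:R * qf (Pn n) u.
Proof.
move=> rho0 Cm0 del0 del1 K0 low up dR eK c n u.
have NN : 0 < N%:R :> F by rewrite ltr0n.
have c0 : 0 <= c.
  rewrite mulr_ge0// mulr_ge0 ?mx_l1_ge0//.
  by apply: mulr_ge0; [exact: exprn_ge0|exact: sqr_ge0].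
set a := c / (rho * del) / N%:R.
have a0 : 0 <= a by rewrite !divr_ge0// ?mulr_ge0// ltW.
elim: n u => [|n IH] u.
  by rewrite Ecov0 subrr mulr_ge0//; exact/psd_ge0/pd_psd.
pose x := closed_loop A B R0 (Pn n) u.
have Ppsd := kalman_psd A R_pd P0_pd S_pd n.
pose c1 := mx_l1 (obs_S B R0) * (d%:R ^+ 3 * (3 * Cm) ^+ 2).
have c10 : 0 <= c1.
  rewrite mulr_ge0 ?mx_l1_ge0//.
  by apply: mulr_ge0; [exact: exprn_ge0|exact: sqr_ge0].
have sx := sqnorm_ge0 x.
pose env := envelope A B (E:=E) rho del n.
have ie : (Prob E).-integrable setT (EFin \o (fun w => env w ^+ 2)).
  apply: integrable_real_ge0 (eK n); last by move=> w; exact: sqr_ge0.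
  by apply: measurable_funX; exact: measurable_envelope.
have low1 : qf (Phi (Pn n)) u + (qf (Ecov n) x - qf (Pn n) x) - c1 * sqnorm x * (K / N%:R) <= qf (Ecov n.+1) u.
  rewrite -lee_fin -EcovS.
  apply: (@le_trans _ _ (\int[Prob E]_w (1 * (1 * qf (cov n w) x +
      (qf (Phi (Pn n)) u - qf (Pn n) x) * cst 1 w) + (- (c1 * sqnorm x)) * env w ^+ 2)%:E)%E).
    have i1 : (Prob E).-integrable setT (EFin \o (fun w => 1 * qf (cov n w) x + (qf (Phi (Pn n)) u - qf (Pn n) x) * cst 1 w)).
      by apply: integrable_real_lin; [exact: integrable_qf_cov|exact: integrable_cst_real].
    rewrite integral_real_lin// integral_real_lin; [|exact: integrable_qf_cov|exact: integrable_cst_real].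
    rewrite (integral_qf x (cov_integrable n)) integral_cst_real.
    have [z zE] : exists z : F, (\int[Prob E]_w (env w ^+ 2)%:E = z%:E)%E.
      exists (fine (\int[Prob E]_w (env w ^+ 2)%:E)%E); rewrite fineK//; exact: integrable_fin_num ie.
    have zK : z <= K / N%:R by rewrite -lee_fin -zE; exact: eK.
    rewrite zE -!EFinM -!EFinD lee_fin /=.
    have : c1 * sqnorm x * z <= c1 * sqnorm x * (K / N%:R).
      by apply: ler_wpM2l => //; exact: mulr_ge0.
    lra.
  apply: le_integral => //.
  - apply: integrable_real_lin => //.
    by apply: integrable_real_lin; [exact: integrable_qf_cov|exact: integrable_cst_real].
  - exact: integrable_qf_Phi.
  move=> w _; rewrite lee_fin.
  apply: le_trans (riccati_remainder A R S_pd u (sample_cov_psd _) Ppsd).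
  rewrite -/x qfB /cst.
  have eb := envelope_bound R_pd P0_pd S_pd (E:=E) rho0 del1 low dR n w.
  have eg := envelope_ge0 A B (E:=E) rho0 del1 n w.
  have sD : (cov n w - Pn n)^T = cov n w - Pn n.
    by rewrite linearB/= sample_cov_symm (psd_symm Ppsd).
  have Db := entry_le_qf sD eg (ltW Cm0) eb (up n).
  have := le_trans (ler_norm _) (qf_image_le (obs_S B R0) x Db).
  rewrite -/env.
  have -> : mx_l1 (obs_S B R0) * (d%:R ^+ 3 * (3 * Cm * env w) ^+ 2) * sqnorm x = c1 * sqnorm x * env w ^+ 2.
    by rewrite /c1; ring.
  lra.
have hx := low n x.
have hl := riccati_lower A R S_pd Ppsd u.
rewrite -/x in hl.
have hd := dR n u.
have IHx := IH x.
have K1 : c1 * sqnorm x * (K / N%:R) <= a * del * qf (Pn n) x.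
  have -> : a * del = c1 * K / N%:R / rho.
    by rewrite /a /c -/c1; field; rewrite !gt_eqF.
  have -> : c1 * sqnorm x * (K / N%:R) = c1 * K / N%:R / rho * (rho * sqnorm x).
    by field; rewrite !gt_eqF.
  by apply: ler_wpM2l => //; apply: divr_ge0; [apply: divr_ge0 => //; exact: mulr_ge0|exact: ltW].
have Px0 : 0 <= qf (Pn n) x by exact: psd_ge0.
have h1 : (1 + del) * qf (Pn n) x <= qf (Phi (Pn n)) u.
  have : qf (Pn n) x <= (1 - del) * qf (Phi (Pn n)) u by move: hd => /=; lra.
  have d10 : 0 <= 1 + del by lra.
  have P10 : 0 <= qf (Phi (Pn n)) u by exact/psd_ge0/riccati_psd.
  move/(ler_wpM2l d10) => h; apply: le_trans h _.
  have := mulr_ge0 (sqr_ge0 del) P10; lra.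
have := ler_wpM2l a0 h1; rewrite /=; lra.
Qed.

End fixed_input.
End conclusions.

Section moments.
Context (F : realType) (d d0 : nat)
  (A : 'M[F]_d) (B : 'M[F]_(d0, d)) (R : 'M[F]_d) (R0 : 'M[F]_d0)
  (m0 : 'cV[F]_d) (P0 : 'M[F]_d).
Hypotheses (R_pd : pdmx R) (R0_pd : pdmx R0) (P0_pd : pdmx P0)
  (S_pd : pdmx (obs_S B R0)).
Local Notation Pn := (kalman_cov A B R R0 P0).

Variables rho del : F.
Hypotheses (rho0 : 0 < rho) (del0 : 0 < del) (del1 : del <= 1).

Lemma uniform_envelope_moment q : (0 < q)%N -> exists2 K : F, 0 <= K &
  forall N (E : enkf_input R R0 m0 P0 N), (0 < N)%N -> forall n,
  (\int[Prob E]_w (envelope A B (E:=E) rho del n w ^+ q.*2)%:E <= (K / N%:R ^+ q)%:E)%E.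
Proof.
move=> q0; have [C C0 H] := fluctuation_moment A m0 R_pd R0_pd P0_pd S_pd q0.
exists (C / rho ^+ q.*2 + C / (rho * del) ^+ q.*2).
  by apply: addr_ge0; apply: divr_ge0 => //; rewrite exprn_ge0// ?mulr_ge0// ltW.
move=> N E N0 n; have CN0 : 0 <= C / N%:R ^+ q by rewrite divr_ge0// exprn_ge0.
apply: le_trans (envelope_moment R0_pd S_pd rho0 del0 del1 CN0 (H N E N0) n) _.
by rewrite lee_fin mulrDl le_eqVlt ![C / N%:R ^+ q / _]mulrAC eqxx.
Qed.

Variables (Cm : F) (nu : 'M[F]_d -> F).
Hypothesis Cm0 : 0 < Cm.
Hypothesis lowP : forall n u, rho * sqnorm u <= qf (Pn n) u.
Hypothesis upP : forall n u, qf (Pn n) u <= Cm * sqnorm u.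
Hypothesis delR : forall n u, del * qf (Pn n.+1) u <= qf R u.
Hypothesis nu_norm : matrix_norm nu.

(** The norm of p_n - P_n is at most a constant times the envelope, and the real
    exponent is replaced by an even integer through [powR_le_scaled]. *)
Lemma norm_moment_le (r : F) : 1 <= r -> exists c : F,
  forall N (E : enkf_input R R0 m0 P0 N), (0 < N)%N -> forall n,
  ('E_(Prob E)[(fun w => nu (enkf_cov A B (S:=E) n w - Pn n) `^ r)%R] `^ r^-1
     <= (c / Num.sqrt N%:R)%R%:E)%E.
Proof.
move=> r1; have r0 : 0 < r by exact: lt_le_trans r1.
have rn0 : r != 0 by rewrite gt_eqF.
pose q := (Num.truncn r).+1.
have rq : r <= q.*2%:R.
  apply: le_trans (ltW (truncnS_gt r)) _; by rewrite ler_nat -addnn leq_addl.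
have [K K0 HK] := uniform_envelope_moment (isT : (0 < q)%N).
have [cn cn0 Hn] := matrix_norm_le nu_norm.
pose b := cn * (3 * Cm).
have b0 : 0 <= b by apply: mulr_ge0 => //; apply: mulr_ge0 => //; exact: ltW.
pose G := 1 + b ^+ q.*2 * K.
have G0 : 0 <= G by apply: addr_ge0 => //; apply: mulr_ge0 => //; exact: exprn_ge0.
exists (G `^ r^-1) => N E N0 n.
have NN : 0 < N%:R :> F by rewrite ltr0n.
pose s : F := Num.sqrt N%:R.
have s0 : 0 < s by rewrite sqrtr_gt0.
have sr0 : 0 < s `^ r by exact: powR_gt0.
have s2q : s ^+ q.*2 = N%:R ^+ q by rewrite -mul2n exprM sqr_sqrtr// ltW.
pose X w := nu (enkf_cov A B (S:=E) n w - Pn n).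
pose env w := envelope A B (E:=E) rho del n w.
have X0 w : 0 <= X w by exact: matrix_norm_ge0.
have Ppsd := kalman_psd A R_pd P0_pd S_pd n.
have env0 w : 0 <= env w by exact: envelope_ge0.
have Xb w : X w <= b * env w.
  rewrite /X enkf_covE.
  have eb := envelope_bound R_pd P0_pd S_pd (E:=E) rho0 del1 lowP delR n w.
  set D := _ - _ in eb *.
  have sD : D^T = D by rewrite linearB/= sample_cov_symm (psd_symm Ppsd).
  have := Hn _ _ (entry_le_qf sD (env0 w) (ltW Cm0) eb (upP n)).
  by rewrite /b /env mulrA.
have ie : (Prob E).-integrable setT (EFin \o (fun w => env w ^+ q.*2)).
  apply: integrable_real_ge0 (HK N E N0 n); last by move=> w; exact: exprn_ge0.
  by apply: measurable_funX; exact: measurable_envelope.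
have bound : (\int[Prob E]_w (X w `^ r)%:E <= ((s `^ r)^-1 * G)%:E)%E.
  apply: (@le_trans _ _ (\int[Prob E]_w ((s `^ r)^-1 * cst 1 w +
      ((s `^ r)^-1 * (N%:R ^+ q * b ^+ q.*2)) * env w ^+ q.*2)%:E)%E).
    apply: ge0_le_integral_pointwise => w; first by rewrite lee_fin powR_ge0.
    rewrite lee_fin; apply: le_trans (powR_le_scaled s0 (X0 w) r1 rq) _.
    rewrite /cst -mulrA -mulrDr ler_wpM2l ?invr_ge0 ?(ltW sr0)// lerD2l.
    rewrite -s2q -exprMn -exprMn; apply: lerXn2r; rewrite ?nnegrE.
    - by apply: mulr_ge0 => //; exact: ltW.
    - by apply: mulr_ge0 => //; apply: mulr_ge0 => //; exact: ltW.
    - by rewrite -mulrA; apply: ler_wpM2l; [exact: ltW|exact: Xb].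
  rewrite integral_real_lin//; last exact: integrable_cst_real.
  rewrite integral_cst_real.
  have c0 : 0 <= (s `^ r)^-1 * (N%:R ^+ q * b ^+ q.*2).
    apply: mulr_ge0; first by rewrite invr_ge0 ltW.
    by apply: mulr_ge0; exact: exprn_ge0.
  apply: (@le_trans _ _ (((s `^ r)^-1)%:E * 1%:E + ((s `^ r)^-1 * (N%:R ^+ q * b ^+ q.*2))%:E * (K / N%:R ^+ q)%:E)%E).
    by apply: leeD => //; apply: lee_wpmul2l; [rewrite lee_fin|exact: HK].
  rewrite -!EFinM -EFinD lee_fin le_eqVlt; apply/orP; left; apply/eqP.
  rewrite /G; field.
  by rewrite gt_eqF//= gt_eqF// exprn_gt0.
rewrite unlock.
have I0 : (0 <= \int[Prob E]_w (X w `^ r)%:E)%E.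
  by apply: integral_ge0 => w _; rewrite lee_fin powR_ge0.
have [y yE] : exists y : F, (\int[Prob E]_w (X w `^ r)%:E = y%:E)%E.
  exists (fine (\int[Prob E]_w (X w `^ r)%:E)%E); rewrite fineK// ge0_fin_numE//.
  exact: le_lt_trans bound (ltry _).
rewrite yE poweR_EFin lee_fin.
have y0 : 0 <= y by rewrite -lee_fin -yE.
have yG : y <= (s `^ r)^-1 * G by rewrite -lee_fin -yE.
have ri0 : 0 <= r^-1 by rewrite invr_ge0 ltW.
have z0 : 0 <= (s `^ r)^-1 by rewrite invr_ge0 ltW.
have := ge0_ler_powR ri0 y0 (mulr_ge0 z0 G0) yG.
rewrite powRM// => h; apply: le_trans h _.
by rewrite -powRN -powRrM mulNr mulfV// powR_inv1 ?(ltW s0)// mulrC.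
Qed.

End moments.

Theorem theorem2p1 (F : realType) (d d0 : nat)
    (A : 'M[F]_d) (B : 'M[F]_(d0, d)) (R : 'M[F]_d) (R0 : 'M[F]_d0)
    (m0 : 'cV[F]_d) (P0 : 'M[F]_d) (nu : 'M[F]_d -> F)
    (d_gt0 : (0 < d)%N) (d0_gt0 : (0 < d0)%N)
    (R_pd : pdmx R) (R0_pd : pdmx R0) (P0_pd : pdmx P0)
    (S_pd : pdmx (obs_S B R0)) (nu_norm : matrix_norm nu) :
  let P := kalman_cov A B R R0 P0 in
  [/\ forall N : nat, (1 <= N)%N -> forall E : enkf_input R R0 m0 P0 N,
      let p := @enkf_cov F d d0 A B R R0 m0 P0 N E in
      forall n : nat, (1 <= n)%N ->
        mx_integrable (Prob E) (p n) /\
        [/\ 0 <L R, R <=L mx_expectation (Prob E) (p n),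
            mx_expectation (Prob E) (p n) <=L P n
          & P n <=L A *m invmx (obs_S B R0) *m A^T + R],

      exists2 iota : F, 0 < iota &
      forall N : nat, (1 + d < N)%N -> forall E : enkf_input R R0 m0 P0 N,
      let p := @enkf_cov F d d0 A B R R0 m0 P0 N E in
      forall n : nat,
        [/\ mx_integrable (Prob E) (p n),
            0 <=L P n - mx_expectation (Prob E) (p n)
          & P n - mx_expectation (Prob E) (p n) <=L (iota / N%:R) *: 1%:M]

    & forall r : F, 1 <= r ->
      exists c : F,
      forall N : nat, (1 + d < N)%N -> forall E : enkf_input R R0 m0 P0 N,
      let p := @enkf_cov F d d0 A B R R0 m0 P0 N E in
      (ereal_sup [set 'E_(Prob E)[(fun w => nu (p n w - P n) `^ r)%R] `^ r^-1
                 | n in [set: nat]]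
         <= (c / Num.sqrt N%:R)%R%:E)%E].
Proof.
move=> P.
have covE N (E : enkf_input R R0 m0 P0 N) n :
    enkf_cov A B (S:=E) n = (fun w => sample_cov (free_particles A B (E:=E) n w)).
  by apply/funext => w; rewrite enkf_covE.
have Psymm n : (P n)^T = P n by apply: psd_symm; exact: kalman_psd.
have [rho [Cm [del [[rho0 Cm0 del0 del1] bounds]]]] := kalman_bounds A R_pd P0_pd S_pd.
have low n u : rho * sqnorm u <= qf (P n) u by case: (bounds n u).
have up n u : qf (P n) u <= Cm * sqnorm u by case: (bounds n u).
have dR n u : del * qf (P n.+1) u <= qf R u by case: (bounds n u).
split.
- move=> N N0 E p [//|n] _; rewrite /p covE.
  split; first exact: cov_integrable.
  split.
  + by split; [rewrite subr0; exact: pd_symm|move=> u u0; rewrite subr0; exact: pd_gt0].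
  + apply: loewner_leE; [exact: pd_symm|exact: Ecov_symm|].
    by move=> u; exact: Ecov_geR.
  + apply: loewner_leE; [exact: Ecov_symm|exact: Psymm|].
    by move=> u; exact: Ecov_le.
  + apply: loewner_leE; first exact: Psymm.
      rewrite linearD/= !trmx_mul trmxK (pd_symm R_pd) mulmxA.
      by rewrite (symm_inv (pd_symm S_pd)).
    by move=> u; apply: riccati_upper => //; exact: kalman_psd.
- have [K K0 HK] := uniform_envelope_moment A m0 R_pd R0_pd P0_pd S_pd rho0 del0 del1 (isT : (0 < 1)%N).
  pose c := mx_l1 (obs_S B R0) * (d%:R ^+ 3 * (3 * Cm) ^+ 2) * K.
  have c0 : 0 <= c.
    apply: mulr_ge0 => //; apply: mulr_ge0; first exact: mx_l1_ge0.
    by apply: mulr_ge0; [exact: exprn_ge0|exact: sqr_ge0].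
  have i0 : 0 <= c / (rho * del) * Cm.
    apply: mulr_ge0; last exact: ltW.
    by apply: divr_ge0 => //; apply: mulr_ge0; exact: ltW.
  exists (c / (rho * del) * Cm + 1); first by rewrite ltr_wpDl.
  move=> N Nd E p n; have N0 : (0 < N)%N by apply: leq_ltn_trans Nd.
  have NN : 0 < N%:R :> F by rewrite ltr0n.
  rewrite /p covE.
  have Es := Ecov_symm A B E n.
  have sD : (P n - mx_expectation (Prob E) (fun w => sample_cov (free_particles A B n w)))^T =
     P n - mx_expectation (Prob E) (fun w => sample_cov (free_particles A B n w)).
    by rewrite linearB/= Psymm Es.
  split; first exact: cov_integrable.
    apply: loewner_leE => //; first by rewrite linear0.
    move=> u; rewrite qfB /qf mulmx0 mul0mx mxE subr_ge0.
    exact: Ecov_le.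
  apply: loewner_leE => //; first by rewrite linearZ/= trmx1.
  move=> u; rewrite qfB qfZ qf1.
  have HK' k : (\int[Prob E]_w (envelope A B (E:=E) rho del k w ^+ 2)%:E <= (K / N%:R)%:E)%E.
    by have := HK N E N0 k; rewrite expr1.
  apply: le_trans (bias_le R_pd R0_pd P0_pd S_pd N0 rho0 Cm0 del0 del1 K0 low up dR HK' n u) _.
  rewrite -/c.
  have a0 : 0 <= c / (rho * del) / N%:R.
    apply: divr_ge0 => //; apply: divr_ge0 => //; apply: mulr_ge0; exact: ltW.
  apply: le_trans (ler_wpM2l a0 (up n u)) _.
  rewrite mulrA ler_wpM2r ?sqnorm_ge0//.
  rewrite [leLHS]mulrAC ler_wpM2r// ?invr_ge0 ?(ltW NN)//.
  by rewrite lerDl.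
- move=> r r1.
  have [c Hc] := norm_moment_le m0 R_pd R0_pd P0_pd S_pd rho0 del0 del1 Cm0 low up dR nu_norm r1.
  exists c; move=> N Nd E; cbv zeta; apply: ge_ereal_sup => _ [n _ <-].
  by apply: Hc; apply: leq_ltn_trans Nd.
Qed.
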